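(* Let $C>0$, $z>0$ and $z\le\min\{Ce^{-CC_\phi};\,2Ce^{-2CC_\phi}\}$. Then for any $G\in\mathcal L_C$ $$\bigl\|(T_n)^{[nt]}p_nG-p_n\widehat T_tG\bigr\|_{C,n}\to0,\quad n\to\infty,$$ for all $t\ge0$, uniformly on bounded intervals of $t$.
   Context: $\Gamma_0$ is the set of all finite subsets of $\mathbb R^d$, with the Lebesgue–Poisson measure $\lambda$: $\int_{\Gamma_0}G\,d\lambda=G(\emptyset)+\sum_{n\ge1}\frac1{n!}\int_{(\mathbb R^d)^n}G(\{x_1,\dots,x_n\})\,dx_1\cdots dx_n$; for bounded Borel $\Lambda$, $\Gamma(\Lambda)=\{\eta\in\Gamma_0:\eta\subset\Lambda\}$, with the restriction of $\lambda$. $|\eta|$ is the cardinality; $[\cdot]$ is the integer part. For $c>0$, $\mathcal L_c=L^1(\Gamma_0,c^{|\cdot|}d\lambda)$ with norm $\|\cdot\|_c$. $\phi:\mathbb R^d\setminus\{0\}\to[0,\infty)$ is a measurable even function with $C_\phi:=\int_{\mathbb R^d}(1-e^{-\phi(x)})\,dx<\infty$; $E^\phi(x,\xi)=\sum_{y\in\xi}\phi(x-y)$; $e_\lambda(f,\eta)=\prod_{x\in\eta}f(x)$, $e_\lambda(f,\emptyset)=1$. The operator $\widehat L$ in $\mathcal L_C$ with domain $\mathcal L_{2C}$ is $$(\widehat LG)(\eta)=-|\eta|G(\eta)+z\sum_{\xi\subset\eta}\int_{\mathbb R^d}e^{-E^\phi(x,\xi)}G(\xi\cup x)\,e_\lambda(e^{-\phi(x-\cdot)}-1,\eta\setminus\xi)\,dx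 ;$$ under the stated condition on $z$ it is closable and its closure generates a strongly continuous contraction semigroup $\widehat T_t$ on $\mathcal L_C$. For bounded Borel $\Lambda$ and $\delta\in(0,1)$, $$(\widehat P^\Lambda_\delta G)(\eta)=\sum_{\xi\subset\eta}(1-\delta)^{|\xi|}\int_{\Gamma(\Lambda)}(z\delta)^{|\omega|}G(\xi\cup\omega)\prod_{y\in\xi}e^{-E^\phi(y,\omega)}\prod_{y'\in\eta\setminus\xi}\bigl(e^{-E^\phi(y',\omega)}-1\bigr)d\lambda(\omega).$$ Fix bounded Borel sets $\Lambda_n$, $n\ge2$, with $\Lambda_n\subset\Lambda_{n+1}$ and $\bigcup_n\Lambda_n=\mathbb R^d$. $\mathcal L_{C,n}$ is the Banach space of measurable $G:\Gamma(\Lambda_n)\to\mathbb R$ with $\|G\|_{C,n}=\int_{\Gamma(\Lambda_n)}|G(\eta)|C^{|\eta|}d\lambda(\eta)<\infty$. $T_n:=\widehat P^{\Lambda_n}_{1/n}$, considered as a linear operator on $\mathcal L_{C,n}$ (i.e. with $\eta\in\Gamma(\Lambda_n)$). $p_n:\mathcal L_C\to\mathcal L_{C,n}$ is the cut-off $(p_nG)(\eta)=\mathbf 1_{\Gamma(\Lambda_n)}(\eta)G(\eta)$. *)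

(* Defs.v *)
From HB Require Import structures.
From mathcomp Require Import all_boot all_order all_algebra finmap.
From mathcomp Require Import all_classical all_reals all_analysis measurable_realfun.

Set Implicit Arguments.
Unset Strict Implicit.
Unset Printing Implicit Defensive.

Import Order.TTheory GRing.Theory Num.Def Num.Theory.
Import numFieldTopology.Exports numFieldNormedType.Exports.

Local Open Scope classical_set_scope.
Local Open Scope ring_scope.

Section tuple_power_measure.
Context {disp} {T : measurableType disp} {R : realType}.
Variable mu : {sigma_finite_measure set T -> \bar R}.

Definition tuple_cons n (p : T * n.-tuple T) : n.+1.-tuple T :=
  [tuple of p.1 :: p.2].

Lemma measurable_tuple_cons n : measurable_fun setT (@tuple_cons n).
Proof. exact: measurable_cons. Qed.

HB.instance Definition _ n :=
  isMeasurableFun.Build _ _ _ _ (@tuple_cons n) (@measurable_tuple_cons n).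

Section step.
Variables (n : nat) (m : {sigma_finite_measure set (n.-tuple T) -> \bar R}).

Definition cons_measure : set (n.+1.-tuple T) -> \bar R :=
  pushforward (mu \x m)%E (@tuple_cons n).

Let cons_measure0 : cons_measure set0 = 0%E.
Proof. by rewrite /cons_measure /pushforward preimage_set0 measure0. Qed.

Let cons_measure_ge0 A : (0 <= cons_measure A)%E.
Proof. exact: measure_ge0. Qed.

Let cons_measure_sigma_additive : semi_sigma_additive cons_measure.
Proof. exact: measure_semi_sigma_additive. Qed.

HB.instance Definition _ := isMeasure.Build _ _ _ cons_measure
  cons_measure0 cons_measure_ge0 cons_measure_sigma_additive.

Let cons_measure_sigma_finite : sigma_finite setT cons_measure.
Proof.
have /sigma_finiteP[F [FT ndF Foo]] := sigma_finiteT mu.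
have /sigma_finiteP[G [GT ndG Goo]] := sigma_finiteT m.
pose unc (t : n.+1.-tuple T) := (thead t, [tuple of behead t]).
have munc : measurable_fun setT unc.
  apply/measurable_fun_pairP; split; first exact: measurable_tnth.
  exact: measurable_behead.
have uncK : unc \o @tuple_cons n = id.
  by apply/funext => -[x t]; congr pair; apply/val_inj.
exists (fun k => unc @^-1` (F k `*` G k)).
  rewrite -preimage_bigcup (_ : \bigcup_k _ = setT) ?preimage_setT//.
  rewrite -subTset => -[x y] _; have [i _ Fx] : (\bigcup_i F i) x by rewrite -FT.
  have [j _ Gy] : (\bigcup_j G j) y by rewrite -GT.
  exists (maxn i j) => //; split => /=.
  - by move: x Fx; exact/subsetPset/ndF/leq_maxl.
  - by move: y Gy; exact/subsetPset/ndG/leq_maxr.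
move=> k; have [mF Fk] := Foo k; have [mG Gk] := Goo k; split.
  by rewrite -[X in measurable X]setTI; apply: munc => //; exact: measurableX.
rewrite /cons_measure /pushforward -comp_preimage uncK preimage_id.
by rewrite product_measure1E// lte_mul_pinfty// ge0_fin_numE.
Qed.

HB.instance Definition _ := Measure_isSigmaFinite.Build _ _ _ cons_measure
  cons_measure_sigma_finite.

End step.

Fixpoint tuple_measure n : {sigma_finite_measure set (n.-tuple T) -> \bar R} :=
  match n with
  | 0 => [the {sigma_finite_measure set (0.-tuple T) -> \bar R} of
            dirac [tuple]]
  | n'.+1 => [the {sigma_finite_measure set (n'.+1.-tuple T) -> \bar R} of
                cons_measure (tuple_measure n')]
  end.

End tuple_power_measure.

Section lebesgue_rV.
Context {R : realType} {d : nat}.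

Definition rV_display : measure_display.
Proof. exact: default_measure_display. Qed.

Definition rV_coord (i : 'I_d) (x : 'rV[R]_d) : measurableTypeR R := x ord0 i.

Let rV_set0 : g_sigma_preimage rV_coord set0.
Proof. exact: sigma_algebra0. Qed.

Let rV_setC A : g_sigma_preimage rV_coord A ->
  g_sigma_preimage rV_coord (~` A).
Proof. exact: sigma_algebraC. Qed.

Let rV_bigcup (F : _^nat) : (forall i, g_sigma_preimage rV_coord (F i)) ->
  g_sigma_preimage rV_coord (\bigcup_i (F i)).
Proof. exact: sigma_algebra_bigcup. Qed.

(* The product of the Borel sigma-algebras of the coordinates, which is the
   Borel sigma-algebra. *)
HB.instance Definition _ := @isMeasurable.Build rV_display
  'rV[R]_d (g_sigma_preimage rV_coord) rV_set0 rV_setC rV_bigcup.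

Definition tuple_row (t : d.-tuple (measurableTypeR R)) : 'rV[R]_d :=
  \row_i tnth t i.

Lemma measurable_tuple_row : measurable_fun setT tuple_row.
Proof.
move=> _ B mB; rewrite setTI.
have : preimage_set_system setT tuple_row (g_sigma_preimage rV_coord)
    (tuple_row @^-1` B) by exists B => //; rewrite setTI.
rewrite -g_sigma_preimage_comp; set f := (X in g_sigma_preimage X).
suff -> : f = (fun i t => tnth t i) by [].
by apply/funext => i; apply/funext => t; rewrite /f /= /rV_coord mxE.
Qed.

HB.instance Definition _ := isMeasurableFun.Build _ _ _ _ tuple_row
  measurable_tuple_row.

Definition lebesgue_rV : set 'rV[R]_d -> \bar R :=
  pushforward (tuple_measure (@lebesgue_measure R) d) tuple_row.

Let lebesgue_rV0 : lebesgue_rV set0 = 0%E.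
Proof. by rewrite /lebesgue_rV /pushforward preimage_set0 measure0. Qed.

Let lebesgue_rV_ge0 A : (0 <= lebesgue_rV A)%E.
Proof. exact: measure_ge0. Qed.

Let lebesgue_rV_sigma_additive : semi_sigma_additive lebesgue_rV.
Proof. exact: measure_semi_sigma_additive. Qed.

HB.instance Definition _ := isMeasure.Build _ _ _ lebesgue_rV
  lebesgue_rV0 lebesgue_rV_ge0 lebesgue_rV_sigma_additive.

Let lebesgue_rV_sigma_finite : sigma_finite setT lebesgue_rV.
Proof.
have [F FT Foo] := sigma_finiteT (tuple_measure (@lebesgue_measure R) d).
pose unrow (x : 'rV[R]_d) : d.-tuple (measurableTypeR R) :=
  [tuple rV_coord i x | i < d].
have munrow : measurable_fun setT unrow.
  apply/measurable_fun_tnthP => i.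
  rewrite (_ : _ \o _ = rV_coord i); last first.
    by apply/funext => x /=; rewrite tnth_mktuple.
  move=> _ B mB; apply: sub_sigma_algebra => /=.
  by rewrite -bigcup_seq/=; exists i; [rewrite /= mem_index_enum|exists B].
have unrowK : unrow \o tuple_row = id.
  apply/funext => t; apply/eq_from_tnth => i.
  by rewrite /= tnth_mktuple /rV_coord mxE.
exists (fun k => unrow @^-1` F k).
  by rewrite -preimage_bigcup -FT preimage_setT.
move=> k; have [mF Fk] := Foo k; split.
  by rewrite -[X in measurable X]setTI; exact: munrow.
by rewrite /lebesgue_rV /pushforward -comp_preimage unrowK preimage_id.
Qed.

HB.instance Definition _ := Measure_isSigmaFinite.Build _ _ _ lebesgue_rV
  lebesgue_rV_sigma_finite.

End lebesgue_rV.

Definition fconf (R : realType) (d : nat) := {fset 'rV[R]_d}.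

Section finite_configurations.
Context {R : realType} {d : nat}.
Local Notation fconf := (fconf R d).

HB.instance Definition _ := Choice.on fconf.
HB.instance Definition _ := isPointed.Build fconf fset0.

Definition conf_of_tuple n (t : n.-tuple 'rV[R]_d) : fconf :=
  [fset x in tval t]%fset.

Definition fconf_display : measure_display.
Proof. exact: default_measure_display. Qed.

(* The Borel sigma-algebra of the disjoint union of the n-point configuration
   spaces.  Tuples with repeated entries are not excluded: a set all of whose
   n-point parts are Borel pulls back to Borel sets on them as well. *)
Definition fconf_measurable : set (set fconf) :=
  [set A | forall n, measurable (@conf_of_tuple n @^-1` A)].

Let fconf_measurable0 : fconf_measurable set0.
Proof. by move=> n; rewrite preimage_set0. Qed.

Let fconf_measurableC A : fconf_measurable A -> fconf_measurable (~` A).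
Proof. by move=> mA n; rewrite preimage_setC; exact: (measurableC (mA n)). Qed.

Let fconf_measurable_bigcup (F : _^nat) : (forall i, fconf_measurable (F i)) ->
  fconf_measurable (\bigcup_i F i).
Proof.
move=> mF n; rewrite preimage_bigcup; apply: bigcupT_measurable => i.
exact: mF.
Qed.

HB.instance Definition _ := @isMeasurable.Build fconf_display fconf
  fconf_measurable fconf_measurable0 fconf_measurableC fconf_measurable_bigcup.

Lemma measurable_conf_of_tuple n : measurable_fun setT (@conf_of_tuple n).
Proof. by move=> _ B mB; rewrite setTI; exact: mB. Qed.

HB.instance Definition _ n := isMeasurableFun.Build _ _ _ _
  (@conf_of_tuple n) (@measurable_conf_of_tuple n).

Definition conf_measure n : set fconf -> \bar R :=
  pushforward (tuple_measure lebesgue_rV n) (@conf_of_tuple n).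

Let conf_measure0 n : conf_measure n set0 = 0%E.
Proof. by rewrite /conf_measure /pushforward preimage_set0 measure0. Qed.

Let conf_measure_ge0 n A : (0 <= conf_measure n A)%E.
Proof. exact: measure_ge0. Qed.

Let conf_measure_sigma_additive n : semi_sigma_additive (conf_measure n).
Proof. exact: measure_semi_sigma_additive. Qed.

HB.instance Definition _ n := isMeasure.Build _ _ _ (conf_measure n)
  (conf_measure0 n) (@conf_measure_ge0 n) (@conf_measure_sigma_additive n).

End finite_configurations.

Section lebesgue_poisson.
Context {R : realType} {d : nat}.
Local Notation fconf := (fconf R d).

Definition lebesgue_poisson : set fconf -> \bar R :=
  mseries (fun n => mscale (n`!%:R^-1)%:nng (conf_measure n)) 0.

HB.instance Definition _ := Measure.on lebesgue_poisson.

Lemma ge0_integral_lebesgue_poisson (G : fconf -> \bar R) :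
  measurable_fun [set: fconf] G -> (forall eta, 0 <= G eta)%E ->
  (\int[lebesgue_poisson]_eta G eta =
   \sum_(n <oo) ((n`!%:R^-1)%:E *
     \int[tuple_measure lebesgue_rV n]_t G (conf_of_tuple t)))%E.
Proof.
move=> mG G0; rewrite ge0_integral_measure_series//.
apply: eq_eseriesr => n _; rewrite ge0_integral_mscale//=; congr (_ * _)%E.
by rewrite (ge0_integral_pushforward (measurable_conf_of_tuple (n:=n))).
Qed.

End lebesgue_poisson.

(* [E] is a linear subspace of [V] on which [N] is a finite seminorm; the
   Banach space meant is [E] modulo the null space of [N].  In this section
   changing vectors of [E] by null vectors of [E] makes no difference. *)

Section semigroups.
Context {R : realType} {V : lmodType R} (E : set V) (N : V -> \bar R).

Record contraction_semigroup (T : R -> V -> V) : Prop := ContractionSemigroup {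
  semigroup_stable : forall t u, 0 <= t -> E u -> E (T t u) ;
  semigroup_linear : forall t a u v, 0 <= t -> E u -> E v ->
    N (T t (a *: u + v) - (a *: T t u + T t v)) = 0%E ;
  semigroup_id : forall u, E u -> N (T 0 u - u) = 0%E ;
  semigroup_add : forall s t u, 0 <= s -> 0 <= t -> E u ->
    N (T (s + t) u - T s (T t u)) = 0%E ;
  semigroup_contraction : forall t u, 0 <= t -> E u -> (N (T t u) <= N u)%E ;
  semigroup_continuous : forall u, E u -> N (T t u - u) @[t --> 0^'+] --> 0%E
}.

Definition generator_graph (T : R -> V -> V) : set (V * V) :=
  [set p | [/\ E p.1, E p.2 &
    N (t^-1 *: (T t p.1 - p.1) - p.2) @[t --> 0^'+] --> 0%E]].

Definition closure_graph (D : set V) (A : V -> V) : set (V * V) :=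
  [set p | [/\ E p.1, E p.2 & exists F : V^nat, [/\ forall k, D (F k),
    N (F k - p.1) @[k --> \oo] --> 0%E &
    N (A (F k) - p.2) @[k --> \oo] --> 0%E]]].

Definition closable (D : set V) (A : V -> V) : Prop :=
  forall w, closure_graph D A (0, w) -> N w = 0%E.

Definition semigroup_of_closure (D : set V) (A : V -> V) (T : R -> V -> V) :=
  [/\ closable D A, contraction_semigroup T &
      generator_graph T = closure_graph D A].

End semigroups.

(* Elements of the [L^1]-spaces are represented by everywhere defined
   functions, and functions on [confs_in Lambda] by functions on all finite
   configurations whose values off [confs_in Lambda] play no role. *)
Definition obs (R : realType) (d : nat) := fconf R d -> R^o.

Section glauber.
Context {R : realType} {d : nat}.
Local Notation Rd := 'rV[R]_d.
Local Notation fconf := (fconf R d).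
Local Notation obs := (obs R d).

Definition confs_in (Lambda : set Rd) : set fconf :=
  [set eta | [set` eta] `<=` Lambda].

Definition L1norm_on (D : set fconf) (c : R) (G : obs) : \bar R :=
  (\int[lebesgue_poisson]_(eta in D) (`|G eta| * c ^+ #|` eta|%fset)%:E)%E.

Definition L1norm (c : R) (G : obs) : \bar R := L1norm_on setT c G.

Definition L1 (c : R) : set obs :=
  [set G | measurable_fun setT G /\ (L1norm c G < +oo)%E].

Variable phi : Rd -> R.

Definition C_phi : \bar R := (\int[lebesgue_rV]_x (1 - expR (- phi x))%:E)%E.

Definition energy (x : Rd) (xi : fconf) : R := \sum_(y <- xi) phi (x - y).

Definition e_lambda (f : Rd -> R) (eta : fconf) : R := \prod_(x <- eta) f x.

Definition Lhat (z : R) (G : obs) : obs := fun eta =>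
  - (#|` eta|%fset%:R * G eta) +
  z * \sum_(xi <- fpowerset eta)
        \int[lebesgue_rV]_x
          (expR (- energy x xi) * G (x |` xi)%fset *
           e_lambda (fun y => expR (- phi (x - y)) - 1) (eta `\` xi)%fset).

Definition Phat (z : R) (Lambda : set Rd) (delta : R) (G : obs) : obs :=
  fun eta => \sum_(xi <- fpowerset eta)
    (1 - delta) ^+ #|` xi|%fset *
    \int[lebesgue_poisson]_(omega in confs_in Lambda)
      ((z * delta) ^+ #|` omega|%fset * G (xi `|` omega)%fset *
       (\prod_(y <- xi) expR (- energy y omega)) *
       (\prod_(y <- (eta `\` xi)%fset) (expR (- energy y omega) - 1))).

Definition cutoff (Lambda : set Rd) (G : obs) : obs :=
  fun eta => \1_(confs_in Lambda) eta * G eta.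

(* [Phat] as an operator on functions on [confs_in Lambda], extended by 0 *)
Definition Phat_on (z : R) (Lambda : set Rd) (delta : R) (G : obs) : obs :=
  cutoff Lambda (Phat z Lambda delta G).

End glauber.

(* Main.v *)
(* A Trotter-type argument.  The iterates of the contractions T_n are compared
   with the semigroup over short times h: the orbit of a vector u of the domain
   of the generator is totally bounded, so it is followed, up to an error of
   order o(h), by finitely many vectors of the core L_{2C}, on which
   n (T_n - 1) converges to the generator.  Since all the operators are
   contractions, the errors of the blocks of length h add up to o(1).

   Contractivity and consistency come from one bound.  Both operators have the
   form
     (K_a G)(eta) = sum_{xi <= eta} int a(xi, omega) G(xi u omega)
       prod_{y in xi} e^{-E(y, omega)}
       prod_{y in eta \ xi} (e^{-E(y, omega)} - 1) d lambda(omega),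
   and by Minlos' lemma, applied twice,
     ||K_a G||_C <= int |G(eta)| sum_{xi <= eta} |a(xi, eta \ xi)| C^{|xi|}
                      kappa^{|eta \ xi|} d lambda(eta),   kappa = e^{C C_phi}.
   As z kappa <= C, the weight in the integrand is at most C^{|eta|} for T_n; for
   n (T_n - 1) - L it is at most 2 (2C)^{|eta|} and tends to 0 pointwise, so that
   dominated convergence applies. *)

Require Import Defs.
From mathcomp Require Import all_boot all_order all_algebra finmap.
From mathcomp Require Import all_classical all_reals all_analysis measurable_realfun.
From mathcomp Require Import lra.

Import Order.TTheory GRing.Theory Num.Theory.
Import numFieldTopology.Exports numFieldNormedType.Exports.

Set Implicit Arguments.
Unset Strict Implicit.
Unset Printing Implicit Defensive.

Local Open Scope classical_set_scope.
Local Open Scope ring_scope.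

(** * Approximation of contraction semigroups *)

Section seminorms.
Context {R : realType} {V : lmodType R} (E : set V).

(** The core [L1 (2 * C)] need not be invariant under the semigroup, so consistency cannot be used
    along an orbit directly. If [u] has image [v] under the generator, the pairs [(T s u, T s v)]
    are approximated in the graph norm by core pairs, finitely many of which serve all [s] in a
    bounded interval. Over a block of length [h] both evolutions move [T s u] by [h *: T s v] up to
    an error of order o(h); on the discrete side this requires that the iterates move the
    first-order term [T s v] only a little during the block. All comparisons take place in one
    vector space. T_n is extended by 0 to configurations outside its domain, and the norm of L_{C,n}
    becomes a seminorm [m n] below the norm [r], which makes the cut-offs disappear until the very
    end. An integral that diverges has a junk value. This can happen on null sets, so the operators
    are linear only up to null vectors, and every algebraic law is stated through a seminorm that
    vanishes. *)

Definition is_subspace := E 0 /\ forall (a : R) u v, E u -> E v -> E (a *: u + v).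

Record seminorm_on (r : V -> R) : Prop := SeminormOn {
  seminorm_ge0 : forall u, 0 <= r u ;
  seminorm_triangle : forall u v, E u -> E v -> r (u + v) <= r u + r v ;
  seminormZ : forall a u, E u -> r (a *: u) = `|a| * r u }.

Hypothesis Esub : is_subspace.

Lemma subspaceZ a u : E u -> E (a *: u).
Proof. by move=> Eu; rewrite -[_ *: _]addr0; apply: Esub.2 => //; exact: Esub.1. Qed.

Lemma subspaceD u v : E u -> E v -> E (u + v).
Proof. by move=> Eu Ev; rewrite -[u]scale1r; apply: Esub.2. Qed.

Lemma subspaceB u v : E u -> E v -> E (u - v).
Proof.
by move=> Eu Ev; rewrite addrC -[- v]scaleN1r; apply: Esub.2.
Qed.

Section one_seminorm.
Variable r : V -> R.
Hypothesis rS : seminorm_on r.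

Lemma seminorm0 : r 0 = 0.
Proof. by rewrite -(scale0r (0 : V)) (seminormZ rS) ?normr0 ?mul0r//; exact: Esub.1. Qed.

Lemma seminorm_subC u v : E u -> E v -> r (u - v) = r (v - u).
Proof.
move=> Eu Ev; rewrite -opprB -[- (v - u)]scaleN1r (seminormZ rS) ?normrN1 ?mul1r//.
exact: subspaceB.
Qed.

Lemma seminorm_dist u v w : E u -> E v -> E w -> r (u - w) <= r (u - v) + r (v - w).
Proof.
move=> Eu Ev Ew; rewrite -[u](subrK v) -addrA addrK.
by apply: (seminorm_triangle rS); exact: subspaceB.
Qed.

Lemma seminorm_le_dist u v : E u -> E v -> r u <= r (u - v) + r v.
Proof.
move=> Eu Ev; rewrite -{1}[u](subrK v).
by apply: (seminorm_triangle rS) => //; exact: subspaceB.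
Qed.

Lemma seminorm_distD u v u' v' : E u -> E v -> E u' -> E v' ->
  r ((u + v) - (u' + v')) <= r (u - u') + r (v - v').
Proof.
move=> Eu Ev Eu' Ev'; rewrite opprD addrACA.
by apply: (seminorm_triangle rS); exact: subspaceB.
Qed.

Lemma seminorm_eq0_dist u v : E u -> E v -> r (u - v) = 0 -> r u = r v.
Proof.
move=> Eu Ev uv0; apply/eqP; rewrite eq_le; apply/andP; split.
  by have := seminorm_le_dist Eu Ev; rewrite uv0 add0r.
by have := seminorm_le_dist Ev Eu; rewrite (seminorm_subC Ev Eu) uv0 add0r.
Qed.

End one_seminorm.

Section contraction.
Variables (r : V -> R) (S : V -> V).
Hypothesis rS : seminorm_on r.
Hypothesis SE : forall u, E u -> E (S u).
Hypothesis S_lin : forall (a : R) u v, E u -> E v ->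
  r (S (a *: u + v) - (a *: S u + S v)) = 0.
Hypothesis S_le : forall u, E u -> r (S u) <= r u.

(** [S u - S v] and [S (u - v)] differ by a null vector, hence have the same seminorm. *)
Lemma contractive_dist u v : E u -> E v -> r (S u - S v) <= r (u - v).
Proof.
move=> Eu Ev; have Euv : E (u - v) by exact: subspaceB.
have := S_lin (-1) Ev Eu; rewrite !scaleN1r [- v + u]addrC [- S v + _]addrC => e.
rewrite -(seminorm_eq0_dist rS _ _ e); first exact: S_le.
- exact: SE.
- by apply: subspaceB; exact: SE.
Qed.

Lemma contractive_affine x y w (c : R) : E x -> E y -> E w ->
  r (S x - S y - c *: S w) <= r (x - y - c *: w).
Proof.
move=> Ex Ey Ew.
rewrite -!addrA -!opprD ![_ + c *: _]addrC.
apply: (le_trans (seminorm_dist rS (v := S (c *: w + y)) _ _ _)).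
- exact: SE.
- by apply/SE/Esub.2.
- by apply: Esub.2; exact: SE.
by rewrite S_lin// addr0; apply: contractive_dist => //; exact: Esub.2.
Qed.

Lemma iter_E k u : E u -> E (iter k S u).
Proof. by move=> Eu; elim: k => //= k; exact: SE. Qed.

Lemma iter_dist k u v : E u -> E v -> r (iter k S u - iter k S v) <= r (u - v).
Proof.
move=> Eu Ev; elim: k => //= k; apply: le_trans.
by apply: contractive_dist; exact: iter_E.
Qed.

Lemma iter_increment k u : E u -> r (iter k S u - u) <= k%:R * r (S u - u).
Proof.
move=> Eu; elim: k => [|k IH].
  by rewrite /= subrr mul0r (seminorm0 rS).
rewrite -addn1 natrD mulrDl mul1r addn1 iterSr.
apply: (le_trans (seminorm_dist rS (v := iter k S u) _ _ _)) => //.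
- by apply: iter_E; exact: SE.
- exact: iter_E.
by rewrite addrC lerD//; apply: iter_dist => //; exact: SE.
Qed.

(** A discrete mean value inequality: [S^k u - u] is the sum of the [S^j (S u - u)] for [j < k],
    where [S u - u] is within [b] of [e *: w] and [S^j w] is within [c] of [w]. It is applied both
    to the discrete operators and to [T t] for small [t]. *)
Lemma iter_increment_linear k (e b c : R) u w : E u -> E w -> 0 <= e ->
  r (S u - u - e *: w) <= b ->
  (forall j, (j < k)%N -> r (iter j S w - w) <= c) ->
  r (iter k S u - u - (k%:R * e) *: w) <= k%:R * (b + e * c).
Proof.
move=> Eu Ew e0 hb; elim: k => [_|k IH hc].
  by rewrite /= subrr sub0r !mul0r scale0r oppr0 (seminorm0 rS).
have Sk x : E x -> E (iter k S x) by exact: iter_E.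
have ESu := SE Eu.
rewrite -addn1 natrD !mulrDl !mul1r addn1 iterSr.
have -> : iter k S (S u) - u - (k%:R * e + e) *: w =
    (iter k S u - u - (k%:R * e) *: w) + (iter k S (S u) - iter k S u - e *: w).
  rewrite [RHS]addrACA scalerDl opprD; congr (_ + _).
  by rewrite addrC subrKA.
apply: (le_trans (seminorm_triangle rS _ _)).
- by apply: subspaceB; [apply: subspaceB => //; exact: Sk|exact: subspaceZ].
- by apply: subspaceB; [apply: subspaceB; exact: Sk|exact: subspaceZ].
apply: lerD; first by apply: IH => j jk; apply: hc; rewrite ltnS ltnW.
have Eew : E (e *: w) by exact: subspaceZ.
have E1 : E (u + e *: w) by exact: subspaceD.
(* Linearity up to null vectors passes to iterates, because a contraction maps vectors at distance 0
   to vectors at distance 0. *)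
have lin : r (iter k S (e *: w + u) - (e *: iter k S w + iter k S u)) = 0.
  clear -rS SE S_lin S_le Eu Ew Esub.
  elim: k => [|k IH] /=; first by rewrite subrr (seminorm0 rS).
  have Ex : E (iter k S (e *: w + u)) by apply: iter_E; apply: Esub.2.
  have Ey : E (e *: iter k S w + iter k S u) by apply: Esub.2; exact: iter_E.
  apply/eqP; rewrite eq_le (seminorm_ge0 rS) andbT.
  apply: (le_trans (seminorm_dist rS (v := S (e *: iter k S w + iter k S u)) _ _ _)).
  - exact: SE.
  - exact: SE.
  - by apply: Esub.2; apply: SE; exact: iter_E.
  rewrite S_lin ?addr0; [|exact: iter_E|exact: iter_E].
  by rewrite -IH; exact: contractive_dist.
have Ei : E (e *: iter k S w + iter k S u) by apply: Esub.2; exact: Sk.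
apply: (le_trans (_ : _ <= r (iter k S (S u) - iter k S (e *: w + u)) +
    r (iter k S (e *: w + u) - (e *: w + iter k S u)))).
  rewrite -[X in r X <= _]addrA -opprD [iter k S u + _]addrC.
  apply: seminorm_dist => //; [exact: Sk|by apply: Sk; apply: Esub.2|].
  by apply: subspaceD => //; exact: Sk.
apply: lerD.
  apply: (le_trans (iter_dist _ _ _)) => //; first exact: Esub.2.
  by rewrite opprD addrA addrAC.
apply: (le_trans (seminorm_dist rS (v := e *: iter k S w + iter k S u) _ _ _)) => //.
- by apply: Sk; apply: Esub.2.
- by apply: subspaceD => //; exact: Sk.
rewrite lin add0r opprD addrACA subrr addr0 -scalerBr (seminormZ rS); last first.
  by apply: subspaceB => //; exact: Sk.
by rewrite ger0_norm// ler_wpM2l// hc.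
Qed.

End contraction.
End seminorms.

Lemma near_forall_lt (P : nat -> nat -> Prop) N :
  (forall i, \forall n \near \oo, P i n) ->
  \forall n \near \oo, forall i, (i < N)%N -> P i n.
Proof.
move=> HP; elim: N => [|N IH]; first by near=> n.
near=> n => i; rewrite ltnS leq_eqVlt => /orP[/eqP ->|iN].
- by near: n; exact: HP.
- by move: i iN; near: n.
Unshelve. all: by end_near. Qed.

(** * Comparison of discrete iterates with the semigroup *)

Section trotter_approximation.
Context {R : realType} {V : lmodType R} (E : set V).
Hypothesis Esub : is_subspace E.
Variables (r : V -> R) (m : nat -> V -> R).
Hypothesis rS : seminorm_on E r.
Hypothesis mS : forall n, seminorm_on E (m n).
Hypothesis m_le : forall n u, E u -> m n u <= r u.
Variable S : nat -> V -> V.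
Hypothesis SE : forall n, (1 < n)%N -> forall u, E u -> E (S n u).
(* Operators given by integrals are linear only up to null vectors. *)
Hypothesis S_lin : forall n, (1 < n)%N -> forall (a : R) u v, E u -> E v ->
  m n (S n (a *: u + v) - (a *: S n u + S n v)) = 0.
Hypothesis S_le : forall n, (1 < n)%N -> forall u, E u -> m n (S n u) <= m n u.
Variable T : R -> V -> V.
Hypothesis TE : forall t : R, 0 <= t -> forall u, E u -> E (T t u).
Hypothesis T_lin : forall t : R, 0 <= t -> forall (a : R) u v, E u -> E v ->
  r (T t (a *: u + v) - (a *: T t u + T t v)) = 0.
Hypothesis T_id : forall u, E u -> r (T 0 u - u) = 0.
Hypothesis T_add : forall (s t : R) u, 0 <= s -> 0 <= t -> E u ->
  r (T (s + t) u - T s (T t u)) = 0.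
Hypothesis T_le : forall t : R, 0 <= t -> forall u, E u -> r (T t u) <= r u.
Hypothesis T_cont : forall u (eta : R), E u -> 0 < eta ->
  exists2 h, 0 < h & forall t, 0 <= t <= h -> r (T t u - u) <= eta.

Let T_dist t u v : 0 <= t -> E u -> E v -> r (T t u - T t v) <= r (u - v).
Proof.
move=> t0 Eu Ev; exact: (contractive_dist Esub rS (TE t0) (T_lin t0) (T_le t0)).
Qed.

Let T_sub s t u : 0 <= s -> 0 <= t -> E u ->
  r (T (s + t) u - T s u) <= r (T t u - u).
Proof.
move=> s0 t0 Eu; have st0 := addr_ge0 s0 t0.
apply: (le_trans (seminorm_dist Esub rS (v := T s (T t u)) _ _ _));
  [exact: TE|by apply: TE => //; exact: TE|exact: TE|].
by rewrite T_add// add0r T_dist//; exact: TE.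
Qed.

Definition in_generator (u v : V) := [/\ E u, E v & forall eta, 0 < eta ->
  exists2 h, 0 < h & forall t, 0 < t <= h -> r (T t u - u - t *: v) <= eta * t].

Let iter_T k t u : 0 <= t -> E u -> r (iter k (T t) u - T (k%:R * t) u) = 0.
Proof.
move=> t0 Eu; apply/eqP; rewrite eq_le (seminorm_ge0 rS) andbT.
elim: k => [|k IH].
  by rewrite mul0r /= (seminorm_subC Esub rS) ?T_id//; exact: TE.
have kt0 : 0 <= k%:R * t by rewrite mulr_ge0.
have Ek : E (iter k (T t) u) by apply: iter_E => //; exact: TE.
rewrite /= -addn1 natrD mulrDl mul1r [k%:R * t + t]addrC.
apply: (le_trans (seminorm_dist Esub rS (v := T t (T (k%:R * t) u)) _ _ _)).
- exact: TE.
- by apply: TE => //; exact: TE.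
- by apply: TE => //; rewrite addr_ge0.
rewrite [X in _ + X](seminorm_subC Esub rS); last 2 first.
- by apply: TE => //; exact: TE.
- by apply: TE => //; rewrite addr_ge0.
rewrite T_add// addr0.
by apply: le_trans IH; apply: T_dist => //; exact: TE.
Qed.

(** It stands in for the formula that [T h u - u] is the integral of [T s v] over [[0, h]], without
    vector-valued integrals: [h] is cut into [K] equal steps and [iter_increment_linear] is applied
    to [T (h / K)]. *)
Lemma generator_mean_value u v h eta : in_generator u v -> 0 <= h ->
  (forall t, 0 <= t <= h -> r (T t v - v) <= eta) ->
  r (T h u - u - h *: v) <= h * eta.
Proof.
move=> [Eu Ev guv] h0 hv; apply/ler_addgt0Pl => e e0.
(* The [K] steps of length [t = h / K] accumulate the error [h * (e / (h + 1)) <= e]; the summand 1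
   allows [h = 0]. *)
have h10 : 0 < h + 1 by rewrite ltr_wpDl.
have [h1 h1_gt0 hh1] := guv _ (divr_gt0 e0 h10).
pose K := (Num.truncn (h / h1)).+1.
have K0 : 0 < K%:R :> R by rewrite ltr0n.
pose t := h / K%:R.
have t0 : 0 <= t by rewrite divr_ge0// ltW.
have Kt : K%:R * t = h by rewrite mulrC divfK// gt_eqF.
have t_le : t <= h1.
  rewrite ler_pdivrMr// mulrC -ler_pdivrMr//.
  by apply: ltW; exact: truncnS_gt.
have tb : r (T t u - u - t *: v) <= e / (h + 1) * t.
  move: t0; rewrite le_eqVlt => /predU1P[<-|t0]; last by rewrite hh1// t0.
  by rewrite scale0r subr0 mulr0 T_id.
have EK : E (iter K (T t) u) by apply: iter_E => //; exact: TE.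
have ETh : E (T h u) by exact: TE.
have bound : r (iter K (T t) u - u - h *: v) <= K%:R * (e / (h + 1) * t + t * eta).
  rewrite -{1}Kt; apply: (iter_increment_linear Esub rS (TE t0) (T_lin t0) (T_le t0)) => //.
  move=> j jK; have jt0 : 0 <= j%:R * t by rewrite mulr_ge0.
  have Ej : E (iter j (T t) v) by apply: iter_E => //; exact: TE.
  apply: (le_trans (seminorm_dist Esub rS (v := T (j%:R * t) v) _ _ _)) => //.
    exact: TE.
  rewrite iter_T// add0r hv// jt0/= -Kt ler_wpM2r// ler_nat ltnW//.
apply: (le_trans (_ : _ <= r (T h u - iter K (T t) u) + r (iter K (T t) u - u - h *: v))).
  rewrite -!addrA -!opprD.
  by apply: (seminorm_dist Esub rS) => //; apply: subspaceD => //; exact: subspaceZ.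
have -> : r (T h u - iter K (T t) u) = 0.
  by rewrite (seminorm_subC Esub rS)// -{1}Kt iter_T.
rewrite add0r (le_trans bound)//.
have qh : h * (e / (h + 1)) <= e.
  by rewrite mulrCA ger_pMr// ler_pdivrMr// mul1r lerDl.
set q := e / (h + 1) in qh *; clearbody q.
have -> : K%:R * (q * t + t * eta) = h * q + h * eta by rewrite -Kt; lra.
lra.
Qed.

(** [T s] commutes with [T t] up to null vectors and is a contraction, so the estimate for [u] is
    inherited by [T s u]. This is what makes core approximations available at every time of the
    orbit. *)
Let gen_T s u v : 0 <= s -> in_generator u v -> in_generator (T s u) (T s v).
Proof.
move=> s0 [Eu Ev guv]; split; [exact: TE|exact: TE|] => eta eta0.
have [h h0 hh] := guv _ eta0; exists h => // t th.
have t0 : 0 <= t by case/andP: th => /ltW.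
have Etu : E (T t u) by exact: TE.
apply: le_trans (hh _ th).
apply: le_trans (contractive_affine Esub rS (TE s0) (T_lin s0) (T_le s0) t Etu Eu Ev).
rewrite -!addrA -!opprD.
have Esuv : E (T s u + t *: T s v).
  by apply: subspaceD => //; [exact: TE|apply: subspaceZ => //; exact: TE].
have Ets : E (T t (T s u)) by apply: TE => //; exact: TE.
have Est : E (T s (T t u)) by exact: TE.
apply: (le_trans (seminorm_dist Esub rS (v := T s (T t u)) _ _ _)) => //.
rewrite gerDr.
have Ets' : E (T (t + s) u) by apply: TE => //; exact: addr_ge0.
apply: (le_trans (seminorm_dist Esub rS (v := T (t + s) u) _ _ _)) => //.
by rewrite (seminorm_subC Esub rS)// T_add// add0r [t + s]addrC T_add.
Qed.

(** Continuity at time 0 is enough, since [T s v - T (i * h) v] is at most as large as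
    [T (s - i * h) v - v]. Net times lie below [s], so that they stay in [[0, tau]]. *)
Let orbit_net v tau rho : E v -> 0 < rho ->
  exists h N, 0 < h /\ forall s : R, 0 <= s <= tau -> exists i,
    [/\ (i < N)%N, i%:R * h <= s & r (T s v - T (i%:R * h) v) <= rho].
Proof.
move=> Ev rho0; have [h h0 hv] := T_cont Ev rho0.
exists h, (Num.truncn (tau / h)).+1; split => // s /andP[s0 st].
have sh0 : 0 <= s / h by rewrite divr_ge0// ltW.
have /andP[] := truncn_itv sh0.
rewrite ler_pdivlMr// ltr_pdivrMr// => h1 h2.
exists (Num.truncn (s / h)); split => //.
  by rewrite ltnS le_truncn// ler_pM2r// invr_gt0.
have {1}-> : s = (Num.truncn (s / h))%:R * h + (s - (Num.truncn (s / h))%:R * h).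
  by rewrite addrC subrK.
rewrite (le_trans (T_sub _ _ Ev))//; first by rewrite mulr_ge0// ltW.
  by rewrite subr_ge0.
apply: hv; rewrite subr_ge0 h1/= lerBlDl (le_trans (ltW h2))//.
by rewrite -addn1 natrD mulrDl mul1r.
Qed.

Variables (D : set V) (A : V -> V).
Hypothesis DE : D `<=` E.
Hypothesis AE : forall u, D u -> E (A u).
Hypothesis consistency : forall u eta, D u -> 0 < eta ->
  \forall n \near \oo, m n (n%:R *: (S n u - u) - A u) <= eta.
Hypothesis D_dense : forall u eta, E u -> 0 < eta ->
  exists2 w, D w & r (u - w) <= eta.
Hypothesis D_generator : forall u, D u -> in_generator u (A u).
Hypothesis D_core : forall u v eta, in_generator u v -> 0 < eta ->
  exists w, [/\ D w, r (u - w) <= eta & r (v - A w) <= eta].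

Let consistency_step u eta : D u -> 0 < eta ->
  \forall n \near \oo, m n (S n u - u - n%:R^-1 *: A u) <= eta / n%:R.
Proof.
move=> Du eta0; near=> n.
have n1 : (1 < n)%N by near: n; exact: nbhs_infty_gt.
have n0 : 0 < n%:R :> R by rewrite ltr0n ltnW.
have Eu := DE Du; have EA := AE Du.
have ES : E (S n u - u) by apply: subspaceB => //; exact: SE.
have : m n (n%:R *: (S n u - u) - A u) <= eta by near: n; exact: consistency.
have -> : n%:R *: (S n u - u) - A u = n%:R *: (S n u - u - n%:R^-1 *: A u).
  by rewrite [RHS]scalerBr scalerA mulfV ?scale1r// gt_eqF.
rewrite (seminormZ (mS n)); last by apply: subspaceB => //; exact: subspaceZ.
by rewrite gtr0_norm// ler_pdivlMr// mulrC.
Unshelve. all: by end_near. Qed.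

(** One step moves [u] by about [A u / n]; the summand 1 absorbs the consistency error. The
    threshold for [n] does not depend on [k]. *)
Let slow_on_core u : D u -> \forall n \near \oo, forall k,
  m n (iter k (S n) u - u) <= k%:R / n%:R * (r (A u) + 1).
Proof.
move=> Du; have := consistency_step Du ltr01.
apply: filterS2 (nbhs_infty_gt 1) => n n1 hn k.
have n0 : 0 < n%:R :> R by rewrite ltr0n ltnW.
have Eu := DE Du; have EA := AE Du.
apply: (le_trans (iter_increment Esub (mS n) (SE n1) (S_lin n1) (S_le n1) k Eu)).
rewrite -mulrA ler_wpM2l//.
apply: (le_trans (seminorm_le_dist Esub (mS n) (v := n%:R^-1 *: A u) _ _)).
- by apply: subspaceB => //; exact: SE.
- exact: subspaceZ.
rewrite (seminormZ (mS n))// ger0_norm ?invr_ge0//.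
by rewrite mulrDr mulr1 addrC lerD// ?ler_wpM2l ?invr_ge0 ?m_le//; rewrite div1r in hn.
Qed.

Let iter_dist3 n k u w eta : (1 < n)%N -> E u -> E w -> r (u - w) <= eta ->
  m n (iter k (S n) u - u) <= 2 * eta + m n (iter k (S n) w - w).
Proof.
move=> n1 Eu Ew uw.
have muw : m n (u - w) <= eta by apply: le_trans uw; apply: m_le; exact: subspaceB.
have Eku : E (iter k (S n) u) by apply: iter_E => //; exact: SE.
have Ekw : E (iter k (S n) w) by apply: iter_E => //; exact: SE.
have h1 := iter_dist Esub (mS n) (SE n1) (S_lin n1) (S_le n1) k Eu Ew.
have h2 := seminorm_dist Esub (mS n) Eku Ekw Eu.
have h3 := seminorm_dist Esub (mS n) Ekw Ew Eu.
rewrite (seminorm_subC Esub (mS n) Ew Eu) in h3.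
lra.
Qed.

(** Here [v] is an arbitrary vector of [E]. The finite net and density reduce uniformity in [s] to
    finitely many core vectors, for which [slow_on_core] holds. *)
Let slow_on_orbit v tau eta : E v -> 0 < eta ->
  exists2 h : R, 0 < h & \forall n \near \oo, forall s : R, 0 <= s <= tau ->
    forall k, k%:R / n%:R <= h -> m n (iter k (S n) (T s v) - T s v) <= eta.
Proof.
move=> Ev eta0; have e8 : 0 < eta / 8 by rewrite divr_gt0.
have [h0 [N [h0_gt0 net]]] := orbit_net tau Ev e8.
have /choice[w Hw] : forall i : nat, exists w, D w /\ r (T (i%:R * h0) v - w) <= eta / 8.
  move=> i; have Ei : E (T (i%:R * h0) v) by apply: TE => //; rewrite mulr_ge0// ltW.
  by have [w Dw hw] := D_dense Ei e8; exists w.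
(* [M] bounds all [r (A (w i)) + 1], so core vectors move by at most [eta / 2] up to time
   [eta / (2 * M)]. Replacing [T s v] by [w i], within [eta / 4] of it, costs another [eta / 2]. *)
pose M := \sum_(i < N) (r (A (w i)) + 1) + 1.
have M0 : 0 < M.
  by rewrite ltr_wpDl// sumr_ge0// => i _; rewrite addr_ge0// (seminorm_ge0 rS).
exists (eta / (2 * M)); first by rewrite divr_gt0// mulr_gt0.
have := near_forall_lt N (fun i => slow_on_core (Hw i).1).
apply: filterS2 (nbhs_infty_gt 1) => n n1 hn s sst k kn.
have [i [iN is_ hi]] := net _ sst.
have Es : E (T s v) by apply: TE => //; case/andP: sst.
have Ei : E (T (i%:R * h0) v) by apply: TE => //; rewrite mulr_ge0// ltW.
have Ew : E (w i) by exact/DE/(Hw i).1.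
have hd := seminorm_dist Esub rS Es Ei Ew.
have sw : r (T s v - w i) <= eta / 4 by have := (Hw i).2; lra.
have := iter_dist3 k n1 Es Ew sw.
have := hn _ iN k.
have kM : k%:R / n%:R * (r (A (w i)) + 1) <= eta / 2.
  apply: (@le_trans _ _ (eta / (2 * M) * M)).
    apply: ler_pM => //; first by rewrite addr_ge0// (seminorm_ge0 rS).
    rewrite /M (bigD1 (Ordinal iN))//= -addrA lerDl addr_ge0// sumr_ge0// => j _.
    by rewrite addr_ge0// (seminorm_ge0 rS).
  by rewrite invfM mulrA divfK// gt_eqF.
lra.
Qed.

(* For [s] in [[0, tau]], [T s u] and [T s v] are replaced by [w i] and [A (w i)]
   with [w i] taken from a finite subset of the core, so that consistency is
   needed for finitely many vectors only, although [s] varies. *)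
Let short_time_error u v (tau eta : R) : in_generator u v -> 0 < eta ->
  exists2 h : R, 0 < h <= 1 & \forall n \near \oo, forall s : R, 0 <= s <= tau ->
    forall k, k%:R / n%:R <= h ->
    m n (iter k (S n) (T s u) - T (s + k%:R / n%:R) u) <= eta * h.
Proof.
move=> guv eta0; have [Eu Ev _] := guv.
(* The bounds [b2], [b3], [b4] and [b7] below contribute 2, 4, 2 and 2 times [e * h]. *)
pose e := eta / 10; have e0 : 0 < e by rewrite divr_gt0.
have [h1 h1_gt0 slow] := slow_on_orbit tau Ev e0.
have [h2 h2_gt0 hv] := T_cont Ev e0.
(* [h1] controls how far the discrete iterates move [T s v], [h2] how far the semigroup moves [v],
   and 1 gives [e * h <= e]. *)
pose h := Num.min h1 (Num.min h2 1).
have [hh1 hh2 hh3] : [/\ h <= h1, h <= h2 & h <= 1].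
  by rewrite !ge_min !lexx !orbT.
have h_gt0 : 0 < h by rewrite !lt_min h1_gt0 h2_gt0/= ltr01.
have eh0 : 0 < e * h by rewrite mulr_gt0.
have ehe : e * h <= e by rewrite ger_pMr.
exists h; first by rewrite h_gt0.
(* Only the orbit of [u] has to be followed with precision [e * h]: the first-order term is
   evaluated at the net time [si] throughout, never at [s]. *)
have [h0 [N [h0_gt0 net]]] := orbit_net tau Eu eh0.
have /choice[w Hw] : forall i : nat, exists w, [/\ D w,
    r (T (i%:R * h0) u - w) <= e * h & r (T (i%:R * h0) v - A w) <= e * h].
  move=> i; have i0 : 0 <= i%:R * h0 by rewrite mulr_ge0// ltW.
  exact: (D_core (gen_T i0 guv)).
have Dw i : D (w i) by case: (Hw i).
have := near_forall_lt N (fun i => consistency_step (Dw i) e0).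
apply: filterS3 (nbhs_infty_gt 1) slow => n n1 hslow hstep s sst k kn.
have n0 : 0 < n%:R :> R by rewrite ltr0n ltnW.
have [i [iN is_ hi]] := net _ sst.
have [_ hw1 hw2] := Hw i.
have {hstep} hs := hstep _ iN.
set si := i%:R * h0 in is_ hi hw1 hw2; set kap := k%:R / n%:R in kn *.
have kap0 : 0 <= kap by rewrite divr_ge0// ltW.
have /andP[s0 st] := sst.
have si0 : 0 <= si by rewrite mulr_ge0// ltW.
have sit : 0 <= si <= tau by rewrite si0 (le_trans is_).
have Ew : E (w i) by exact: DE.
have EA : E (A (w i)) by exact: AE.
have Ea : E (T s u) by exact: TE.
have Eb : E (T si u) by exact: TE.
have Ec : E (T si v) by exact: TE.
have ESa : E (iter k (S n) (T s u)) by apply: iter_E => //; exact: SE.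
have ESw : E (iter k (S n) (w i)) by apply: iter_E => //; exact: SE.
have EkA : E (kap *: A (w i)) by exact: subspaceZ.
have Ekc : E (kap *: T si v) by exact: subspaceZ.
have EwA : E (w i + kap *: A (w i)) by exact: subspaceD.
have Ebc : E (T si u + kap *: T si v) by exact: subspaceD.
have Eku : E (T kap u) by exact: TE.
have Esku : E (T si (T kap u)) by exact: TE.
have Esk : E (T (s + kap) u) by apply: TE => //; exact: addr_ge0.
have Esik : E (T (si + kap) u) by apply: TE => //; exact: addr_ge0.
have b2 : m n (iter k (S n) (T s u) - iter k (S n) (w i)) <= 2 * (e * h).
  apply: (le_trans (iter_dist Esub (mS n) (SE n1) (S_lin n1) (S_le n1) k Ea Ew)).
  apply: (le_trans (m_le _ (subspaceB Esub Ea Ew))).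
  apply: (le_trans (seminorm_dist Esub rS (v := T si u) _ _ _)) => //.
  lra.
(* The constant [3 * e] bounds the drift of [A (w i)]: [2 * e] for exchanging it with [T si v], and
   [e] from [slow_on_orbit]. Consistency adds [e / n] per step. *)
have b3 : m n (iter k (S n) (w i) - (w i + kap *: A (w i))) <= 4 * (e * h).
  rewrite opprD addrA.
  apply: (le_trans (iter_increment_linear Esub (mS n) (SE n1) (S_lin n1) (S_le n1)
    (c := 3 * e) Ew EA _ hs _)).
  - by rewrite invr_ge0 ltW.
  - move=> j jk.
    have jn : j%:R / n%:R <= h1.
      apply: le_trans hh1; apply: le_trans kn; rewrite ler_pM2r ?invr_gt0//.
      by rewrite ler_nat ltnW.
    have Aw : r (A (w i) - T si v) <= e.
      by rewrite (seminorm_subC Esub rS)// (le_trans hw2).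
    have := iter_dist3 j n1 EA Ec Aw; have := hslow _ sit _ jn; lra.
  have -> : k%:R * (e / n%:R + n%:R^-1 * (3 * e)) = 4 * (e * kap).
    rewrite /kap; set x := n%:R^-1; lra.
  by rewrite ler_pM2l// ler_pM2l.
have b4 : m n (w i + kap *: A (w i) - (T si u + kap *: T si v)) <= 2 * (e * h).
  apply: (le_trans (m_le _ (subspaceB Esub EwA Ebc))).
  apply: (le_trans (seminorm_distD Esub rS Ew EkA Eb Ekc)).
  rewrite -scalerBr (seminormZ rS); last exact: subspaceB.
  rewrite (seminorm_subC Esub rS)// [X in _ * X](seminorm_subC Esub rS)// ger0_norm//.
  have : kap * r (T si v - A (w i)) <= h * e.
    by apply: ler_pM => //; [exact: (seminorm_ge0 rS)|exact: le_trans hw2 ehe].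
  lra.
have b5 : r (T si u + kap *: T si v - T si (T kap u)) <= e * h.
  rewrite (seminorm_subC Esub rS)// opprD addrA.
  apply: (le_trans (contractive_affine Esub rS (TE si0) (T_lin si0) (T_le si0)
    kap Eku Eu Ev)).
  apply: (le_trans (generator_mean_value guv kap0 (eta := e) _)).
    by move=> t /andP[t0 tk]; apply: hv; rewrite t0; lra.
  by rewrite mulrC ler_pM2l.
have b6 : r (T (si + kap) u - T (s + kap) u) <= e * h.
  rewrite ![_ + kap]addrC.
  have Esi' : E (T kap (T si u)) by exact: TE.
  have Es' : E (T kap (T s u)) by exact: TE.
  have Eksi : E (T (kap + si) u) by rewrite addrC.
  have Eks : E (T (kap + s) u) by rewrite addrC.
  apply: (le_trans (seminorm_dist Esub rS (v := T kap (T si u)) _ _ _)) => //.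
  rewrite T_add// add0r.
  apply: (le_trans (seminorm_dist Esub rS (v := T kap (T s u)) _ _ _)) => //.
  rewrite [X in _ + X](seminorm_subC Esub rS)// T_add// addr0.
  apply: (le_trans (T_dist kap0 Eb Ea)).
  by rewrite (seminorm_subC Esub rS).
have b7 : m n (T si u + kap *: T si v - T (s + kap) u) <= 2 * (e * h).
  apply: (le_trans (m_le _ (subspaceB Esub Ebc Esk))).
  have := seminorm_dist Esub rS Ebc Esku Esk.
  have := seminorm_dist Esub rS Esku Esik Esk.
  rewrite (seminorm_subC Esub rS Esku Esik) T_add//; lra.
have := seminorm_dist Esub (mS n) ESa ESw Esk.
have := seminorm_dist Esub (mS n) ESw EwA Esk.
have := seminorm_dist Esub (mS n) EwA Ebc Esk.
have -> : eta * h = 10 * (e * h) by rewrite /e; lra.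
lra.
Qed.

(** The [k] steps are grouped into [q] full blocks of [p] steps and a remainder. By contractivity
    the block errors add up, and each is a small multiple of the block length. *)
Let generator_convergence u v (tau eta : R) : in_generator u v -> 0 < eta ->
  \forall n \near \oo, forall k, k%:R / n%:R <= tau ->
    m n (iter k (S n) u - T (k%:R / n%:R) u) <= eta.
Proof.
move=> guv eta0; have [Eu Ev _] := guv.
(* A full block lasts at least [h / 2], so [q * h <= 2 * tau]; with the remainder, and as [h <= 1],
   the total is at most [c]. *)
pose c := 2 * `|tau| + 1; have c0 : 0 < c by rewrite ltr_wpDl// mulr_ge0.
have [h /andP[h0 h1] short] := short_time_error tau guv (divr_gt0 eta0 c0).
apply: filterS3 (nbhs_infty_gt 1) (nbhs_infty_ger h^-1) short => n n1 nh short k ktau.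
have n0 : 0 < n%:R :> R by rewrite ltr0n ltnW.
pose err j := m n (iter j (S n) u - T (j%:R / n%:R) u).
have step j i : j%:R / n%:R <= tau -> i%:R / n%:R <= h ->
    err (j + i)%N <= err j + eta / c * h.
  move=> jt ih; have j0 : 0 <= j%:R / n%:R :> R by rewrite divr_ge0// ltW.
  have i0 : 0 <= i%:R / n%:R :> R by rewrite divr_ge0// ltW.
  have jt' : 0 <= (j%:R / n%:R : R) <= tau by rewrite j0.
  have := short _ jt' _ ih.
  rewrite /err addnC iterD [(i + j)%N]addnC natrD mulrDl => hb.
  have Ej : E (iter j (S n) u) by apply: iter_E => //; exact: SE.
  have Et : E (T (j%:R / n%:R) u) by exact: TE.
  have Est : E (T (j%:R / n%:R + i%:R / n%:R) u) by apply: TE => //; exact: addr_ge0.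
  have Ei : E (iter i (S n) (iter j (S n) u)) by apply: iter_E => //; exact: SE.
  have Ei' : E (iter i (S n) (T (j%:R / n%:R) u)) by apply: iter_E => //; exact: SE.
  apply: (le_trans (seminorm_dist Esub (mS n) Ei Ei' Est)); apply: lerD => //.
  exact: (iter_dist Esub (mS n) (SE n1) (S_lin n1) (S_le n1)).
have err0 : err 0%N = 0.
  apply/eqP; rewrite eq_le (seminorm_ge0 (mS n)) andbT /err mul0r /=.
  have ET0 : E (T 0 u) by exact: TE.
  apply: (le_trans (m_le _ (subspaceB Esub Eu ET0))).
  by rewrite (seminorm_subC Esub rS)// T_id.
(* Since [n >= 1 / h], a block has at least one step, and [p + 1 <= 2 * p] gives
   [h <= 2 * p / n]. *)
pose p := Num.truncn (n%:R * h).
have nh1 : 1 <= n%:R * h by rewrite -ler_pdivrMr// div1r.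
have p0 : (0 < p)%N by rewrite truncn_gt0.
have /andP[pn np] : (p%:R : R) <= n%:R * h < p.+1%:R.
  by rewrite truncn_itv// (le_trans ler01).
have ph j : (j <= p)%N -> j%:R / n%:R <= h.
  by move=> jp; rewrite ler_pdivrMr// mulrC (le_trans _ pn)// ler_nat.
have blocks q : (q * p)%:R / n%:R <= tau -> err (q * p)%N <= q%:R * (eta / c * h).
  elim: q => [|q IH]; first by move=> _; rewrite mul0n err0 mul0r.
  rewrite mulSnr => qt.
  have qt' : (q * p)%:R / n%:R <= tau.
    by apply: le_trans qt; rewrite ler_pM2r ?invr_gt0// ler_nat leq_addr.
  apply: (le_trans (step _ _ qt' (ph _ (leqnn _)))).
  by rewrite -addn1 natrD mulrDl mul1r; apply: lerD => //; exact: IH.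
rewrite -/(err k) (divn_eq k p); set q := (k %/ p)%N.
have qpk : (q * p)%:R / n%:R <= k%:R / n%:R :> R.
  by rewrite ler_pM2r ?invr_gt0// ler_nat leq_trunc_div.
have qpt : (q * p)%:R / n%:R <= tau by exact: le_trans ktau.
apply: (le_trans (step _ _ qpt (ph _ (ltnW (ltn_pmod k p0))))).
apply: (@le_trans _ _ ((q%:R + 1) * (eta / c * h))).
  by rewrite mulrDl mul1r lerD2r blocks.
have qh : q%:R * h <= 2 * `|tau|.
  have : q%:R * h <= 2 * ((q * p)%:R / n%:R).
    have -> : 2 * ((q * p)%:R / n%:R) = q%:R * (2 * p%:R / n%:R) :> R.
      by rewrite natrM; set x := n%:R^-1; lra.
    rewrite ler_wpM2l// ler_pdivlMr// mulrC (le_trans (ltW np))//.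
    by rewrite -natrM ler_nat mul2n -addnn -addn1 leq_add2l.
  have := ler_norm tau; lra.
have -> : (q%:R + 1) * (eta / c * h) = eta * ((q%:R * h + h) / c).
  by set x := c^-1; lra.
rewrite ger_pMr// ler_pdivrMr// mul1r /c; lra.
Qed.

(** Four errors of [eta / 4]: replacing [u] by a core vector in the discrete and in the continuous
    evolution, the convergence at multiples of [1 / n], and the rounding of [t] down to such a
    multiple. *)
Theorem trotter_approximation u (tau eta : R) : E u -> 0 < eta ->
  \forall n \near \oo, forall t : R, 0 <= t <= tau ->
    m n (iter (Num.truncn (n%:R * t)) (S n) u - T t u) <= eta.
Proof.
move=> Eu eta0; have e4 : 0 < eta / 4 by rewrite divr_gt0.
have [w Dw uw] := D_dense Eu e4; have Ew := DE Dw.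
have [h h0 hw] := T_cont Ew e4.
have := generator_convergence tau (D_generator Dw) e4.
apply: filterS3 (nbhs_infty_gt 1) (nbhs_infty_ger h^-1) => n n1 nh hn t tt.
have /andP[t0 ttau] := tt.
have n0 : 0 < n%:R :> R by rewrite ltr0n ltnW.
have /andP[] : ((Num.truncn (n%:R * t))%:R : R) <= n%:R * t < (Num.truncn (n%:R * t)).+1%:R.
  by rewrite truncn_itv// mulr_ge0// ltW.
set k := Num.truncn _ => kl kr.
have kt : k%:R / n%:R <= t by rewrite ler_pdivrMr// mulrC.
have k0 : 0 <= k%:R / n%:R :> R by rewrite divr_ge0// ltW.
have dt : 0 <= t - (k%:R / n%:R : R) <= h.
  rewrite subr_ge0 kt/= lerBlDr; apply: (@le_trans _ _ (k.+1%:R / n%:R)).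
    by rewrite ler_pdivlMr// mulrC ltW.
  rewrite -addn1 natrD mulrDl addrC lerD2r div1r.
  by rewrite -[h]invrK lef_pV2 ?posrE ?invr_gt0.
have Eku : E (iter k (S n) u) by apply: iter_E => //; exact: SE.
have Ekw : E (iter k (S n) w) by apply: iter_E => //; exact: SE.
have ETk : E (T (k%:R / n%:R) w) by exact: TE.
have ETw : E (T t w) by exact: TE.
have ETu : E (T t u) by exact: TE.
have b1 : m n (iter k (S n) u - iter k (S n) w) <= eta / 4.
  apply: (le_trans (iter_dist Esub (mS n) (SE n1) (S_lin n1) (S_le n1) k Eu Ew)).
  by apply: le_trans uw; apply: m_le; exact: subspaceB.
have b2 := hn k (le_trans kt ttau).
have b3 : m n (T (k%:R / n%:R) w - T t w) <= eta / 4.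
  rewrite (seminorm_subC Esub (mS n))//.
  apply: (le_trans (m_le _ (subspaceB Esub ETw ETk))).
  have {1}-> : t = k%:R / n%:R + (t - k%:R / n%:R) by rewrite addrC subrK.
  by apply: (le_trans (T_sub _ _ Ew)) => //; [case/andP: dt|exact: hw].
have b4 : m n (T t w - T t u) <= eta / 4.
  rewrite (seminorm_subC Esub (mS n))//.
  apply: (le_trans (m_le _ (subspaceB Esub ETu ETw))).
  exact: le_trans (T_dist t0 Eu Ew) uw.
have := seminorm_dist Esub (mS n) Eku Ekw ETu.
have := seminorm_dist Esub (mS n) Ekw ETk ETu.
have := seminorm_dist Esub (mS n) ETk ETw ETu.
lra.
Qed.

End trotter_approximation.

(** * Integration over finite configurations *)

Section rV_measurability.
Context {R : realType} {d : nat}.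
Local Notation Rd := 'rV[R]_d.
Context {dQ} {Q : measurableType dQ}.

Lemma measurable_rV_coord (i : 'I_d) : measurable_fun setT (@rV_coord R d i).
Proof.
move=> _ B mB; apply: sub_sigma_algebra => /=.
by rewrite -bigcup_seq/=; exists i; [rewrite /= mem_index_enum|exists B].
Qed.

Lemma measurable_fun_rV (f : Q -> Rd) :
  (forall i, measurable_fun setT (fun q => f q ord0 i)) -> measurable_fun setT f.
Proof.
move=> mf.
rewrite (_ : f = tuple_row \o (fun q => [tuple (f q ord0 i : measurableTypeR R) | i < d])).
  apply: measurableT_comp; first exact: measurable_tuple_row.
  apply/measurable_fun_tnthP => i.
  rewrite [X in measurable_fun _ X](_ : _ = fun q => f q ord0 i); first exact: mf.
  by apply/funext => q /=; rewrite tnth_mktuple.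
by apply/funext => q; apply/rowP => i; rewrite /tuple_row mxE tnth_mktuple.
Qed.

Lemma measurable_rV_sub (f g : Q -> Rd) : measurable_fun setT f -> measurable_fun setT g ->
  measurable_fun setT (fun q => f q - g q).
Proof.
move=> mf mg; apply: measurable_fun_rV => i.
rewrite [X in measurable_fun _ X](_ : _ =
    (@rV_coord R d i \o f) \- (@rV_coord R d i \o g)).
  by apply: measurable_funB; apply: measurableT_comp => //; exact: measurable_rV_coord.
by apply/funext => q; rewrite /= !mxE.
Qed.

Lemma measurable_rV_set1 (x : Rd) : measurable [set x].
Proof.
have -> : [set x] = \bigcap_(i in [set: 'I_d]) (@rV_coord R d i @^-1` [set x ord0 i]).
  apply/seteqP; split => [y -> //|y xy]; apply/rowP => i.
  by have := xy i I.
apply: fin_bigcap_measurable; first exact: finite_finset.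
move=> i _; rewrite -[X in measurable X]setTI.
by apply: measurable_rV_coord => //; exact: measurable_set1.
Qed.

Lemma measurable_fun_rV_eq (f g : Q -> Rd) : measurable_fun setT f ->
  measurable_fun setT g -> measurable_fun setT (fun q => f q == g q).
Proof.
move=> mf mg; apply: (measurable_fun_bool true).
rewrite (_ : _ `&` _ = setT `&` (fun q => f q - g q) @^-1` [set 0]).
  by apply: measurable_rV_sub => //; exact: measurable_rV_set1.
rewrite !setTI; apply/seteqP; split => q /=.
- by move=> /eqP ->; rewrite subrr.
- by move=> /eqP; rewrite subr_eq0.
Qed.

End rV_measurability.

Section tuple_measurability.
Context {R : realType} {d : nat}.
Local Notation Rd := 'rV[R]_d.
Local Notation tup n := (n.-tuple Rd).

Lemma measurable_tuple_cat {dQ} {Q : measurableType dQ} n m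
  (f : Q -> tup n) (g : Q -> tup m) :
  measurable_fun setT f -> measurable_fun setT g ->
  measurable_fun setT (fun q => [tuple of f q ++ g q]).
Proof.
move=> mf mg; apply/measurable_fun_tnthP => i.
have [j|j] := split_ordP i => ->.
- rewrite (_ : _ \o _ = (@tnth _ Rd ^~ j) \o f).
    by apply: measurableT_comp => //; exact: measurable_tnth.
  by apply/funext => q /=; rewrite tnth_lshift.
- rewrite (_ : _ \o _ = (@tnth _ Rd ^~ j) \o g).
    by apply: measurableT_comp => //; exact: measurable_tnth.
  by apply/funext => q /=; rewrite tnth_rshift.
Qed.

(** The head of the tuple moves into the parameter space. Inductions on the length of a tuple
    therefore quantify over [Q]. *)
Lemma measurable_tuple_unzip {dQ} {Q : measurableType dQ} {dU} {U : measurableType dU} n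
  (F : Q -> tup n.+1 -> U) :
  measurable_fun setT (fun w : (Q * Rd) * tup n => F w.1.1 [tuple of w.1.2 :: w.2]) ->
  measurable_fun setT (fun w : Q * tup n.+1 => F w.1 w.2).
Proof.
move=> mF.
rewrite (_ : (fun w => F w.1 w.2) =
  (fun w : (Q * Rd) * tup n => F w.1.1 [tuple of w.1.2 :: w.2]) \o
  (fun w : Q * tup n.+1 => ((w.1, thead w.2), [tuple of behead w.2]))).
  apply: measurableT_comp => //; apply: measurable_fun_pair => /=.
    apply: measurable_fun_pair => //; apply: (measurableT_comp (measurable_tnth ord0)).
    exact: measurable_snd.
  apply: (@measurableT_comp _ _ _ _ _ _
    (fun t : tup n.+1 => [tuple of behead t] : tup n)); last exact: measurable_snd.
  exact: measurable_behead.
by apply/funext => -[q t] /=; rewrite [in LHS](tuple_eta t).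
Qed.

Lemma conf_of_tuple0 (t : tup 0) : conf_of_tuple t = fset0.
Proof. by rewrite (tuple0 t); apply/fsetP => x; rewrite !inE. Qed.

Lemma conf_of_tuple_cons n x (t : tup n) :
  conf_of_tuple [tuple of x :: t] = (x |` conf_of_tuple t)%fset.
Proof. by apply/fsetP => y; rewrite !inE. Qed.

Lemma conf_of_tuple_cat n m (s : tup n) (t : tup m) :
  conf_of_tuple [tuple of s ++ t] = (conf_of_tuple s `|` conf_of_tuple t)%fset.
Proof. by apply/fsetP => y; rewrite !inE. Qed.

Lemma conf_of_tupleP (eta : fconf R d) : exists n, exists t : tup n, conf_of_tuple t = eta.
Proof.
exists (size (enum_fset eta)), (in_tuple (enum_fset eta)).
by apply/fsetP => y; rewrite !inE.
Qed.

Lemma measurable_mem_conf {dQ} {Q : measurableType dQ} n (f : Q -> Rd) (g : Q -> tup n) :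
  measurable_fun setT f -> measurable_fun setT g ->
  measurable_fun setT (fun q => f q \in conf_of_tuple (g q)).
Proof.
move=> mf mg.
rewrite (_ : (fun q => _) =
    (fun w : Q * tup n => f w.1 \in conf_of_tuple w.2) \o (fun q => (q, g q))); last by [].
apply: measurableT_comp; last exact: measurable_fun_pair.
move: (mf) => {g mg}; elim: n dQ Q f {mf} => [|n IH] dQ Q f mf.
  rewrite (_ : (fun _ => _) = cst false) //.
  by apply/funext => w; rewrite conf_of_tuple0 inE.
apply: (measurable_tuple_unzip (F := fun q t => f q \in conf_of_tuple t)).
rewrite (_ : (fun _ => _) = fun w : (Q * Rd) * tup n =>
    (f w.1.1 == w.1.2) || (f w.1.1 \in conf_of_tuple w.2)); last first.
  by apply/funext => w; rewrite conf_of_tuple_cons !inE.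
apply: measurable_or.
- apply: measurable_fun_rV_eq.
    by apply: measurableT_comp => //; apply: measurableT_comp.
  by apply: measurableT_comp => //; exact: measurable_snd.
- apply: (IH _ (Q * Rd)%type (fun q => f q.1)).
  by apply: measurableT_comp.
Qed.

(** A repeated entry of the tuple counts once in the configuration, so the recursion branches on
    whether the head belongs to the tail, which is a measurable condition. Measurability of [op] is
    assumed over every space because the parameter space grows along the induction. *)
Lemma measurable_big_conf {dQ} {Q : measurableType dQ} {dU} {U : measurableType dU}
  (idx : U) (op : Monoid.com_law idx) n (g : Q -> tup n) (h : Q -> Rd -> U) :
  (forall dP (P : measurableType dP) (a b : P -> U), measurable_fun setT a ->
     measurable_fun setT b -> measurable_fun setT (fun p => op (a p) (b p))) ->
  measurable_fun setT (fun w : Q * Rd => h w.1 w.2) -> measurable_fun setT g ->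
  measurable_fun setT (fun q => \big[op/idx]_(y <- conf_of_tuple (g q)) h q y).
Proof.
move=> mop mh mg.
rewrite (_ : (fun q => _) = (fun w : Q * tup n =>
   \big[op/idx]_(y <- conf_of_tuple w.2) h w.1 y) \o (fun q => (q, g q))); last by [].
apply: measurableT_comp; last exact: measurable_fun_pair.
elim: n dQ Q h mh {g mg} => [|n IH] dQ Q h mh.
  rewrite (_ : (fun _ => _) = cst idx) //.
  by apply/funext => w; rewrite conf_of_tuple0 big_seq_fset0.
apply: (measurable_tuple_unzip (F := fun q t => \big[op/idx]_(y <- conf_of_tuple t) h q y)).
have IHh : measurable_fun setT (fun w : (Q * Rd) * tup n =>
    \big[op/idx]_(y <- conf_of_tuple w.2) h w.1.1 y).
  apply: (IH _ (Q * Rd)%type (fun q => h q.1)).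
  rewrite (_ : (fun _ => _) = (fun w : Q * Rd => h w.1 w.2) \o
     (fun w : (Q * Rd) * Rd => (w.1.1, w.2))) //.
  apply: measurableT_comp => //; apply: measurable_fun_pair; last exact: measurable_snd.
  by apply: measurableT_comp.
rewrite (_ : (fun _ => _) = fun w : (Q * Rd) * tup n =>
    if w.1.2 \in conf_of_tuple w.2 then
      \big[op/idx]_(y <- conf_of_tuple w.2) h w.1.1 y
    else op (h w.1.1 w.1.2) (\big[op/idx]_(y <- conf_of_tuple w.2) h w.1.1 y)).
  apply: measurable_fun_ifT => //.
    apply: measurable_mem_conf => //; by apply: (measurableT_comp measurable_snd).
  by apply: mop => //; apply: (measurableT_comp mh measurable_fst).
apply/funext => w; rewrite conf_of_tuple_cons; case: ifPn => xt.
  by rewrite (fsetUidPr _ _ _)// fsub1set.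
by rewrite big_fsetU1.
Qed.

End tuple_measurability.

(** * Sums over the splittings of a finite set *)

Section subset_sums.
Context {K : choiceType} {V : nmodType}.
Implicit Types (H : {fset K} -> {fset K} -> V) (A : {fset K}).

(** The complement is a separate argument of [H], so that [H] can also be integrated over two
    independent configurations. *)
Definition subset_sum H A : V := \sum_(B <- fpowerset A) H B (A `\` B)%fset.

Lemma subset_sum0 H : subset_sum H fset0 = H fset0 fset0.
Proof. by rewrite /subset_sum fpowerset0 big_seq_fset1 fset0D. Qed.

(** The new point goes to one part of the splitting or to the other. This is the recursion behind
    all inductions on subset sums. *)
Lemma subset_sum_fset1U H x A : x \notin A ->
  subset_sum H (x |` A)%fset =
  subset_sum (fun B D => H (x |` B)%fset D) A + subset_sum (fun B D => H B (x |` D)%fset) A.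
Proof.
move=> xA; rewrite /subset_sum (big_fsetID _ (fun B : {fset K} => x \in B))/=.
have sub B : (B `<=` A -> x \notin B)%fset.
  by move=> /fsubsetP BA; apply: contra xA => /BA.
congr (_ + _).
- rewrite (_ : [fset _ | _ in _]%fset =
      [fset (x |` B)%fset | B in fpowerset A]%fset); last first.
    apply/fsetP => B; rewrite !inE fpowersetE; apply/andP/imfsetP => /=.
    + move=> [BxA xB]; exists (B `\ x)%fset; last by rewrite fsetD1K.
      by rewrite fpowersetE fsubDset.
    + move=> [D]; rewrite fpowersetE => DA ->; split; last by rewrite !inE eqxx.
      exact: fsetUS.
  rewrite big_imfset/=; last first.
    move=> B D; rewrite !fpowersetE => /sub xB /sub xD /(congr1 (fun E => E `\ x)%fset).
    by rewrite !fsetU1K.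
  apply: eq_big_seq => B; rewrite fpowersetE => BA; congr H.
  apply/fsetP => y; rewrite !inE; have [->|] := eqVneq y x => //=.
  by rewrite (negbTE xA) andbF.
- rewrite (_ : [fset _ | _ in _ & _]%fset = fpowerset A); last first.
    apply/fsetP => B; rewrite !inE !fpowersetE; apply/andP/idP.
    + by move=> [BxA xB]; rewrite -(fsetU1K xA) fsubsetD1 BxA.
    + by move=> BA; split; [exact: fsubset_trans BA (fsubsetUr _ _)|exact: sub].
  apply: eq_big_seq => B; rewrite fpowersetE => BA; congr H.
  apply/fsetP => y; rewrite !inE; have [->|] := eqVneq y x => //=.
  by rewrite (negbTE (sub _ BA)).
Qed.

Lemma eq_subset_sum H H' A :
  (forall B, (B `<=` A)%fset -> H B (A `\` B)%fset = H' B (A `\` B)%fset) ->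
  subset_sum H A = subset_sum H' A.
Proof.
move=> HH'; apply: eq_big_seq => B.
by rewrite fpowersetE => /HH'.
Qed.

Lemma subset_sumD H H' A :
  subset_sum (fun B D => H B D + H' B D) A = subset_sum H A + subset_sum H' A.
Proof. by rewrite /subset_sum big_split. Qed.

Lemma subset_sum_unique H A : (forall B D, D != fset0 -> H B D = 0) ->
  subset_sum H A = H A fset0.
Proof.
move=> H0; rewrite /subset_sum (big_fsetD1 A) ?fpowersetE//= fsetDv.
rewrite big_seq_cond big1 ?addr0// => B.
rewrite andbT !inE fpowersetE => /andP[BA AB]; apply: H0.
by apply: contra BA; rewrite fsetD_eq0 eqEfsubset AB => ->.
Qed.

End subset_sums.

Section lebesgue_poisson_integration.
Context {R : realType} {d : nat}.
Local Notation Rd := 'rV[R]_d.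
Local Notation tup n := (n.-tuple Rd).
Local Notation fconf := (fconf R d).
Local Notation leb := (@lebesgue_rV R d).
Local Notation lp := (@lebesgue_poisson R d).
Local Notation mu n := (tuple_measure leb n).
Local Open Scope ereal_scope.

Lemma measurable_fun_fconf {dU} {U : measurableType dU} (f : fconf -> U) :
  (forall n, measurable_fun setT (fun t : tup n => f (conf_of_tuple t))) ->
  measurable_fun setT f.
Proof.
move=> mf _ B mB; rewrite setTI.
suff : fconf_measurable (f @^-1` B) by [].
by move=> n; have := mf n measurableT B mB; rewrite setTI.
Qed.

Lemma measurable_subset_sum {dQ} {Q : measurableType dQ} (H : Q -> fconf -> fconf -> \bar R)
  N (g : Q -> tup N) :
  (forall n m, measurable_fun setT (fun w : (Q * tup n) * tup m =>
     H w.1.1 (conf_of_tuple w.1.2) (conf_of_tuple w.2))) ->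
  measurable_fun setT g ->
  measurable_fun setT (fun q => subset_sum (H q) (conf_of_tuple (g q))).
Proof.
move=> mH mg.
rewrite (_ : (fun q => _) = (fun w : Q * tup N =>
   subset_sum (H w.1) (conf_of_tuple w.2)) \o (fun q => (q, g q))); last by [].
apply: measurableT_comp; last exact: measurable_fun_pair.
elim: N dQ Q H mH {g mg} => [|N IH] dQ Q H mH.
  rewrite (_ : (fun _ => _) = (fun w : (Q * tup 0) * tup 0 =>
     H w.1.1 (conf_of_tuple w.1.2) (conf_of_tuple w.2)) \o
     (fun w : Q * tup 0 => ((w.1, w.2), w.2))).
    apply: (measurableT_comp (mH _ _)); apply: measurable_fun_pair; last exact: measurable_snd.
    by apply: measurable_fun_pair.
  by apply/funext => w /=; rewrite conf_of_tuple0 subset_sum0.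
apply: (measurable_tuple_unzip (F := fun q t => subset_sum (H q) (conf_of_tuple t))).
have m1 n m : measurable_fun setT (fun w : ((Q * Rd) * tup n) * tup m =>
    H w.1.1.1 (w.1.1.2 |` conf_of_tuple w.1.2)%fset (conf_of_tuple w.2)).
  rewrite (_ : (fun _ => _) = (fun w : (Q * tup n.+1) * tup m =>
     H w.1.1 (conf_of_tuple w.1.2) (conf_of_tuple w.2)) \o
     (fun w : ((Q * Rd) * tup n) * tup m => ((w.1.1.1, [tuple of w.1.1.2 :: w.1.2]), w.2))).
    apply: (measurableT_comp (mH _ _)); apply: measurable_fun_pair; last exact: measurable_snd.
    apply: measurable_fun_pair.
      by apply: (measurableT_comp measurable_fst); apply: (measurableT_comp measurable_fst).
    apply: measurable_cons.
      by apply: (measurableT_comp measurable_snd); apply: (measurableT_comp measurable_fst).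
    by apply: (measurableT_comp measurable_snd).
  by apply/funext => w /=; rewrite conf_of_tuple_cons.
have m2 n m : measurable_fun setT (fun w : ((Q * Rd) * tup n) * tup m =>
    H w.1.1.1 (conf_of_tuple w.1.2) (w.1.1.2 |` conf_of_tuple w.2)%fset).
  rewrite (_ : (fun _ => _) = (fun w : (Q * tup n) * tup m.+1 =>
     H w.1.1 (conf_of_tuple w.1.2) (conf_of_tuple w.2)) \o
     (fun w : ((Q * Rd) * tup n) * tup m => ((w.1.1.1, w.1.2), [tuple of w.1.1.2 :: w.2]))).
    apply: (measurableT_comp (mH _ _)); apply: measurable_fun_pair.
      apply: measurable_fun_pair.
        by apply: (measurableT_comp measurable_fst); apply: (measurableT_comp measurable_fst).
      by apply: (measurableT_comp measurable_snd).
    apply: measurable_cons; last exact: measurable_snd.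
    by apply: (measurableT_comp measurable_snd); apply: (measurableT_comp measurable_fst).
  by apply/funext => w /=; rewrite conf_of_tuple_cons.
have m0 n m : measurable_fun setT (fun w : ((Q * Rd) * tup n) * tup m =>
    H w.1.1.1 (conf_of_tuple w.1.2) (conf_of_tuple w.2)).
  rewrite (_ : (fun _ => _) = (fun w : (Q * tup n) * tup m =>
     H w.1.1 (conf_of_tuple w.1.2) (conf_of_tuple w.2)) \o
     (fun w : ((Q * Rd) * tup n) * tup m => ((w.1.1.1, w.1.2), w.2))) //.
  apply: (measurableT_comp (mH _ _)); apply: measurable_fun_pair; last exact: measurable_snd.
  apply: measurable_fun_pair.
    by apply: (measurableT_comp measurable_fst); apply: (measurableT_comp measurable_fst).
  by apply: (measurableT_comp measurable_snd).
rewrite (_ : (fun _ => _) = fun w : (Q * Rd) * tup N =>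
    if w.1.2 \in conf_of_tuple w.2 then subset_sum (H w.1.1) (conf_of_tuple w.2)
    else subset_sum (fun B D => H w.1.1 (w.1.2 |` B)%fset D) (conf_of_tuple w.2) +
         subset_sum (fun B D => H w.1.1 B (w.1.2 |` D)%fset) (conf_of_tuple w.2)).
  apply: measurable_fun_ifT.
  - by apply: measurable_mem_conf => //; apply: (measurableT_comp measurable_snd).
  - exact: (IH _ (Q * Rd)%type (fun q => H q.1)).
  - apply: emeasurable_funD.
    + exact: (IH _ (Q * Rd)%type (fun q B D => H q.1 (q.2 |` B)%fset D)).
    + exact: (IH _ (Q * Rd)%type (fun q B D => H q.1 B (q.2 |` D)%fset)).
apply/funext => w; rewrite conf_of_tuple_cons; case: ifPn => xt.
  by rewrite (fsetUidPr _ _ _)// fsub1set.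
by rewrite subset_sum_fset1U.
Qed.

Lemma measurable_integral_lp {dQ} {Q : measurableType dQ} (H : Q -> fconf -> \bar R) :
  (forall q om, 0 <= H q om) ->
  (forall n, measurable_fun setT (fun w : Q * tup n => H w.1 (conf_of_tuple w.2))) ->
  measurable_fun setT (fun q => \int[lp]_om H q om).
Proof.
move=> H0 mH.
have mHq q : measurable_fun setT (H q).
  apply: measurable_fun_fconf => n.
  exact: (measurableT_comp (mH n) (measurable_pair1 q)).
under eq_fun do rewrite ge0_integral_lebesgue_poisson//.
apply: ge0_emeasurable_sum => [n q _ _|n _].
  by rewrite mule_ge0// ?lee_fin ?invr_ge0//; exact: integral_ge0.
apply: measurable_funeM.
exact: (@measurable_fun_fubini_tonelli_F _ _ _ _ _ (mu n)
  (fun w : Q * tup n => H w.1 (conf_of_tuple w.2)) (mH n)).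
Qed.

(** The Lebesgue-Poisson measure is a series of images of sigma-finite measures on tuples: Tonelli's
    theorem is applied to each term, and the series is exchanged with the integral. *)
Lemma lp_fubini_measure {dQ} {Q : measurableType dQ}
    (m : {sigma_finite_measure set Q -> \bar R}) (H : Q -> fconf -> \bar R) :
  (forall q om, 0 <= H q om) ->
  (forall n, measurable_fun setT (fun w : Q * tup n => H w.1 (conf_of_tuple w.2))) ->
  \int[m]_q \int[lp]_om H q om = \int[lp]_om \int[m]_q H q om.
Proof.
move=> H0 mH.
have mHq q : measurable_fun setT (H q).
  apply: measurable_fun_fconf => n.
  exact: (measurableT_comp (mH n) (measurable_pair1 q)).
under eq_integral do rewrite ge0_integral_lebesgue_poisson//.
have mF n : measurable_fun setT (fun q => \int[mu n]_t H q (conf_of_tuple t)).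
  exact: (@measurable_fun_fubini_tonelli_F _ _ _ _ _ (mu n)
    (fun w : Q * tup n => H w.1 (conf_of_tuple w.2)) (mH n)).
have mG n : measurable_fun setT (fun t : tup n => \int[m]_q H q (conf_of_tuple t)).
  exact: (@measurable_fun_fubini_tonelli_G _ _ _ _ _ m
    (fun w : Q * tup n => H w.1 (conf_of_tuple w.2)) (mH n)).
rewrite integral_nneseries//; last 2 first.
- by move=> n; exact: measurable_funeM.
- by move=> n q _; rewrite mule_ge0// ?lee_fin ?invr_ge0//; exact: integral_ge0.
rewrite ge0_integral_lebesgue_poisson; last 2 first.
- exact: measurable_fun_fconf.
- by move=> om; exact: integral_ge0.
apply: eq_eseriesr => n _; rewrite ge0_integralZl//; last by move=> q _; exact: integral_ge0.
congr (_ * _).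
by apply: (fubini_tonelli (m1 := m) (m2 := mu n)
  (fun w : Q * tup n => H w.1 (conf_of_tuple w.2)) (mH n)).
Qed.

(** Joint measurability is tested on pairs of tuples, where Tonelli's theorem is applied, and not on
    a product of configuration spaces. *)
Definition measurable_conf2 {dU} {U : measurableType dU} (H : fconf -> fconf -> U) :=
  forall n m, measurable_fun setT (fun w : tup n * tup m =>
    H (conf_of_tuple w.1) (conf_of_tuple w.2)).

Lemma measurable_conf2_swap {dU} {U : measurableType dU} (H : fconf -> fconf -> U) :
  measurable_conf2 H -> measurable_conf2 (fun xi om => H om xi).
Proof.
move=> mH n m; apply: (measurableT_comp (mH m n) (g := fun w : tup n * tup m => (w.2, w.1))).
by apply: measurable_fun_pair.
Qed.

Lemma measurable_conf2_r {dU} {U : measurableType dU} (H : fconf -> fconf -> U) xi :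
  measurable_conf2 H -> measurable_fun setT (H xi).
Proof.
move=> mH; have [m [s <-]] := conf_of_tupleP xi; apply: measurable_fun_fconf => n.
exact: (measurableT_comp (mH m n) (measurable_pair1 s)).
Qed.

Lemma measurable_conf2_integral (H : fconf -> fconf -> \bar R) :
  (forall xi om, 0 <= H xi om) -> measurable_conf2 H ->
  measurable_fun setT (fun xi => \int[lp]_om H xi om).
Proof.
move=> H0 mH; apply: measurable_fun_fconf => n.
apply: (measurable_integral_lp (H := fun (t : tup n) om => H (conf_of_tuple t) om)) => //.
exact: mH.
Qed.

Lemma lp_fubini (H : fconf -> fconf -> \bar R) :
  (forall xi om, 0 <= H xi om) -> measurable_conf2 H ->
  \int[lp]_xi \int[lp]_om H xi om = \int[lp]_om \int[lp]_xi H xi om.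
Proof.
move=> H0 mH.
rewrite ge0_integral_lebesgue_poisson; last 2 first.
- exact: measurable_conf2_integral.
- by move=> xi; exact: integral_ge0.
have mHs := measurable_conf2_swap mH.
under [RHS]eq_integral => om _.
  rewrite ge0_integral_lebesgue_poisson//; last exact: (measurable_conf2_r om mHs).
  over.
have mI n : measurable_fun setT (fun om => \int[mu n]_t H (conf_of_tuple t) om).
  apply: measurable_fun_fconf => m.
  exact: (@measurable_fun_fubini_tonelli_F _ _ _ _ _ (mu n)
    (fun w : tup m * tup n => H (conf_of_tuple w.2) (conf_of_tuple w.1)) (mHs m n)).
rewrite integral_nneseries//; last 2 first.
- by move=> n; exact: measurable_funeM.
- by move=> n om _; rewrite mule_ge0// ?lee_fin ?invr_ge0//; exact: integral_ge0.
apply: eq_eseriesr => n _; rewrite ge0_integralZl//; last by move=> q _; exact: integral_ge0.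
by congr (_ * _); apply: lp_fubini_measure => // m; exact: mH.
Qed.

End lebesgue_poisson_integration.

(** * Minlos' lemma and Lebesgue-Poisson exponentials *)

Lemma natmul_mule (R : realType) (x : \bar R) n : (x *+ n)%R = (n%:R%:E * x)%E.
Proof. by rewrite mule_natl. Qed.

(** Pascal's rule; its two terms correspond to the two terms of [subset_sum_fset1U]. *)
Lemma sum_binomial_recr (V : nmodType) (f : nat -> nat -> V) N :
  \sum_(i < N.+2) f i (N.+1 - i)%N *+ 'C(N.+1, i) =
  \sum_(i < N.+1) (f i.+1 (N - i)%N + f i (N.+1 - i)%N) *+ 'C(N, i).
Proof.
rewrite big_ord_recl /= bin0 subn0 mulr1n.
under eq_bigr => i _ do rewrite /bump /= add1n binS mulrnDr subSS.
rewrite big_split /= [X in _ + (X + _)]big_ord_recr /= bin_small// mulr0n addr0.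
under [RHS]eq_bigr => i _ do rewrite mulrnDl.
rewrite big_split /= addrA addrC; congr (_ + _).
rewrite [RHS]big_ord_recl /= bin0 subn0 mulr1n; congr (_ + _).
Qed.

Lemma nneseries_antidiagonal (R : realType) (c : nat -> nat -> \bar R) :
  (forall i j, (0 <= c i j)%E) ->
  (\sum_(N <oo) \sum_(i < N.+1) c i (N - i)%N = \sum_(i <oo) \sum_(j <oo) c i j)%E.
Proof.
move=> c0; pose b i N := if (i <= N)%N then c i (N - i)%N else 0%E.
have b0 i N : (0 <= b i N)%E by rewrite /b; case: ifP.
transitivity (\sum_(N <oo) \sum_(i <oo) b i N)%E.
  apply: eq_eseriesr => N _; rewrite (nneseries_split 0 N.+1)//.
  rewrite [X in (_ + X)%E]eseries0 ?adde0 ?add0n; last first.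
    by move=> i iN _; rewrite /b leqNgt iN.
  by rewrite big_mkord; apply: eq_bigr => i _; rewrite /b -ltnS ltn_ord.
rewrite nneseries_interchange//; apply: eq_eseriesr => i _.
rewrite (nneseries_split 0 i)// big_mkord big1 ?add0e ?add0n; last first.
  by move=> j _; rewrite /b leqNgt ltn_ord.
rewrite -nneseries_addn//; apply: eq_eseriesr => j _.
by rewrite /b leq_addl addnK.
Qed.

Section tuple_integrals.
Context {disp} {T : measurableType disp} {R : realType}.
Variable mu : {sigma_finite_measure set T -> \bar R}.
Local Open Scope ereal_scope.

Lemma integral_tuple0 (f : 0.-tuple T -> \bar R) :
  \int[tuple_measure mu 0]_t f t = f [tuple].
Proof.
have -> : f = cst (f [tuple]) by apply/funext => t; rewrite (tuple0 t).
by rewrite /= integral_dirac// diracT mul1e.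
Qed.

Lemma integral_tuple_cons n (f : n.+1.-tuple T -> \bar R) :
  measurable_fun setT f -> (forall t, 0 <= f t) ->
  \int[tuple_measure mu n.+1]_t f t =
  \int[mu]_x \int[tuple_measure mu n]_t f [tuple of x :: t].
Proof.
move=> mf f0.
rewrite [LHS](ge0_integral_pushforward (measurable_tuple_cons (n := n)))//.
rewrite preimage_setT (fubini_tonelli1 (f \o @tuple_cons _ T n))//.
- by apply: measurableT_comp => //; exact: measurable_tuple_cons.
- by move=> x; exact: f0.
Qed.

End tuple_integrals.

Section minlos.
Context {R : realType} {d : nat}.
Hypothesis d_gt0 : (0 < d)%N.
Local Notation Rd := 'rV[R]_d.
Local Notation tup n := (n.-tuple Rd).
Local Notation fconf := (fconf R d).
Local Notation leb := (@lebesgue_rV R d).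
Local Notation mu n := (tuple_measure leb n).
Local Open Scope ereal_scope.

(** The point lies in a hyperplane that fixes the first coordinate. Positivity of [d] is essential:
    for [d = 0] the only point has mass 1. *)
Lemma lebesgue_rV_set1 (x : Rd) : leb [set x] = 0.
Proof.
case: d d_gt0 x => // n _ x.
rewrite /lebesgue_rV /pushforward /=.
apply/eqP; rewrite eq_le measure_ge0 andbT.
have mB : measurable [set x ord0 ord0 : measurableTypeR R] by exact: measurable_set1.
have -> : 0 = (@lebesgue_measure R \x tuple_measure (@lebesgue_measure R) n)
    ([set x ord0 ord0] `*` setT).
  rewrite product_measure1E// [X in X * _](_ : _ = 0) ?mul0e//.
  exact: lebesgue_measure_set1.
have mx : measurable (@tuple_row R n.+1 @^-1` [set x]).
  rewrite -[X in measurable X]setTI; apply: measurable_tuple_row => //.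
  exact: measurable_rV_set1.
rewrite /cons_measure /pushforward; apply: le_measure; rewrite ?inE.
- by rewrite -[X in measurable X]setTI; apply: measurable_tuple_cons.
- exact: measurableX.
- move=> [y t] /= /(congr1 (fun v : 'rV[R]_n.+1 => v ord0 ord0)); rewrite mxE => <-.
  by split.
Qed.

Lemma lebesgue_rV_fset (A : fconf) : leb.-negligible [set x | x \in A].
Proof.
have -> : [set x | x \in A] = \big[setU/set0]_(x <- A) [set x].
  apply/seteqP; split => x; rewrite -bigcup_seq /=.
  - by move=> xA; exists x.
  - by move=> [y yA ->].
elim/big_rec: _ => [|x B _ IH]; first exact: negligible_set0.
apply: negligibleU => //; apply/negligibleP; first exact: measurable_rV_set1.
exact: lebesgue_rV_set1.
Qed.

(* Peeling off one point of a tuple is additive for [subset_sum] unless the point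
   occurs twice, which happens on a null set only. *)
Lemma integral_off_diagonal n (f g : Rd * tup n -> \bar R) :
  measurable_fun setT f -> measurable_fun setT g ->
  (forall w, 0 <= f w) -> (forall w, 0 <= g w) ->
  (forall x t, x \notin conf_of_tuple t -> f (x, t) = g (x, t)) ->
  \int[leb]_x \int[mu n]_t f (x, t) = \int[leb]_x \int[mu n]_t g (x, t).
Proof.
move=> mf mg f0 g0 fg; rewrite !fubini_tonelli//.
apply: eq_integral => t _; apply: ge0_ae_eq_integral => //.
- exact: (measurableT_comp mf (measurable_pair2 t)).
- exact: (measurableT_comp mg (measurable_pair2 t)).
- apply: negligibleS (lebesgue_rV_fset (conf_of_tuple t)) => x /= nfg.
  by apply/negPn/negP => /fg e; apply: nfg => _.
Qed.

Definition tuple_integral2 (H : fconf -> fconf -> \bar R) i j : \bar R :=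
  \int[mu i]_s \int[mu j]_t H (conf_of_tuple s) (conf_of_tuple t).

Lemma measurable_tuple_integral2 {dQ} {Q : measurableType dQ}
  (K : Q -> fconf -> fconf -> \bar R) i j :
  (forall q xi om, 0 <= K q xi om) ->
  measurable_fun setT (fun w : (Q * tup i) * tup j =>
     K w.1.1 (conf_of_tuple w.1.2) (conf_of_tuple w.2)) ->
  measurable_fun setT (fun q => tuple_integral2 (K q) i j).
Proof.
move=> K0 mK.
apply: (@measurable_fun_fubini_tonelli_F _ _ _ _ _ (mu i) (fun w : Q * tup i =>
  \int[mu j]_t K w.1 (conf_of_tuple w.2) (conf_of_tuple t))).
- exact: (@measurable_fun_fubini_tonelli_F _ _ _ _ _ (mu j) (fun w : (Q * tup i) * tup j =>
    K w.1.1 (conf_of_tuple w.1.2) (conf_of_tuple w.2))).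
- by move=> w; exact: integral_ge0.
Qed.

Lemma tuple_integral2_consl (H : fconf -> fconf -> \bar R) i j :
  (forall xi om, 0 <= H xi om) -> measurable_conf2 H ->
  tuple_integral2 H i.+1 j =
  \int[leb]_x tuple_integral2 (fun xi om => H (x |` xi)%fset om) i j.
Proof.
move=> H0 mH; rewrite /tuple_integral2 integral_tuple_cons.
- by apply: eq_integral => x _; apply: eq_integral => s _; rewrite conf_of_tuple_cons.
- exact: (@measurable_fun_fubini_tonelli_F _ _ _ _ _ (mu j)
    (fun w : tup i.+1 * tup j => H (conf_of_tuple w.1) (conf_of_tuple w.2)) (mH _ _)).
- by move=> t; exact: integral_ge0.
Qed.

Lemma tuple_integral2_consr (H : fconf -> fconf -> \bar R) i j :
  (forall xi om, 0 <= H xi om) -> measurable_conf2 H ->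
  tuple_integral2 H i j.+1 =
  \int[leb]_x tuple_integral2 (fun xi om => H xi (x |` om)%fset) i j.
Proof.
move=> H0 mH; rewrite /tuple_integral2.
under eq_integral => s _.
  rewrite integral_tuple_cons//; last first.
    apply: (measurableT_comp (f := H (conf_of_tuple s))).
      exact: measurable_conf2_r.
    exact: measurable_conf_of_tuple.
  over.
rewrite (fubini_tonelli (m1 := mu i) (m2 := leb) (fun w : tup i * Rd =>
  \int[mu j]_t H (conf_of_tuple w.1) (conf_of_tuple [tuple of w.2 :: t]))); last 2 first.
- apply: (@measurable_fun_fubini_tonelli_F _ _ _ _ _ (mu j) (fun w : (tup i * Rd) * tup j =>
    H (conf_of_tuple w.1.1) (conf_of_tuple [tuple of w.1.2 :: w.2]))) => //.
  rewrite (_ : (fun _ => _) = (fun w : tup i * tup j.+1 =>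
    H (conf_of_tuple w.1) (conf_of_tuple w.2)) \o
    (fun w : (tup i * Rd) * tup j => (w.1.1, [tuple of w.1.2 :: w.2])))//.
  apply: (measurableT_comp (mH i j.+1)); apply: measurable_fun_pair.
    by apply: (measurableT_comp measurable_fst).
  by apply: measurable_cons => //; apply: (measurableT_comp measurable_snd).
- by move=> w; exact: integral_ge0.
apply: eq_integral => x _; apply: eq_integral => s _; apply: eq_integral => t _ /=.
by rewrite conf_of_tuple_cons.
Qed.

(** By symmetry, the choices of [i] entries for the first part all contribute the same integral, and
    there are ['C(N, i)] of them when the entries are distinct. The induction peels off the head
    outside the null set where it recurs in the tail. *)
Lemma integral_subset_sum_tuple (H : fconf -> fconf -> \bar R) N :
  (forall xi om, 0 <= H xi om) -> measurable_conf2 H ->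
  \int[mu N]_t subset_sum H (conf_of_tuple t) =
  (\sum_(i < N.+1) tuple_integral2 H i (N - i) *+ 'C(N, i))%R.
Proof.
elim: N H => [|N IH] H H0 mH.
  rewrite big_ord_recl big_ord0 /= bin0 mulr1n addr0 /tuple_integral2.
  rewrite subnn !(integral_tuple0 leb) /= (conf_of_tuple0 [tuple]).
  exact: subset_sum0.
have mHl n i j : measurable_fun setT (fun w : ((Rd * tup n) * tup i) * tup j =>
    H (w.1.1.1 |` conf_of_tuple w.1.2)%fset (conf_of_tuple w.2)).
  rewrite (_ : (fun _ => _) = (fun w : tup i.+1 * tup j =>
     H (conf_of_tuple w.1) (conf_of_tuple w.2)) \o
     (fun w : ((Rd * tup n) * tup i) * tup j => ([tuple of w.1.1.1 :: w.1.2], w.2))).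
    apply: (measurableT_comp (mH _ _)); apply: measurable_fun_pair; last exact: measurable_snd.
    apply: measurable_cons.
      by apply: (measurableT_comp measurable_fst); apply: (measurableT_comp measurable_fst).
    by apply: (measurableT_comp measurable_snd).
  by apply/funext => w /=; rewrite conf_of_tuple_cons.
have mHr n i j : measurable_fun setT (fun w : ((Rd * tup n) * tup i) * tup j =>
    H (conf_of_tuple w.1.2) (w.1.1.1 |` conf_of_tuple w.2)%fset).
  rewrite (_ : (fun _ => _) = (fun w : tup i * tup j.+1 =>
     H (conf_of_tuple w.1) (conf_of_tuple w.2)) \o
     (fun w : ((Rd * tup n) * tup i) * tup j => (w.1.2, [tuple of w.1.1.1 :: w.2]))).
    apply: (measurableT_comp (mH _ _)); apply: measurable_fun_pair.
      by apply: (measurableT_comp measurable_snd).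
    apply: measurable_cons; last exact: measurable_snd.
    by apply: (measurableT_comp measurable_fst); apply: (measurableT_comp measurable_fst).
  by apply/funext => w /=; rewrite conf_of_tuple_cons.
have mHx (K : Rd -> fconf -> fconf -> \bar R) :
    (forall n i j, measurable_fun setT (fun w : ((Rd * tup n) * tup i) * tup j =>
      K w.1.1.1 (conf_of_tuple w.1.2) (conf_of_tuple w.2))) ->
    forall i j, measurable_fun setT (fun w : (Rd * tup i) * tup j =>
      K w.1.1 (conf_of_tuple w.1.2) (conf_of_tuple w.2)).
  move=> mK i j; rewrite (_ : (fun _ => _) = (fun w : ((Rd * tup i) * tup i) * tup j =>
      K w.1.1.1 (conf_of_tuple w.1.2) (conf_of_tuple w.2)) \o
      (fun w : (Rd * tup i) * tup j => ((w.1, w.1.2), w.2)))//.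
  apply: (measurableT_comp (mK i i j)); apply: measurable_fun_pair; last exact: measurable_snd.
  by apply: measurable_fun_pair => //; apply: (measurableT_comp measurable_snd).
have mHl' := mHx (fun x xi om => H (x |` xi)%fset om) mHl.
have mHr' := mHx (fun x xi om => H xi (x |` om)%fset) mHr.
have mc2 (K : Rd -> fconf -> fconf -> \bar R) x :
    (forall i j, measurable_fun setT (fun w : (Rd * tup i) * tup j =>
      K w.1.1 (conf_of_tuple w.1.2) (conf_of_tuple w.2))) -> measurable_conf2 (K x).
  move=> mK i j; rewrite (_ : (fun _ => _) = (fun w : (Rd * tup i) * tup j =>
      K w.1.1 (conf_of_tuple w.1.2) (conf_of_tuple w.2)) \o
      (fun w : tup i * tup j => ((x, w.1), w.2)))//.
  apply: (measurableT_comp (mK i j)); apply: measurable_fun_pair; last exact: measurable_snd.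
  by apply: measurable_fun_pair.
have mHlx x := mc2 (fun x xi om => H (x |` xi)%fset om) x mHl'.
have mHrx x := mc2 (fun x xi om => H xi (x |` om)%fset) x mHr'.
have S0 (K : fconf -> fconf -> \bar R) A : (forall xi om, 0 <= K xi om) -> 0 <= subset_sum K A.
  by move=> K0; apply: sume_ge0 => B _.
have mS n (K : Rd -> fconf -> fconf -> \bar R) :
    (forall n i j, measurable_fun setT (fun w : ((Rd * tup n) * tup i) * tup j =>
      K w.1.1.1 (conf_of_tuple w.1.2) (conf_of_tuple w.2))) ->
    measurable_fun setT (fun w : Rd * tup n => subset_sum (K w.1) (conf_of_tuple w.2)).
  by move=> mK; apply: measurable_subset_sum; [exact: mK|exact: measurable_snd].
have mSc n : measurable_fun setT (fun t : tup n => subset_sum H (conf_of_tuple t)).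
  apply: (measurable_subset_sum (H := fun=> H)) => // i j.
  rewrite (_ : (fun _ => _) = (fun w : tup i * tup j =>
    H (conf_of_tuple w.1) (conf_of_tuple w.2)) \o
    (fun w : (tup n * tup i) * tup j => (w.1.2, w.2)))//.
  apply: (measurableT_comp (mH i j)); apply: measurable_fun_pair; last exact: measurable_snd.
  by apply: (measurableT_comp measurable_snd).
rewrite integral_tuple_cons//; last by move=> t; exact: S0.
rewrite (integral_off_diagonal
  (f := fun w => subset_sum H (conf_of_tuple [tuple of w.1 :: w.2]))
  (g := fun w => subset_sum (fun xi om => H (w.1 |` xi)%fset om) (conf_of_tuple w.2) +
     subset_sum (fun xi om => H xi (w.1 |` om)%fset) (conf_of_tuple w.2))); last 5 first.
- apply: (measurableT_comp (mSc N.+1)).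
  by apply: measurable_cons.
- apply: emeasurable_funD.
  + exact: (mS _ (fun x xi om => H (x |` xi)%fset om)).
  + exact: (mS _ (fun x xi om => H xi (x |` om)%fset)).
- by move=> w; exact: S0.
- by move=> w; rewrite adde_ge0// S0.
- by move=> x t xt; rewrite conf_of_tuple_cons subset_sum_fset1U.
under eq_integral => x _.
  rewrite ge0_integralD//=; last 4 first.
  - by move=> t _; exact: S0.
  - exact: (measurableT_comp (mS _ (fun x xi om => H (x |` xi)%fset om) mHl)
      (measurable_pair1 x)).
  - by move=> t _; exact: S0.
  - exact: (measurableT_comp (mS _ (fun x xi om => H xi (x |` om)%fset) mHr)
      (measurable_pair1 x)).
  rewrite !IH// -big_split/=.
  under eq_bigr => i _ do rewrite -mulrnDl natmul_mule.
  over.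
have I0 (K : fconf -> fconf -> \bar R) i j : (forall xi om, 0 <= K xi om) ->
    0 <= tuple_integral2 K i j.
  by move=> K0; apply: integral_ge0 => s _; exact: integral_ge0.
have mIl i j := measurable_tuple_integral2 (K := fun x xi om => H (x |` xi)%fset om)
  (fun _ _ _ => H0 _ _) (mHl' i j).
have mIr i j := measurable_tuple_integral2 (K := fun x xi om => H xi (x |` om)%fset)
  (fun _ _ _ => H0 _ _) (mHr' i j).
rewrite ge0_integral_sum//; last 2 first.
- by move=> i; apply: measurable_funeM; exact: emeasurable_funD.
- by move=> i x _; rewrite mule_ge0// adde_ge0// I0.
rewrite sum_binomial_recr; apply: eq_bigr => i _.
rewrite ge0_integralZl//; last 2 first.
- exact: emeasurable_funD.
- by move=> x _; rewrite adde_ge0// I0.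
rewrite ge0_integralD//; last 2 first.
- by move=> x _; exact: I0.
- by move=> x _; exact: I0.
rewrite -natmul_mule subSn; last by rewrite -ltnS.
by rewrite tuple_integral2_consl// tuple_integral2_consr.
Qed.

End minlos.

Section minlos_identity.
Context {R : realType} {d : nat}.
Hypothesis d_gt0 : (0 < d)%N.
Local Notation Rd := 'rV[R]_d.
Local Notation tup n := (n.-tuple Rd).
Local Notation fconf := (fconf R d).
Local Notation leb := (@lebesgue_rV R d).
Local Notation lp := (@lebesgue_poisson R d).
Local Notation mu n := (tuple_measure leb n).
Local Open Scope ereal_scope.

Lemma measurable_fun_subset_sum (H : fconf -> fconf -> \bar R) : measurable_conf2 H ->
  measurable_fun setT (fun eta : fconf => subset_sum H eta : \bar R).
Proof.
move=> mH; apply: measurable_fun_fconf => n.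
apply: (measurable_subset_sum (H := fun=> H)) => // i j.
rewrite (_ : (fun _ => _) = (fun w : tup i * tup j =>
  H (conf_of_tuple w.1) (conf_of_tuple w.2)) \o
  (fun w : (tup n * tup i) * tup j => (w.1.2, w.2)))//.
apply: (measurableT_comp (mH i j)); apply: measurable_fun_pair; last exact: measurable_snd.
by apply: (measurableT_comp measurable_snd).
Qed.

(** Minlos' lemma. Since ['C(N, i) / N!] is the product of the inverses of [i!] and [(N - i)!], the
    series over [N] runs through the antidiagonals of the double series on the right. *)
Theorem integral_subset_sum (H : fconf -> fconf -> \bar R) :
  (forall xi om, 0 <= H xi om) -> measurable_conf2 H ->
  \int[lp]_eta subset_sum H eta = \int[lp]_xi \int[lp]_om H xi om.
Proof.
move=> H0 mH.
have I0 i j : 0 <= tuple_integral2 H i j.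
  by apply: integral_ge0 => s _; exact: integral_ge0.
have Hs n (s : tup n) : measurable_fun setT (fun om => H (conf_of_tuple s) om).
  exact: measurable_conf2_r.
rewrite ge0_integral_lebesgue_poisson; last 2 first.
- exact: measurable_fun_subset_sum.
- by move=> eta; apply: sume_ge0.
transitivity (\sum_(i <oo) \sum_(j <oo)
    ((i`!%:R^-1)%:E * (j`!%:R^-1)%:E) * tuple_integral2 H i j); last first.
  rewrite [RHS]ge0_integral_lebesgue_poisson; last 2 first.
  - exact: measurable_conf2_integral.
  - by move=> xi; exact: integral_ge0.
  apply: eq_eseriesr => i _.
  under [in RHS]eq_integral => s _ do rewrite ge0_integral_lebesgue_poisson//.
  rewrite integral_nneseries//; last 2 first.
  - move=> j; apply: measurable_funeM.
    exact: (@measurable_fun_fubini_tonelli_F _ _ _ _ _ (mu j) (fun w : tup i * tup j =>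
      H (conf_of_tuple w.1) (conf_of_tuple w.2)) (mH _ _)).
  - by move=> j s _; rewrite mule_ge0// ?lee_fin ?invr_ge0//; exact: integral_ge0.
  rewrite -nneseriesZl//; last first.
    move=> j _; apply: integral_ge0 => s _.
    by rewrite mule_ge0// ?lee_fin ?invr_ge0//; exact: integral_ge0.
  apply: eq_eseriesr => j _; rewrite -muleA; congr (_ * _).
  rewrite ge0_integralZl//.
  - exact: (@measurable_fun_fubini_tonelli_F _ _ _ _ _ (mu j) (fun w : tup i * tup j =>
      H (conf_of_tuple w.1) (conf_of_tuple w.2)) (mH _ _)).
  - by move=> s _; exact: integral_ge0.
rewrite -nneseries_antidiagonal; last first.
  by move=> i j; rewrite !mule_ge0// lee_fin invr_ge0.
apply: eq_eseriesr => N _; rewrite integral_subset_sum_tuple// ge0_sume_distrr; last first.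
  by move=> i _; rewrite natmul_mule mule_ge0.
apply: eq_bigr => i _; rewrite natmul_mule muleA -!EFinM; congr (_%:E * _).
have iN : (i <= N)%N by rewrite -ltnS.
rewrite -(bin_fact iN) !natrM !invfM mulrAC mulVf ?mul1r//.
by rewrite pnatr_eq0 -lt0n bin_gt0.
Qed.

Lemma e_lambda0 (f : Rd -> R) : e_lambda f fset0 = 1%R.
Proof. by rewrite /e_lambda big_seq_fset0. Qed.

Lemma e_lambda_fset1U (f : Rd -> R) x (eta : fconf) : x \notin eta ->
  e_lambda f (x |` eta)%fset = (f x * e_lambda f eta)%R.
Proof. by move=> xeta; rewrite /e_lambda big_fsetU1. Qed.

Lemma e_lambda_ge0 (f : Rd -> R) (eta : fconf) : (forall x, 0 <= f x)%R ->
  (0 <= e_lambda f eta)%R.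
Proof. by move=> f0; apply: prodr_ge0. Qed.

Lemma measurable_e_lambda_tuple {dQ} {Q : measurableType dQ} (f : Q -> Rd -> R) n
  (g : Q -> tup n) : measurable_fun setT (fun w : Q * Rd => f w.1 w.2) ->
  measurable_fun setT g ->
  measurable_fun setT (fun q => e_lambda (f q) (conf_of_tuple (g q))).
Proof.
by move=> mf mg; apply: measurable_big_conf => // dP P a b ma mb; exact: measurable_funM.
Qed.

Lemma measurable_e_lambda (f : Rd -> R) : measurable_fun setT f ->
  measurable_fun setT (e_lambda f).
Proof.
move=> mf; apply: measurable_fun_fconf => n.
apply: (measurable_e_lambda_tuple (f := fun=> f)) => //.
by apply: (measurableT_comp mf); exact: measurable_snd.
Qed.

(** For distinct entries [e_lambda] is a product of functions of one entry each. Repeated entries,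
    whose factor occurs only once, form a null set. *)
Lemma integral_e_lambda_tuple (f : Rd -> R) n : measurable_fun setT f ->
  (forall x, 0 <= f x)%R ->
  \int[mu n]_t (e_lambda f (conf_of_tuple t))%:E = (\int[leb]_x (f x)%:E) ^+ n.
Proof.
move=> mf f0; elim: n => [|n IH].
  by rewrite integral_tuple0 conf_of_tuple0 e_lambda0.
have me m : measurable_fun setT (fun t : tup m => (e_lambda f (conf_of_tuple t))%:E).
  apply/measurable_EFinP; apply: measurableT_comp; first exact: measurable_e_lambda.
  exact: measurable_conf_of_tuple.
have e0 m (t : tup m) : 0 <= (e_lambda f (conf_of_tuple t))%:E.
  by rewrite lee_fin e_lambda_ge0.
rewrite integral_tuple_cons//.
rewrite (integral_off_diagonal d_gt0
  (f := fun w => (e_lambda f (conf_of_tuple [tuple of w.1 :: w.2]))%:E)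
  (g := fun w => (f w.1)%:E * (e_lambda f (conf_of_tuple w.2))%:E)); last 5 first.
- by apply: (measurableT_comp (me n.+1)); exact: measurable_cons.
- apply: emeasurable_funM.
  + by apply/measurable_EFinP; apply: measurableT_comp.
  + by apply: (measurableT_comp (me n)); exact: measurable_snd.
- by move=> w.
- by move=> w; rewrite mule_ge0// lee_fin.
- by move=> x t xt; rewrite conf_of_tuple_cons e_lambda_fset1U.
transitivity (\int[leb]_x ((f x)%:E * (\int[leb]_y (f y)%:E) ^+ n)).
  by apply: eq_integral => x _; rewrite /= ge0_integralZl// ?IH//; [exact: me|rewrite lee_fin].
rewrite ge0_integralZr ?expeS//.
- by apply/measurable_EFinP.
- by move=> x _; rewrite lee_fin.
- by rewrite expe_ge0//; apply: integral_ge0 => x _; rewrite lee_fin.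
Qed.

Lemma integral_e_lambda (f : Rd -> R) b : measurable_fun setT f ->
  (forall x, 0 <= f x)%R -> \int[leb]_x (f x)%:E = b%:E ->
  \int[lp]_eta (e_lambda f eta)%:E = (expR b)%:E.
Proof.
move=> mf f0 fb; rewrite ge0_integral_lebesgue_poisson; last 2 first.
- by apply/measurable_EFinP; exact: measurable_e_lambda.
- by move=> eta; rewrite lee_fin e_lambda_ge0.
transitivity (\sum_(n <oo) (exp_coeff b n)%:E).
  apply: eq_eseriesr => n _; rewrite integral_e_lambda_tuple// fb.
  by rewrite /exp_coeff /= mulrC EFinM -EFin_expe.
rewrite /expR -EFin_lim; last exact: is_cvg_series_exp_coeff.
by congr (limn _); apply/funext => n; rewrite /= /series/= sumEFin.
Qed.

Lemma measurable_card_tuple n :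
  measurable_fun setT (fun t : tup n => #|` conf_of_tuple t|%fset).
Proof.
rewrite (_ : (fun _ => _) = fun t : tup n => (\sum_(y <- conf_of_tuple t) 1)%N).
  apply: (measurable_big_conf (U := nat) (h := fun _ _ => 1%N)) => //.
  by move=> dP P a b ma mb; exact: measurable_fun_addn.
by apply/funext => t; rewrite sum1_size.
Qed.

Lemma measurable_fun_nat {dU} {U : measurableType dU} {dQ} {Q : measurableType dQ}
  (h : nat -> U) (c : Q -> nat) : measurable_fun setT c ->
  measurable_fun setT (fun q => h (c q)).
Proof. by move=> mc; apply: (measurableT_comp (f := h)). Qed.

Lemma measurable_fun_nat2 {dU} {U : measurableType dU} {dQ} {Q : measurableType dQ}
  (h : nat -> Q -> U) (c : Q -> nat) : measurable_fun setT c ->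
  (forall n, measurable_fun setT (h n)) ->
  measurable_fun setT (fun q => h (c q) q).
Proof.
move=> mc mh _ B mB; rewrite setTI.
rewrite (_ : _ @^-1` _ = \bigcup_n ((c @^-1` [set n]) `&` (h n @^-1` B))).
  apply: bigcupT_measurable => n; apply: measurableI.
  - by rewrite -[X in measurable X]setTI; exact: mc.
  - by rewrite -[X in measurable X]setTI; exact: mh.
by apply/seteqP; split=> q /= => [qB|[n _ [<-]]//]; exists (c q).
Qed.

Lemma measurable_conf2_card (h : nat -> nat -> R) :
  measurable_conf2 (fun xi om : fconf => h #|` xi|%fset #|` om|%fset).
Proof.
move=> n m.
apply: (measurable_fun_nat2 (h := fun k (w : tup n * tup m) => h k #|` conf_of_tuple w.2|%fset)
  (c := fun w : tup n * tup m => #|` conf_of_tuple w.1|%fset)).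
  exact: (measurableT_comp (@measurable_card_tuple n) measurable_fst).
move=> k; apply: measurable_fun_nat.
exact: (measurableT_comp (@measurable_card_tuple m) measurable_snd).
Qed.

Lemma ge0_integral_lp_card0 (F : fconf -> \bar R) : measurable_fun setT F ->
  (forall om, 0 <= F om) -> (forall om, om != fset0 -> F om = 0) ->
  \int[lp]_om F om = F fset0.
Proof.
move=> mF F0 Fs; rewrite ge0_integral_lebesgue_poisson// (nneseries_split 0 1)//; last first.
  by move=> k _; rewrite mule_ge0// ?lee_fin ?invr_ge0//; exact: integral_ge0.
rewrite big_mkord big_ord1 integral_tuple0 conf_of_tuple0 fact0 invr1 mul1e.
rewrite eseries0 ?adde0// => -[//|n] _ _.
rewrite integral0_eq ?mule0// => t _; apply: Fs.
rewrite (tuple_eta t) conf_of_tuple_cons; apply/eqP => /fsetP/(_ (thead t)).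
by rewrite !inE eqxx.
Qed.

(** A tuple of length at least 2 yields a one-point configuration only if all its entries coincide,
    hence on a null set; the empty tuple yields none. *)
Lemma ge0_integral_lp_card1 (F : fconf -> \bar R) : measurable_fun setT F ->
  (forall om, 0 <= F om) -> (forall om, #|` om|%fset != 1%N -> F om = 0) ->
  \int[lp]_om F om = \int[leb]_x F [fset x]%fset.
Proof.
move=> mF F0 Fs; rewrite ge0_integral_lebesgue_poisson// (nneseries_split 0 2)//; last first.
  by move=> k _; rewrite mule_ge0// ?lee_fin ?invr_ge0//; exact: integral_ge0.
have mFt n : measurable_fun setT (fun t : tup n => F (conf_of_tuple t)).
  by apply: (measurableT_comp mF); exact: measurable_conf_of_tuple.
rewrite add0n big_ltn// big_ltn// big_geq// (integral_tuple0 leb) conf_of_tuple0.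
rewrite Fs ?cardfs0// mule0 add0e adde0 factS fact0 muln1 invr1 mul1e.
rewrite eseries0 ?adde0//.
  rewrite integral_tuple_cons//; apply: eq_integral => x _.
  by rewrite integral_tuple0 conf_of_tuple_cons conf_of_tuple0 fsetU0.
case=> [//|[//|n]] _ _; rewrite integral_tuple_cons//.
rewrite (integral_off_diagonal d_gt0
  (f := fun w => F (conf_of_tuple [tuple of w.1 :: w.2])) (g := cst 0)) => //.
- rewrite integral0_eq ?mule0// => x _; exact: integral0.
- by apply: (measurableT_comp (mFt n.+2)); exact: measurable_cons.
- move=> x t xt; rewrite conf_of_tuple_cons /=; apply: Fs.
  rewrite cardfsU1 xt add1n eqSS cardfs_eq0.
  rewrite (tuple_eta t) conf_of_tuple_cons; apply/eqP => /fsetP/(_ (thead t)).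
  by rewrite !inE eqxx.
Qed.

End minlos_identity.

(** * Translation invariance of Lebesgue measure *)

Section translation_invariance.
Context {R : realType}.
Local Open Scope ereal_scope.
Local Notation leb1 := (@lebesgue_measure R).
Local Notation mR := (measurableTypeR R).

Lemma measurable_translation (c : R) :
  measurable_fun setT ((fun x => x + c)%R : mR -> mR).
Proof. by apply: (@measurable_funD _ mR R _ id (cst c)). Qed.

(** The translated measure agrees with Lebesgue measure on half-open intervals, which determine
    it. *)
Lemma ge0_integral_translation (c : R) (f : mR -> \bar R) :
  measurable_fun setT f -> (forall x, 0 <= f x) ->
  \int[leb1]_x f (x + c)%R = \int[leb1]_x f x.
Proof.
move=> mf f0; have mc := measurable_translation c.
transitivity (\int[pushforward leb1 ((fun x => x + c)%R : mR -> mR)]_x f x).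
  by rewrite ge0_integral_pushforward.
apply: eq_measure_integral => //= A mA _.
apply/esym/lebesgue_measure_unique => //= _ [[a b]] _ <-.
rewrite /pushforward.
have -> : (fun x => x + c)%R @^-1` `]a, b] = `](a - c)%R, (b - c)%R]%classic.
  by apply/seteqP; split => x /=; rewrite !in_itv/= ltrBlDr lerBrDr.
rewrite !lebesgue_measure_itv/= !lte_fin ltrD2r -!EFinB.
by rewrite opprB addrA subrK.
Qed.

Definition tuple_translation n (c t : n.-tuple mR) : n.-tuple mR :=
  [tuple (tnth t i + tnth c i)%R | i < n].

Lemma measurable_tuple_translation n (c : n.-tuple mR) :
  measurable_fun setT (tuple_translation c).
Proof.
apply/measurable_fun_tnthP => i.
rewrite (_ : _ \o _ = (fun x => x + tnth c i)%R \o (@tnth n mR ^~ i)); last first.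
  by apply/funext => t; rewrite /= tnth_mktuple.
apply: measurableT_comp; first exact: measurable_translation.
exact: measurable_tnth.
Qed.

Lemma ge0_integral_tuple_translation n (c : n.-tuple mR) (f : n.-tuple mR -> \bar R) :
  measurable_fun setT f -> (forall x, 0 <= f x) ->
  \int[tuple_measure leb1 n]_t f (tuple_translation c t) = \int[tuple_measure leb1 n]_t f t.
Proof.
elim: n c f => [|n IH] c f mf f0.
  by rewrite !(integral_tuple0 leb1); congr f; exact: tuple0.
rewrite !integral_tuple_cons//; last first.
  by apply: measurableT_comp => //; exact: measurable_tuple_translation.
have mfc (x : mR) : measurable_fun setT (fun t : n.-tuple mR => f [tuple of x :: t]).
  by apply: measurableT_comp => //; exact: measurable_cons.
transitivity (\int[leb1]_x \int[tuple_measure leb1 n]_t f [tuple of (x + thead c)%R :: t]).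
  apply: eq_integral => x _.
  rewrite -[RHS](IH [tuple of behead c] (fun t => f [tuple of (x + thead c)%R :: t]))//.
  apply: eq_integral => t _; congr f; apply/eq_from_tnth => i.
  rewrite tnth_mktuple; have [j ->|->] := fintype.unliftP ord0 i.
    rewrite !tnthS tnth_mktuple tnth_behead; congr (_ + tnth c _)%R.
    by apply/val_inj; rewrite /= inordK// ltnS.
  by rewrite !tnth0.
rewrite (ge0_integral_translation (thead c)
  (f := fun x => \int[tuple_measure leb1 n]_t f [tuple of x :: t]))//.
- apply: (@measurable_fun_fubini_tonelli_F _ _ _ _ _ (tuple_measure leb1 n)
    (fun w : mR * n.-tuple mR => f [tuple of w.1 :: w.2])) => //.
  by apply: (measurableT_comp mf); exact: measurable_cons.
- by move=> x; exact: integral_ge0.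
Qed.

Lemma ge0_integral_rV_translation d (c : 'rV[R]_d) (f : 'rV[R]_d -> \bar R) :
  measurable_fun setT f -> (forall x, 0 <= f x) ->
  \int[lebesgue_rV]_x f (x + c)%R = \int[lebesgue_rV]_x f x.
Proof.
move=> mf f0.
have mc : measurable_fun setT (fun x : 'rV[R]_d => x + c)%R.
  apply: measurable_fun_rV => i.
  rewrite [X in measurable_fun _ X](_ : _ = fun x => (rV_coord i x + c ord0 i)%R).
    by apply: measurable_funD => //; exact: measurable_rV_coord.
  by apply/funext => x; rewrite /= !mxE.
have mfc : measurable_fun setT (fun x : 'rV[R]_d => f (x + c)%R).
  exact: (measurableT_comp mf mc).
rewrite !(ge0_integral_pushforward (@measurable_tuple_row R d))//.
rewrite !preimage_setT.
have mft : measurable_fun setT (f \o @tuple_row R d).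
  by apply: measurableT_comp => //; exact: measurable_tuple_row.
rewrite -[RHS](ge0_integral_tuple_translation [tuple rV_coord i c | i < d] mft)//=.
apply: eq_integral => t _ /=; congr f; apply/rowP => i.
by rewrite !mxE tnth_mktuple tnth_mktuple.
Qed.

End translation_invariance.

(** The induction step is [(1 - p i) * (1 - P) >= 0], where [P] is the product of the remaining
    factors. *)
Lemma one_minus_prod_le (R : realDomainType) (I : Type) (s : seq I) (p : I -> R) :
  (forall i, 0 <= p i <= 1) -> 1 - \prod_(i <- s) p i <= \sum_(i <- s) (1 - p i).
Proof.
move=> p01; elim: s => [|i s IH]; first by rewrite !big_nil subrr.
have /andP[p0 p1] := p01 i.
have P0 : 0 <= \prod_(i <- s) p i by apply: prodr_ge0 => j; case/andP: (p01 j).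
have P1 : \prod_(i <- s) p i <= 1.
  by apply: prodr_ile1 => j _; exact: p01.
rewrite !big_cons; set P := \prod_(i <- s) p i in IH P0 P1 *.
have : 0 <= (1 - p i) * (1 - P) by rewrite mulr_ge0// subr_ge0.
rewrite mulrBl mul1r mulrBr mulr1; lra.
Qed.

(** * Operators of Glauber type *)

Section kernel_operator.
Context {R : realType} {d : nat}.
Hypothesis d_gt0 : (0 < d)%N.
Local Notation Rd := 'rV[R]_d.
Local Notation tup n := (n.-tuple Rd).
Local Notation fconf := (fconf R d).
Local Notation leb := (@lebesgue_rV R d).
Local Notation lp := (@lebesgue_poisson R d).
Variable phi : Rd -> R.
Hypothesis mphi : measurable_fun setT phi.
Hypothesis phi_ge0 : forall x, 0 <= phi x.
Variable cphi : R.
Hypothesis C_phiE : C_phi phi = cphi%:E.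

Definition boltzmann (om : fconf) (y : Rd) : R := expR (- energy phi y om).

Lemma boltzmann_ge0 om y : 0 <= boltzmann om y.
Proof. exact: expR_ge0. Qed.

Lemma boltzmann_le1 om y : boltzmann om y <= 1.
Proof. by rewrite -expR0 ler_expR oppr_le0; apply: sumr_ge0. Qed.

Lemma boltzmannE om y : boltzmann om y = \prod_(x <- om) expR (- phi (y - x)).
Proof. by rewrite /boltzmann /energy -sumrN expR_sum. Qed.

Lemma boltzmann0 y : boltzmann fset0 y = 1.
Proof. by rewrite boltzmannE big_seq_fset0. Qed.

Lemma measurable_boltzmann {dQ} {Q : measurableType dQ} n (g : Q -> tup n) (f : Q -> Rd) :
  measurable_fun setT g -> measurable_fun setT f ->
  measurable_fun setT (fun q => boltzmann (conf_of_tuple (g q)) (f q)).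
Proof.
move=> mg mf; apply: measurableT_comp; first exact: measurable_expR.
apply: measurableT_comp => //.
apply: (measurable_big_conf (h := fun q y => phi (f q - y))) => //.
  by move=> dP P a b ma mb; exact: measurable_funD.
apply: measurableT_comp => //; apply: measurable_rV_sub; last exact: measurable_snd.
by apply: (measurableT_comp mf).
Qed.

Lemma measurable_boltzmannr om : measurable_fun setT (boltzmann om).
Proof.
have [n [t <-]] := conf_of_tupleP om.
by apply: (measurable_boltzmann (g := fun=> t)).
Qed.

(** By [one_minus_prod_le] the integrand is at most a sum over the points of [om]; by translation
    invariance each point contributes [cphi]. *)
Lemma integral_boltzmann_le om :
  (\int[leb]_y (1 - boltzmann om y)%:E <= (cphi * #|` om|%fset%:R)%:E)%E.
Proof.
have mshift (x : Rd) : measurable_fun setT (fun y : Rd => (1 - expR (- phi (y - x)))%:E).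
  apply/measurable_EFinP; apply: measurable_funB => //.
  apply: (measurableT_comp (@measurable_expR R)); apply: measurableT_comp => //.
  by apply: measurableT_comp => //; exact: measurable_rV_sub.
have e1 x : expR (- phi x) <= 1 by rewrite -expR0 ler_expR oppr_le0.
apply: (@le_trans _ _ (\int[leb]_y (\sum_(x <- om) (1 - expR (- phi (y - x)))%:E))%E).
  apply: ge0_le_integral => //.
  - by move=> y _; rewrite lee_fin subr_ge0 boltzmann_le1.
  - apply/measurable_EFinP; apply: measurable_funB => //; exact: measurable_boltzmannr.
  - by apply: emeasurable_sum.
  - move=> y _; rewrite sumEFin lee_fin boltzmannE; apply: one_minus_prod_le => x.
    by rewrite expR_ge0 e1.
rewrite ge0_integral_sum//; last by move=> x y _; rewrite lee_fin subr_ge0.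
rewrite (eq_bigr (fun=> cphi%:E)) => [|x _]; last first.
  rewrite -C_phiE /C_phi -(ge0_integral_rV_translation (- x)
    (f := fun y => (1 - expR (- phi y))%:E))//.
  - apply/measurable_EFinP; apply: measurable_funB => //.
    by apply: (measurableT_comp (@measurable_expR R)); exact: measurableT_comp.
  - by move=> y; rewrite lee_fin subr_ge0.
by rewrite sumEFin lee_fin big_const_seq count_predT iter_addr_0 mulr_natr.
Qed.

(* [Phat] and the birth part of [Lhat] are [glauber_op a] for suitable [a]; in the
   latter [a] restricts [omega] to one-point configurations. *)
Definition glauber_kernel (a : fconf -> fconf -> R) (G : obs R d) (xi ze om : fconf) : R :=
  a xi om * G (xi `|` om)%fset *
  (e_lambda (boltzmann om) xi * e_lambda (fun y => boltzmann om y - 1) ze).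

Definition glauber_op a (G : obs R d) : obs R d := fun eta =>
  subset_sum (fun xi ze => \int[lp]_om glauber_kernel a G xi ze om) eta.

(* Where this is infinite, the value of [glauber_op a G] is junk. *)
Definition glauber_abs a (G : obs R d) (eta : fconf) : \bar R :=
  subset_sum (fun xi ze => \int[lp]_om `|glauber_kernel a G xi ze om|%:E)%E eta.

(** The weight that multiplies [|G|] in [kernel_bound]. A point of [om] costs the factor
    [expR (C * cphi)], the price of integrating out the points that interact with it. *)
Definition weight (a : fconf -> fconf -> R) (C : R) (eta : fconf) : R :=
  subset_sum (fun xi om => `|a xi om| * C ^+ #|` xi|%fset *
    expR (C * cphi) ^+ #|` om|%fset) eta.

Section measurability.
Variables (a : fconf -> fconf -> R) (G : obs R d).
Hypothesis ma : measurable_conf2 a.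
Hypothesis mG : measurable_fun setT G.

Lemma measurable_glauber_kernel {dQ} {Q : measurableType dQ} n m k (f : Q -> tup n)
  (g : Q -> tup m) (h : Q -> tup k) :
  measurable_fun setT f -> measurable_fun setT g -> measurable_fun setT h ->
  measurable_fun setT (fun q =>
    glauber_kernel a G (conf_of_tuple (f q)) (conf_of_tuple (g q)) (conf_of_tuple (h q))).
Proof.
move=> mf mg mh; apply: measurable_funM; apply: measurable_funM.
- exact: (measurableT_comp (@ma n k) (measurable_fun_pair mf mh)).
- under eq_fun do rewrite -conf_of_tuple_cat.
  apply: (measurableT_comp mG); apply: (measurableT_comp (@measurable_conf_of_tuple R d _)).
  exact: measurable_tuple_cat.
- apply: measurable_e_lambda_tuple => //; apply: measurable_boltzmann.
    by apply: (measurableT_comp mh).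
  exact: measurable_snd.
- apply: measurable_e_lambda_tuple => //; apply: measurable_funB => //.
  apply: measurable_boltzmann; last exact: measurable_snd.
  by apply: (measurableT_comp mh).
Qed.

Lemma measurable_glauber_kernel_om xi ze : measurable_fun setT (glauber_kernel a G xi ze).
Proof.
have [n [s <-]] := conf_of_tupleP xi; have [m [t <-]] := conf_of_tupleP ze.
apply: measurable_fun_fconf => k.
by apply: (measurable_glauber_kernel (f := fun=> s) (g := fun=> t)).
Qed.

Lemma measurable_conf2_glauber_abs :
  measurable_conf2 (fun xi ze => \int[lp]_om `|glauber_kernel a G xi ze om|%:E)%E.
Proof.
move=> n m; apply: (measurable_integral_lp (H := fun (w : tup n * tup m) om =>
  `|glauber_kernel a G (conf_of_tuple w.1) (conf_of_tuple w.2) om|%:E)) => // k.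
apply/measurable_EFinP; apply: measurableT_comp => //; apply: measurable_glauber_kernel => //.
- by apply: (measurableT_comp measurable_fst).
- by apply: (measurableT_comp measurable_snd).
Qed.

Lemma measurable_glauber_abs : measurable_fun setT (glauber_abs a G).
Proof. exact: (measurable_fun_subset_sum measurable_conf2_glauber_abs). Qed.

(** This includes the points where an integral diverges: positive and negative parts are integrated
    separately and recombined by measurable operations on the extended reals. *)
Lemma measurable_glauber_op : measurable_fun setT (glauber_op a G).
Proof.
have mI : measurable_conf2 (fun xi ze => (\int[lp]_om glauber_kernel a G xi ze om)%:E).
  move=> n m; apply/measurable_EFinP; rewrite /Rintegral.
  apply: measurableT_comp; first exact: fine_measurable.
  under eq_fun do rewrite integralE.
  have mk k : measurable_fun setT (fun w : (tup n * tup m) * tup k =>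
      (glauber_kernel a G (conf_of_tuple w.1.1) (conf_of_tuple w.1.2) (conf_of_tuple w.2))%:E).
    apply/measurable_EFinP; apply: measurable_glauber_kernel => //.
      by apply: (measurableT_comp measurable_fst).
    by apply: (measurableT_comp measurable_snd).
  apply: emeasurable_funB.
  - apply: (measurable_integral_lp (H := fun (w : tup n * tup m) =>
      (fun om => (glauber_kernel a G (conf_of_tuple w.1)
        (conf_of_tuple w.2) om)%:E)^\+)%E) => // k.
    apply: (eq_measurable_fun _ _ (measurable_funepos (mk k))) => w _.
    by rewrite !funeposE.
  - apply: (measurable_integral_lp (H := fun (w : tup n * tup m) =>
      (fun om => (glauber_kernel a G (conf_of_tuple w.1)
        (conf_of_tuple w.2) om)%:E)^\-)%E) => // k.
    apply: (eq_measurable_fun _ _ (measurable_funeneg (mk k))) => w _.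
    by rewrite !funenegE.
apply/measurable_EFinP.
rewrite (_ : _ \o _ = fun eta =>
    subset_sum (fun xi ze => (\int[lp]_om glauber_kernel a G xi ze om)%:E) eta).
  exact: measurable_fun_subset_sum.
by apply/funext => eta; rewrite /glauber_op /subset_sum /= -sumEFin.
Qed.

End measurability.

End kernel_operator.

(** * The norm bound for Glauber operators *)

Section kernel_bound.
Context {R : realType} {d : nat}.
Hypothesis d_gt0 : (0 < d)%N.
Local Notation Rd := 'rV[R]_d.
Local Notation tup n := (n.-tuple Rd).
Local Notation fconf := (fconf R d).
Local Notation leb := (@lebesgue_rV R d).
Local Notation lp := (@lebesgue_poisson R d).
Variable phi : Rd -> R.
Hypothesis mphi : measurable_fun setT phi.
Hypothesis phi_ge0 : forall x, 0 <= phi x.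
Variable cphi : R.
Hypothesis C_phiE : C_phi phi = cphi%:E.
Variables (a : fconf -> fconf -> R) (G : obs R d).
Hypothesis ma : measurable_conf2 a.
Hypothesis mG : measurable_fun setT G.
Local Notation boltzmann := (boltzmann phi).
Local Notation kern := (glauber_kernel phi a G).

Lemma normr_kernel xi ze om : `|kern xi ze om| =
  `|a xi om * G (xi `|` om)%fset| * (e_lambda (boltzmann om) xi *
    e_lambda (fun y => 1 - boltzmann om y) ze).
Proof.
rewrite /glauber_kernel !normrM; congr (_ * (_ * _)).
- by rewrite ger0_norm// e_lambda_ge0// => y; exact: boltzmann_ge0.
- rewrite /e_lambda normr_prod; apply: eq_bigr => y _.
  by rewrite distrC ger0_norm// subr_ge0 boltzmann_le1.
Qed.

Lemma e_lambdaZ (c : R) (f : Rd -> R) (eta : fconf) :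
  c ^+ #|` eta|%fset * e_lambda f eta = e_lambda (fun y => c * f y) eta.
Proof.
rewrite /e_lambda big_split /= big_const_seq count_predT iter_mulr_1.
by [].
Qed.

Lemma e_lambda_le1 (f : Rd -> R) (eta : fconf) : (forall x, 0 <= f x <= 1) ->
  e_lambda f eta <= 1.
Proof. by move=> f01; apply: prodr_ile1. Qed.

Lemma cardfs_subset (A B : fconf) : (B `<=` A)%fset ->
  #|` A|%fset = (#|` B| + #|` A `\` B|)%N%fset.
Proof. by move=> BA; rewrite -(cardfsID B A) fsetIC (fsetIidPl BA). Qed.

Lemma fsetU_setD (A B : fconf) : (B `<=` A)%fset -> (B `|` (A `\` B))%fset = A.
Proof.
move=> /fsubsetP BA; apply/fsetP => x; rewrite !inE.
by case: (boolP (x \in B)) => //= /BA ->.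
Qed.

Lemma measurable_conf2_union : measurable_conf2 (fun xi om : fconf => G (xi `|` om)%fset).
Proof.
move=> n m; under eq_fun do rewrite -conf_of_tuple_cat.
apply: (measurableT_comp mG); apply: (measurableT_comp (@measurable_conf_of_tuple R d _)).
exact: measurable_tuple_cat.
Qed.

Variable C : R.
Hypothesis C_ge0 : 0 <= C.
Local Notation kappa := (expR (C * cphi)).

Let bound xi om := `|a xi om * G (xi `|` om)%fset| * (C ^+ #|` xi|%fset *
  kappa ^+ #|` om|%fset).

Let mbound : measurable_conf2 bound.
Proof.
move=> n m; apply: measurable_funM.
  apply: measurableT_comp => //; apply: measurable_funM; first exact: ma.
  exact: measurable_conf2_union.
exact: (measurable_conf2_card (fun i j => C ^+ i * kappa ^+ j)).
Qed.

Let weighted_kernel xi ze om : R :=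
  `|kern xi ze om| * (C ^+ #|` xi|%fset * C ^+ #|` ze|%fset).

Let mweighted {dQ} {Q : measurableType dQ} n m k (f : Q -> tup n)
  (g : Q -> tup m) (h : Q -> tup k) :
  measurable_fun setT f -> measurable_fun setT g -> measurable_fun setT h ->
  measurable_fun setT (fun q =>
    weighted_kernel (conf_of_tuple (f q)) (conf_of_tuple (g q)) (conf_of_tuple (h q))).
Proof.
move=> mf mg mh; apply: measurable_funM.
  by apply: measurableT_comp => //; exact: measurable_glauber_kernel.
have mc := @measurable_conf2_card R d (fun i j => C ^+ i * C ^+ j).
exact: (measurableT_comp (mc n m) (measurable_fun_pair mf mg)).
Qed.

Let weighted_ge0 xi ze om : 0 <= weighted_kernel xi ze om.
Proof. by rewrite !mulr_ge0// exprn_ge0. Qed.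

(* Integrating out [ze] gives [exp (C * \int (1 - exp (- E (y, om))) dy)], and
   [1 - exp (- E (y, om))] is at most the sum of [1 - exp (- phi (y - x))] over
   [x] in [om]. *)
Let integral_weighted_kernel_le xi om :
  (\int[lp]_ze (weighted_kernel xi ze om)%:E <= (bound xi om)%:E)%E.
Proof.
pose f y := C * (1 - boltzmann om y).
have mb := measurable_boltzmannr mphi om.
have mf : measurable_fun setT f.
  by apply: measurable_funM => //; exact: measurable_funB.
have f0 y : 0 <= f y by rewrite mulr_ge0// subr_ge0 boltzmann_le1.
have := integral_boltzmann_le mphi phi_ge0 C_phiE om.
set b := (\int[leb]_y _)%E => bC.
have b0 : (0 <= b)%E by apply: integral_ge0 => y _; rewrite lee_fin subr_ge0 boltzmann_le1.
have bfin : b \is a fin_num by rewrite ge0_fin_numE// (le_lt_trans bC)// ltry.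
have fE : (\int[leb]_y (f y)%:E = (C * fine b)%:E)%E.
  rewrite EFinM fineK// /b -ge0_integralZl//.
  - by apply/measurable_EFinP; exact: measurable_funB.
  - by move=> y _; rewrite lee_fin subr_ge0 boltzmann_le1.
pose c := `|a xi om * G (xi `|` om)%fset| * e_lambda (boltzmann om) xi * C ^+ #|` xi|%fset.
have c0 : 0 <= c.
  by rewrite !mulr_ge0// ?exprn_ge0// e_lambda_ge0// => y; exact: boltzmann_ge0.
have -> : (\int[lp]_ze (weighted_kernel xi ze om)%:E =
    \int[lp]_ze (c%:E * (e_lambda f ze)%:E))%E.
  apply: eq_integral => ze _; rewrite -EFinM; congr EFin.
  rewrite /weighted_kernel normr_kernel -e_lambdaZ /c.
  set x1 := `|_|; set x2 := e_lambda _ _; set x3 := e_lambda _ _.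
  set x4 := C ^+ _; set x5 := C ^+ _; lra.
rewrite ge0_integralZl//; last 2 first.
- by apply/measurable_EFinP; exact: measurable_e_lambda.
- by move=> ze _; rewrite lee_fin e_lambda_ge0.
rewrite (integral_e_lambda d_gt0 mf f0 fE) -EFinM lee_fin /bound.
apply: (@le_trans _ _ (c * kappa ^+ #|` om|%fset)).
  rewrite ler_wpM2l// -expRM_natl ler_expR mulrCA ler_wpM2l//.
  by rewrite -lee_fin fineK// mulrC.
rewrite /c mulrA ler_wpM2r ?exprn_ge0 ?expR_ge0//.
rewrite ler_wpM2r ?exprn_ge0// ler_piMr// e_lambda_le1// => y.
by rewrite boltzmann_ge0 boltzmann_le1.
Qed.

(** Minlos' lemma first separates [eta] into [xi] and [ze], so that [ze] can be integrated out for
    fixed [xi] and [om]. Read backwards, it then merges [xi] and [om] into one configuration, the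
    one at which [G] is evaluated. *)
Theorem kernel_bound :
  (\int[lp]_eta (glauber_abs phi a G eta * (C ^+ #|` eta|%fset)%:E) <=
   \int[lp]_eta (`|G eta| * weight cphi a C eta)%:E)%E.
Proof.
pose H xi ze := (\int[lp]_om (weighted_kernel xi ze om)%:E)%E.
have H0 xi ze : (0 <= H xi ze)%E.
  by apply: integral_ge0 => om _; rewrite lee_fin.
have mk xi ze := measurable_glauber_kernel_om mphi ma mG xi ze.
have -> : (\int[lp]_eta (glauber_abs phi a G eta * (C ^+ #|` eta|%fset)%:E) =
    \int[lp]_eta subset_sum H eta)%E.
  apply: eq_integral => eta _.
  rewrite /glauber_abs /subset_sum ge0_sume_distrl; last first.
    by move=> xi _; apply: integral_ge0 => om _; rewrite lee_fin.
  apply: eq_big_seq => xi; rewrite fpowersetE => xieta.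
  rewrite -ge0_integralZr//.
  - apply: eq_integral => om _; rewrite -EFinM; congr EFin.
    by rewrite /weighted_kernel -exprD -cardfs_subset.
  - by apply/measurable_EFinP; apply: measurableT_comp => //; exact: mk.
  - by rewrite lee_fin exprn_ge0.
have mH : measurable_conf2 H.
  move=> n m; apply: (measurable_integral_lp (H := fun (w : tup n * tup m) om =>
    (weighted_kernel (conf_of_tuple w.1) (conf_of_tuple w.2) om)%:E)) => [w om|k].
    by rewrite lee_fin.
  apply/measurable_EFinP; apply: mweighted => //.
  - by apply: (measurableT_comp measurable_fst).
  - by apply: (measurableT_comp measurable_snd).
have b0 xi om : (0 <= (bound xi om)%:E)%E.
  by rewrite lee_fin mulr_ge0// mulr_ge0// exprn_ge0// expR_ge0.
have mbE : measurable_conf2 (fun xi om => (bound xi om)%:E).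
  by move=> n m; apply/measurable_EFinP; exact: mbound.
apply: (@le_trans _ _ (\int[lp]_xi \int[lp]_om (bound xi om)%:E)%E).
  rewrite [leLHS](integral_subset_sum d_gt0 H0 mH).
  apply: ge0_le_integral => //.
  - by move=> xi _; exact: integral_ge0.
  - exact: measurable_conf2_integral.
  - exact: measurable_conf2_integral.
  move=> xi _; have [n [s xiE]] := conf_of_tupleP xi.
  have mswap : measurable_conf2 (fun ze om => (weighted_kernel xi ze om)%:E).
    move=> i j; apply/measurable_EFinP; rewrite -xiE.
    by apply: (mweighted (f := fun=> s)).
  rewrite /H lp_fubini//; last by move=> ze om; rewrite lee_fin.
  apply: ge0_le_integral => //.
  - by move=> om _; apply: integral_ge0 => ze _; rewrite lee_fin.
  - apply: measurable_conf2_integral; first by move=> om ze; rewrite lee_fin.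
    exact: (measurable_conf2_swap mswap).
  - exact: (measurable_conf2_r xi mbE).
rewrite -(integral_subset_sum d_gt0 b0 mbE) le_eqVlt; apply/orP; left; apply/eqP.
apply: eq_integral => eta _; rewrite /weight /subset_sum mulr_sumr -sumEFin.
apply: eq_big_seq => xi; rewrite fpowersetE => xieta; congr EFin.
rewrite /bound fsetU_setD// normrM; set x1 := `|_|; set x2 := `|_|.
by set x3 := C ^+ _; set x4 := _ ^+ _; lra.
Qed.

End kernel_bound.

(** * Real-valued integrals and the algebra of Glauber operators *)

Section lp_Rintegral.
Context {R : realType} {d : nat}.
Hypothesis d_gt0 : (0 < d)%N.
Local Notation fconf := (fconf R d).
Local Notation leb := (@lebesgue_rV R d).
Local Notation lp := (@lebesgue_poisson R d).

Lemma fine_pos_mul (c : R) (x : \bar R) : 0 < c -> fine (c%:E * x) = c * fine x.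
Proof.
move=> c0; case: x => [r||] //=.
- by rewrite gt0_muley ?lte_fin// mulr0.
- by rewrite gt0_muleNy ?lte_fin// mulr0.
Qed.

Lemma pos_muleBr (c : R) (x y : \bar R) : 0 < c ->
  (c%:E * x - c%:E * y = c%:E * (x - y))%E.
Proof.
move=> c0; have h1 : (c%:E * +oo = +oo)%E by rewrite gt0_muley ?lte_fin.
have h2 : (c%:E * -oo = -oo)%E by rewrite gt0_muleNy ?lte_fin.
case: x => [x||]; case: y => [y||]; rewrite ?h1 ?h2 //= -?EFinM ?h1 ?h2 //=.
by rewrite -?EFinB -?EFinM ?mulrBr.
Qed.

(* No integrability is needed: both sides take the same junk value when [f] is
   not integrable. *)
Lemma Rintegral_posZl {dQ} {Q : measurableType dQ} (m : {measure set Q -> \bar R})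
  (c : R) (f : Q -> R) : 0 < c -> measurable_fun setT f ->
  \int[m]_x (c * f x) = c * \int[m]_x f x.
Proof.
move=> c0 mf; rewrite /Rintegral -fine_pos_mul//; congr fine.
have mfE : measurable_fun setT (EFin \o f) by exact/measurable_EFinP.
have cE : ((fun x => (c * f x)%:E) = (fun x => c%:E * (EFin \o f) x))%E.
  by apply/funext => x; rewrite /= EFinM.
rewrite [LHS]integralE [in RHS]integralE cE.
rewrite (_ : ((fun x => c%:E * (EFin \o f) x)^\+ =
    (fun x => c%:E * (EFin \o f)^\+ x))%E); last first.
  by apply/funext => x; rewrite !funeposE maxe_pMr ?mule0// lee_fin ltW.
rewrite (_ : ((fun x => c%:E * (EFin \o f) x)^\- =
    (fun x => c%:E * (EFin \o f)^\- x))%E); last first.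
  by apply/funext => x; rewrite !funenegE maxe_pMr ?mule0 ?muleN// lee_fin ltW.
rewrite !ge0_integralZl//; last 4 first.
- exact: measurable_funeneg.
- by rewrite lee_fin ltW.
- exact: measurable_funepos.
- by rewrite lee_fin ltW.
exact: pos_muleBr.
Qed.

Lemma Rintegral_lp_card0 (F : fconf -> R) : measurable_fun setT F ->
  (forall om, om != fset0 -> F om = 0) -> \int[lp]_om F om = F fset0.
Proof.
move=> mF F0; have mFE : measurable_fun setT (EFin \o F) by exact/measurable_EFinP.
rewrite /Rintegral integralE !ge0_integral_lp_card0//.
- rewrite funeposE funenegE /= -!EFin_max -EFinB /=.
  by case: (leP 0 (F fset0)) => h; [rewrite max_r|rewrite max_l]; lra.
- exact: measurable_funeneg.
- by move=> om /F0 /= F00; rewrite funenegE /= F00 oppr0 maxxx.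
- exact: measurable_funepos.
- by move=> om /F0 /= F00; rewrite funeposE /= F00 maxxx.
Qed.

Lemma Rintegral_lp_card1 (F : fconf -> R) : measurable_fun setT F ->
  (forall om, #|` om|%fset != 1%N -> F om = 0) ->
  \int[lp]_om F om = \int[leb]_x F [fset x]%fset.
Proof.
move=> mF F0; have mFE : measurable_fun setT (EFin \o F) by exact/measurable_EFinP.
rewrite /Rintegral integralE [in RHS]integralE !(ge0_integral_lp_card1 d_gt0)//.
- congr (fine (_ - _)); apply: eq_integral => x _; [by rewrite !funeposE|by rewrite !funenegE].
- exact: measurable_funeneg.
- by move=> om /F0 /= F00; rewrite funenegE /= F00 oppr0 maxxx.
- exact: measurable_funepos.
- by move=> om /F0 /= F00; rewrite funeposE /= F00 maxxx.
Qed.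

End lp_Rintegral.

Section glauber_operator.
Context {R : realType} {d : nat}.
Hypothesis d_gt0 : (0 < d)%N.
Local Notation Rd := 'rV[R]_d.
Local Notation fconf := (fconf R d).
Local Notation lp := (@lebesgue_poisson R d).
Variable phi : Rd -> R.
Hypothesis mphi : measurable_fun setT phi.
Hypothesis phi_ge0 : forall x, 0 <= phi x.
Local Notation kern := (glauber_kernel phi).
Local Notation op := (glauber_op phi).
Local Notation gabs := (glauber_abs phi).

Definition admissible (a : fconf -> fconf -> R) (G : obs R d) :=
  measurable_conf2 a /\ measurable_fun setT G.

Lemma glauber_abs_ge0 a G eta : (0 <= gabs a G eta)%E.
Proof. by apply: sume_ge0 => xi _; apply: integral_ge0 => om _; rewrite lee_fin. Qed.

Lemma glauber_abs_integrable a G eta xi : admissible a G -> (gabs a G eta < +oo)%E ->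
  (xi `<=` eta)%fset -> lp.-integrable setT (EFin \o kern a G xi (eta `\` xi)%fset).
Proof.
move=> [ma mG] fin xieta; apply/integrableP; split.
  by apply/measurable_EFinP; exact: measurable_glauber_kernel_om.
apply: le_lt_trans fin.
rewrite /glauber_abs /subset_sum (big_fsetD1 xi) ?fpowersetE//= leeDl//.
by apply: sume_ge0 => B _; apply: integral_ge0 => om _; rewrite lee_fin.
Qed.

(** Where [glauber_abs] is infinite the bound is trivial, so junk values of [glauber_op] do no
    harm. *)
Lemma normr_glauber_op_le a G eta : admissible a G ->
  (`|op a G eta|%:E <= gabs a G eta)%E.
Proof.
move=> aG; have [ma mG] := aG.
have [/eqP ->|fin] := boolP (gabs a G eta == +oo)%E; first exact: leey.
rewrite /glauber_op /subset_sum; apply: (le_trans (_ : _ <= (\sum_(xi <- fpowerset eta)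
    `|\int[lp]_om kern a G xi (eta `\` xi)%fset om|)%:E)%E).
  by rewrite lee_fin ler_norm_sum.
rewrite -sumEFin /glauber_abs /subset_sum big_seq [leRHS]big_seq.
apply: lee_sum => xi; rewrite fpowersetE => xieta.
have int : lp.-integrable setT (EFin \o kern a G xi (eta `\` xi)%fset).
  by apply: glauber_abs_integrable => //; rewrite ltey.
have fi := integrable_fin_num measurableT int.
rewrite /Rintegral -abse_EFin fineK//.
by apply: le_abse_integral => //; case/integrableP: int.
Qed.

(** The assumption concerns the products of coefficient and argument. The lemma thus covers
    linearity in [G] for a fixed coefficient and linearity in the coefficient for a fixed [G]. *)
Lemma glauber_abs_lin a1 G1 a2 G2 a3 G3 (c : R) eta :
  admissible a1 G1 -> admissible a2 G2 -> admissible a3 G3 ->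
  (forall xi om, (xi `<=` eta)%fset -> a1 xi om * G1 (xi `|` om)%fset =
     c * (a2 xi om * G2 (xi `|` om)%fset) + a3 xi om * G3 (xi `|` om)%fset) ->
  (gabs a2 G2 eta < +oo)%E -> (gabs a3 G3 eta < +oo)%E ->
  (gabs a1 G1 eta < +oo)%E /\ op a1 G1 eta = c * op a2 G2 eta + op a3 G3 eta.
Proof.
move=> aG1 aG2 aG3 H fin2 fin3.
have kE xi ze om : (xi `<=` eta)%fset ->
    kern a1 G1 xi ze om = c * kern a2 G2 xi ze om + kern a3 G3 xi ze om.
  by move=> xieta; rewrite /glauber_kernel H// mulrDl -!mulrA.
have i2 xi := glauber_abs_integrable (xi := xi) aG2 fin2.
have i3 xi := glauber_abs_integrable (xi := xi) aG3 fin3.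
have i1 xi : (xi `<=` eta)%fset ->
    lp.-integrable setT (EFin \o kern a1 G1 xi (eta `\` xi)%fset).
  move=> xieta; rewrite (_ : _ \o _ =
    (fun om => (c%:E * (EFin \o kern a2 G2 xi (eta `\` xi)%fset) om)%E)
     \+ (EFin \o kern a3 G3 xi (eta `\` xi)%fset))%E; last first.
    by apply/funext => om; rewrite /= kE// EFinD EFinM.
  by apply: integrableD => //; [apply: integrableZl => //; exact: i2|exact: i3].
split.
  rewrite /glauber_abs /subset_sum big_seq; apply: lte_sum_pinfty => xi.
  by rewrite fpowersetE => /i1 /integrableP[].
rewrite /glauber_op /subset_sum mulr_sumr -big_split/=.
apply: eq_big_seq => xi; rewrite fpowersetE => xieta.
under eq_Rintegral do rewrite kE//.
rewrite RintegralD//; last 2 first.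
- rewrite (_ : _ \o _ =
    (fun om => c%:E * (EFin \o kern a2 G2 xi (eta `\` xi)%fset) om)%E); last first.
    by apply/funext => om /=; rewrite EFinM.
  by apply: integrableZl => //; exact: i2.
- exact: i3.
by rewrite RintegralZl//; exact: i2.
Qed.

(** For empty [om] the Boltzmann factor is 1, so the factors [boltzmann om y - 1] kill every
    nonempty [ze]. Multiplication operators, in particular the identity and the death term, are
    therefore Glauber operators. *)
Lemma glauber_op_card0 (f : fconf -> R) a G eta : admissible a G ->
  (forall xi om, a xi om = f xi * (#|` om|%fset == 0%N)%:R) ->
  op a G eta = f eta * G eta.
Proof.
move=> [ma mG] aE; rewrite /glauber_op.
have kE xi ze : \int[lp]_om kern a G xi ze om = f xi * G xi * (ze == fset0)%:R.
  rewrite Rintegral_lp_card0.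
  - rewrite /glauber_kernel aE cardfs0 eqxx mulr1 fsetU0; congr (_ * _).
    rewrite /e_lambda big1 ?mul1r; last by move=> y _; rewrite boltzmann0.
    have [->|/fset0Pn[y yze]] := eqVneq ze fset0; first by rewrite big_seq_fset0.
    by rewrite (big_fsetD1 y)//= boltzmann0 subrr mul0r.
  - exact: measurable_glauber_kernel_om.
  - by move=> om; rewrite -cardfs_eq0 /glauber_kernel aE => /negbTE ->; rewrite mulr0 !mul0r.
rewrite (eq_subset_sum (H' := fun xi ze => f xi * G xi * (ze == fset0)%:R)) => [|B _];
  last exact: kE.
rewrite subset_sum_unique ?eqxx ?mulr1// => B D /negbTE ->; exact: mulr0.
Qed.

Lemma glauber_abs_card0 (f : fconf -> R) a G eta : admissible a G ->
  (forall xi om, a xi om = f xi * (#|` om|%fset == 0%N)%:R) -> (gabs a G eta < +oo)%E.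
Proof.
move=> [ma mG] aE; rewrite /glauber_abs /subset_sum.
apply: lte_sum_pinfty => xi _; rewrite ge0_integral_lp_card0.
- by rewrite ltry.
- apply/measurable_EFinP; apply: measurableT_comp => //.
  exact: measurable_glauber_kernel_om.
- by move=> om; rewrite lee_fin.
- move=> om; rewrite -cardfs_eq0 /glauber_kernel aE => /negbTE ->.
  by rewrite mulr0 !mul0r normr0.
Qed.

End glauber_operator.

Section configuration_sums.
Context {R : realType} {d : nat}.
Local Notation fconf := (fconf R d).

Lemma fconf_ind (P : fconf -> Prop) : P fset0 ->
  (forall x eta, x \notin eta -> P eta -> P (x |` eta)%fset) -> forall eta, P eta.
Proof.
move=> P0 PU eta; have [n] := ubnP #|` eta|%fset.
elim: n eta => // n IH eta; have [->//|/fset0Pn[x xeta]] := eqVneq eta fset0.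
rewrite (cardfsD1 x) xeta add1n ltnS => /IH Pe.
by rewrite -(fsetD1K xeta); apply: PU => //; rewrite !inE eqxx.
Qed.

Lemma subset_sum_binomial (x y : R) (eta : fconf) :
  subset_sum (fun xi om => x ^+ #|` xi|%fset * y ^+ #|` om|%fset) eta =
  (x + y) ^+ #|` eta|%fset.
Proof.
elim/fconf_ind: eta => [|u eta ueta IH].
  by rewrite subset_sum0 cardfs0 !expr0 mulr1.
rewrite subset_sum_fset1U// cardfsU1 ueta add1n exprS mulrDl -IH.
rewrite /subset_sum !mulr_sumr; congr (_ + _); apply: eq_big_seq => xi;
    rewrite fpowersetE => xieta.
- have uxi : u \notin xi by apply: contra ueta; exact: (fsubsetP xieta).
  by rewrite cardfsU1 uxi add1n exprS mulrA.
- have uom : u \notin (eta `\` xi)%fset by rewrite !inE negb_and ueta orbT.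
  by rewrite cardfsU1 uom add1n exprS mulrCA.
Qed.

Lemma le_subset_sum (H H' : fconf -> fconf -> R) eta :
  (forall xi, (xi `<=` eta)%fset -> H xi (eta `\` xi)%fset <= H' xi (eta `\` xi)%fset) ->
  subset_sum H eta <= subset_sum H' eta.
Proof.
move=> HH'; rewrite /subset_sum big_seq [leRHS]big_seq; apply: ler_sum => xi.
by rewrite fpowersetE; exact: HH'.
Qed.

Lemma subset_sum_cst (c : R) (eta : fconf) :
  subset_sum (fun _ _ => c) eta = c * 2 ^+ #|` eta|%fset.
Proof.
have := subset_sum_binomial 1 1 eta.
rewrite (_ : 1 + 1 = 2 :> R)// => <-; rewrite /subset_sum mulr_sumr.
by apply: eq_bigr => xi _; rewrite !expr1n !mulr1.
Qed.

Lemma subset_sum_point (f : fconf -> R) (eta : fconf) :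
  subset_sum (fun xi om => f xi * (#|` om|%fset == 0%N)%:R) eta = f eta.
Proof.
rewrite subset_sum_unique => [|B D].
  by rewrite cardfs0 eqxx mulr1.
by rewrite -cardfs_eq0 => /negbTE ->; rewrite mulr0.
Qed.

Lemma natr_le_expr2 (n : nat) : n%:R <= 2 ^+ n :> R.
Proof. by rewrite -natrX ler_nat ltnW// ltn_expl. Qed.

Lemma measurable_confs_in (L : set 'rV[R]_d) : measurable L -> measurable (@confs_in R d L).
Proof.
move=> mL; suff : fconf_measurable (@confs_in R d L) by [].
move=> n; rewrite (_ : _ @^-1` _ =
    \bigcap_(i in [set: 'I_n]) ((fun t : n.-tuple 'rV[R]_d => tnth t i) @^-1` L)).
  apply: fin_bigcap_measurable; first exact: finite_finset.
  by move=> i _; rewrite -[X in measurable X]setTI; exact: measurable_tnth.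
apply/seteqP; split => t /=.
- by move=> tL i _ /=; apply: tL => /=; rewrite !inE mem_tnth.
- by move=> tL x /=; rewrite !inE => /tnthP[i ->]; exact: tL.
Qed.

Lemma confs_in_subset (L : set 'rV[R]_d) (eta xi : fconf) : confs_in L eta ->
  (xi `<=` eta)%fset -> confs_in L xi.
Proof. by move=> etaL /fsubsetP xieta x /= /xieta; exact: etaL. Qed.

Lemma confs_in_split (L : set 'rV[R]_d) (eta xi : fconf) : (xi `<=` eta)%fset ->
  confs_in L xi -> confs_in L (eta `\` xi)%fset -> confs_in L eta.
Proof.
move=> xieta xiL omL x /= xeta; have [xxi|xxi] := boolP (x \in xi); first exact: xiL.
by apply: omL; rewrite /= !inE xxi.
Qed.

End configuration_sums.

(** * The discrete operators and the birth term as Glauber operators *)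

Section glauber_dynamics.
Context {R : realType} {d : nat}.
Hypothesis d_gt0 : (0 < d)%N.
Local Notation Rd := 'rV[R]_d.
Local Notation tup n := (n.-tuple Rd).
Local Notation fconf := (fconf R d).
Local Notation lp := (@lebesgue_poisson R d).
Variable phi : Rd -> R.
Hypothesis mphi : measurable_fun setT phi.
Hypothesis phi_ge0 : forall x, 0 <= phi x.
Hypothesis phi_even : forall x, phi (- x) = phi x.
Local Notation kern := (glauber_kernel phi).
Local Notation op := (glauber_op phi).
Variable z : R.
Hypothesis z_gt0 : 0 < z.

Definition in_conf (L : set Rd) (eta : fconf) : R := \1_(confs_in L) eta.

Lemma in_confE L eta : confs_in L eta -> in_conf L eta = 1.
Proof. by move=> h; rewrite /in_conf indicE mem_set. Qed.

Lemma in_confN L eta : ~ confs_in L eta -> in_conf L eta = 0.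
Proof. by move=> h; rewrite /in_conf indicE memNset. Qed.

Lemma in_conf_itv L eta : 0 <= in_conf L eta <= 1.
Proof.
have [h|h] := pselect (confs_in L eta); rewrite ?(in_confE h) ?(in_confN h).
- by rewrite ler01 lexx.
- by rewrite ler01 lexx.
Qed.

(** The factor [in_conf L xi] is 1 whenever [eta] lies in [L]. It makes [weight] vanish off
    [confs_in L], so that the contraction bound has the norm on [confs_in L] on both sides. *)
Definition Phat_coef (L : set Rd) (de : R) (xi om : fconf) : R :=
  in_conf L xi * in_conf L om * ((1 - de) ^+ #|` xi|%fset * (z * de) ^+ #|` om|%fset).

Definition birth_coef (xi om : fconf) : R := z * (#|` om|%fset == 1%N)%:R.

Lemma measurable_in_conf L n : measurable L ->
  measurable_fun setT (fun t : tup n => in_conf L (conf_of_tuple t)).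
Proof.
move=> mL; apply: (measurableT_comp (f := in_conf L)).
  by apply: measurable_indic; exact: measurable_confs_in.
exact: measurable_conf_of_tuple.
Qed.

Lemma measurable_Phat_coef L de : measurable L -> measurable_conf2 (Phat_coef L de).
Proof.
move=> mL n m; apply: measurable_funM; first apply: measurable_funM.
- exact: (measurableT_comp (measurable_in_conf (n := n) mL) measurable_fst).
- exact: (measurableT_comp (measurable_in_conf (n := m) mL) measurable_snd).
- exact: (measurable_conf2_card (fun i j => (1 - de) ^+ i * (z * de) ^+ j)).
Qed.

Lemma measurable_birth_coef : measurable_conf2 birth_coef.
Proof. exact: (measurable_conf2_card (fun i j => z * (j == 1%N)%:R)). Qed.

Lemma Phat_onE L de G : measurable L -> 0 <= de < 1 -> measurable_fun setT G ->
  Phat_on phi z L de G = cutoff L (op (Phat_coef L de) G).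
Proof.
move=> mL /andP[de0 de1] mG; apply/funext => eta; rewrite /Phat_on /cutoff.
have [etaL|etaL] := pselect (confs_in L eta); last first.
  by rewrite -/(in_conf L eta) in_confN// !mul0r.
congr (_ * _); rewrite /Phat /glauber_op /subset_sum.
apply: eq_big_seq => xi; rewrite fpowersetE => xieta.
have xiL := confs_in_subset etaL xieta.
have mD := measurable_confs_in mL.
pose a (xi om : fconf) := in_conf L om * (z * de) ^+ #|` om|%fset.
have ma : measurable_conf2 a.
  move=> n m; apply: measurable_funM.
    exact: (measurableT_comp (measurable_in_conf (n := m) mL) measurable_snd).
  exact: (measurable_conf2_card (fun i j => (z * de) ^+ j)).
rewrite Rintegral_mkcond; set F := (_ \_ _).
have FE : F = kern a G xi (eta `\` xi)%fset.
  apply/funext => om; rewrite /F /patch /glauber_kernel /a.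
  have [omL|omL] := pselect (confs_in L om).
    by rewrite mem_set// in_confE//= mul1r !mulrA.
  by rewrite memNset// in_confN// !mul0r.
(* Strict positivity of [1 - de] makes the scaling valid even if the integral diverges. *)
rewrite FE -Rintegral_posZl; last 2 first.
- by rewrite exprn_gt0// subr_gt0.
- exact: measurable_glauber_kernel_om.
apply: eq_Rintegral => om _; rewrite /glauber_kernel /a /Phat_coef (in_confE xiL) mul1r.
by rewrite !mulrA [in_conf L om * _]mulrC.
Qed.

Lemma LhatE G : measurable_fun setT G ->
  Lhat phi z G = (fun eta => - (#|` eta|%fset%:R * G eta) + op birth_coef G eta).
Proof.
move=> mG; apply/funext => eta; rewrite /Lhat; congr (_ + _).
rewrite /glauber_op /subset_sum mulr_sumr.
apply: eq_big_seq => xi; rewrite fpowersetE => xieta.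
pose a (xi om : fconf) := (#|` om|%fset == 1%N)%:R : R.
have ma : measurable_conf2 a.
  exact: (measurable_conf2_card (fun i j => (j == 1%N)%:R)).
have mk := measurable_glauber_kernel_om mphi ma mG xi (eta `\` xi)%fset.
transitivity (\int[lp]_om (z * kern a G xi (eta `\` xi)%fset om)); last first.
  by apply: eq_Rintegral => om _; rewrite /glauber_kernel /birth_coef /a !mulrA.
rewrite Rintegral_posZl//; congr (_ * _).
rewrite (Rintegral_lp_card1 d_gt0)//; last first.
  by move=> om /negbTE om1; rewrite /glauber_kernel /a om1 !mul0r.
apply: eq_Rintegral => x _.
(* Evenness of [phi] reconciles [phi (y - x)] in [glauber_kernel] with [phi (x - y)] in [Lhat]. *)
have bx y : boltzmann phi [fset x]%fset y = expR (- phi (x - y)).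
  by rewrite boltzmannE big_seq_fset1 -phi_even opprB.
rewrite /glauber_kernel /a cardfs1 eqxx mul1r fsetUC -mulrA [LHS]mulrCA; congr (_ * _).
congr (_ * _); rewrite /e_lambda.
- by rewrite /energy -sumrN expR_sum; apply: eq_bigr => y _; rewrite bx.
- by apply: eq_bigr => y _; rewrite bx.
Qed.

End glauber_dynamics.

Section glauber_estimates.
Context {R : realType} {d : nat}.
Hypothesis d_gt0 : (0 < d)%N.
Local Notation Rd := 'rV[R]_d.
Local Notation fconf := (fconf R d).
Local Notation lp := (@lebesgue_poisson R d).
Variable phi : Rd -> R.
Hypothesis mphi : measurable_fun setT phi.
Hypothesis phi_ge0 : forall x, 0 <= phi x.
Hypothesis phi_even : forall x, phi (- x) = phi x.
Variable cphi : R.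
Hypothesis C_phiE : C_phi phi = cphi%:E.
Local Notation gabs := (glauber_abs phi).
Variables z C : R.
Hypothesis z_gt0 : 0 < z.
Hypothesis C_gt0 : 0 < C.
Hypothesis zC : z * expR (C * cphi) <= C.
Local Notation kappa := (expR (C * cphi)).

Lemma weight_Phat_le L de (eta : fconf) : 0 <= de <= 1 ->
  weight cphi (Phat_coef z L de) C eta <= in_conf L eta * C ^+ #|` eta|%fset.
Proof.
move=> /andP[de0 de1]; have d1 : 0 <= 1 - de by rewrite subr_ge0.
have [etaL|etaL] := pselect (confs_in L eta); last first.
  rewrite (in_confN etaL) mul0r /weight /subset_sum big1_seq// => xi.
  rewrite fpowersetE => /andP[_ xieta]; rewrite /Phat_coef.
  have [xiL|xiL] := pselect (confs_in L xi); last first.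
    by rewrite (in_confN xiL) !mul0r normr0 !mul0r.
  have [omL|omL] := pselect (confs_in L (eta `\` xi)%fset).
    by case: etaL; exact: confs_in_split omL.
  by rewrite (in_confN omL) mulr0 !mul0r normr0 !mul0r.
rewrite in_confE// mul1r.
(* By the binomial theorem for subsets it suffices to compare summands; a point of [xi] contributes
   [C * (1 - de)] to both, and a point of [om] contributes [z * de * kappa <= C * de]. *)
have {2}-> : C = C * (1 - de) + C * de by rewrite -mulrDr subrK mulr1.
rewrite -subset_sum_binomial; apply: le_subset_sum => xi xieta.
rewrite /Phat_coef (in_confE (confs_in_subset etaL xieta)).
rewrite (in_confE (confs_in_subset etaL (fsubsetDl _ _))) !mul1r.
rewrite ger0_norm; last first.
  by rewrite mulr_ge0// exprn_ge0// mulr_ge0// ltW.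
rewrite -mulrA mulrACA -!exprMn [(1 - de) * C]mulrC.
have C0 := ltW C_gt0; have z0 := ltW z_gt0.
apply: ler_wpM2l; first by rewrite exprn_ge0// mulr_ge0.
apply: lerXn2r; rewrite ?nnegrE ?mulr_ge0 ?expR_ge0//.
by rewrite mulrAC ler_wpM2r.
Qed.

(** Only splittings with a one-point [om] contribute, each at most [C] to the power |eta| because
    [z * kappa <= C]. Counting all subsets instead gives the weight of [L1 (2 * C)]. *)
Lemma weight_birth_le (eta : fconf) :
  weight cphi (birth_coef z) C eta <= C ^+ #|` eta|%fset * 2 ^+ #|` eta|%fset.
Proof.
rewrite -subset_sum_cst; apply: le_subset_sum => xi xieta.
rewrite /birth_coef; have [m1|m1] := eqVneq #|` eta `\` xi|%fset 1%N; last first.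
  by rewrite mulr0 normr0 !mul0r exprn_ge0// ltW.
rewrite (cardfs_subset xieta) m1 expr1 addn1 exprS mulr1 (gtr0_norm z_gt0).
by rewrite mulrAC ler_wpM2r// exprn_ge0// ltW.
Qed.

Lemma measurable_weighted_norm (c : R) (F : obs R d) : measurable_fun setT F ->
  measurable_fun setT (fun eta => (`|F eta| * c ^+ #|` eta|%fset)%:E).
Proof.
move=> mF; apply/measurable_EFinP; apply: measurable_funM.
  exact: measurableT_comp.
apply: measurable_fun_fconf => n.
by apply: measurable_fun_nat; exact: measurable_card_tuple.
Qed.

Lemma measurable_expr_card (c : R) :
  measurable_fun setT (fun eta : fconf => (c ^+ #|` eta|%fset)%:E).
Proof.
apply/measurable_EFinP; apply: measurable_fun_fconf => n.
by apply: measurable_fun_nat; exact: measurable_card_tuple.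
Qed.

Lemma measurable_weight a : measurable_conf2 a ->
  measurable_fun setT (fun eta : fconf => weight cphi a C eta).
Proof.
move=> ma; apply/measurable_EFinP.
rewrite (_ : _ \o _ = fun eta => subset_sum (fun xi om =>
    (`|a xi om| * C ^+ #|` xi|%fset * kappa ^+ #|` om|%fset)%:E) eta); last first.
  by apply/funext => eta; rewrite /weight /subset_sum /= -sumEFin.
apply: measurable_fun_subset_sum => n m; apply/measurable_EFinP.
under eq_fun do rewrite -mulrA.
apply: measurable_funM; first by apply: measurableT_comp => //; exact: ma.
exact: (measurable_conf2_card (fun i j => C ^+ i * kappa ^+ j)).
Qed.

Lemma weight_ge0 a (eta : fconf) : 0 <= weight cphi a C eta.
Proof.
by apply: sumr_ge0 => xi _; rewrite !mulr_ge0// exprn_ge0// ?expR_ge0// ltW.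
Qed.

(** Since [C > 0], a finite weighted integral forces finiteness almost everywhere. Off this null set
    the integrals in [glauber_op a G] converge, and its algebra is valid. *)
Lemma ae_glauber_abs_fin a (G : obs R d) : admissible a G ->
  (\int[lp]_eta (`|G eta| * weight cphi a C eta)%:E < +oo)%E ->
  {ae lp, forall eta, (gabs a G eta < +oo)%E}.
Proof.
move=> [ma mG] fin.
have mg : measurable_fun setT (fun eta => gabs a G eta * (C ^+ #|` eta|%fset)%:E)%E.
  apply: emeasurable_funM; last exact: measurable_expr_card.
  exact: measurable_glauber_abs.
have g0 eta : (0 <= gabs a G eta * (C ^+ #|` eta|%fset)%:E)%E.
  by rewrite mule_ge0 ?glauber_abs_ge0// lee_fin exprn_ge0// ltW.
have /integrable_ae : lp.-integrable setT
    (fun eta => gabs a G eta * (C ^+ #|` eta|%fset)%:E)%E.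
  apply/integrableP; split => //.
  under eq_integral do rewrite gee0_abs//.
  exact: le_lt_trans (kernel_bound d_gt0 mphi phi_ge0 C_phiE ma mG (ltW C_gt0)) fin.
move=> /(_ measurableT); apply: filterS => eta /(_ I).
apply: contraTT; rewrite -leNgt leye_eq => /eqP ->.
by rewrite gt0_mulye// lte_fin exprn_gt0.
Qed.

Lemma L1norm_on_le (D : set fconf) a (G F : obs R d) :
  measurable D -> admissible a G -> measurable_fun setT F ->
  {ae lp, forall eta, D eta -> (`|F eta|%:E <= gabs a G eta)%E} ->
  (L1norm_on D C F <= \int[lp]_eta (`|G eta| * weight cphi a C eta)%:E)%E.
Proof.
move=> mD [ma mG] mF Fle.
have mg : measurable_fun setT (fun eta => gabs a G eta * (C ^+ #|` eta|%fset)%:E)%E.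
  apply: emeasurable_funM; last exact: measurable_expr_card.
  exact: measurable_glauber_abs.
have g0 eta : (0 <= gabs a G eta * (C ^+ #|` eta|%fset)%:E)%E.
  by rewrite mule_ge0 ?glauber_abs_ge0// lee_fin exprn_ge0// ltW.
apply: le_trans (kernel_bound d_gt0 mphi phi_ge0 C_phiE ma mG (ltW C_gt0)).
apply: (@le_trans _ _ (\int[lp]_(eta in D) (gabs a G eta * (C ^+ #|` eta|%fset)%:E))%E).
  apply: ae_ge0_le_integral => //.
  - by move=> eta _; rewrite lee_fin mulr_ge0// exprn_ge0// ltW.
  - by apply: measurable_funTS; exact: measurable_weighted_norm.
  - exact: measurable_funTS.
  - apply: filterS Fle => eta Fle Deta; rewrite EFinM lee_wpmul2r// ?Fle//.
    by rewrite lee_fin exprn_ge0// ltW.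
by apply: ge0_subset_integral.
Qed.

Lemma L1norm_on_indic L (G : obs R d) : measurable L -> measurable_fun setT G ->
  (\int[lp]_eta (`|G eta| * (in_conf L eta * C ^+ #|` eta|%fset))%:E =
   L1norm_on (confs_in L) C G)%E.
Proof.
move=> mL mG; rewrite /L1norm_on [RHS]integral_mkcond; apply: eq_integral => eta _.
rewrite /patch; have [h|h] := pselect (confs_in L eta).
- by rewrite mem_set// in_confE// mul1r.
- by rewrite memNset// in_confN// mul0r mulr0.
Qed.

Section thinning.
Variables (L : set Rd) (de : R).
Hypothesis mL : measurable L.
Hypothesis de01 : 0 <= de < 1.

Let de01' : 0 <= de <= 1.
Proof. by case/andP: de01 => -> /ltW ->. Qed.

Lemma measurable_Phat_on (G : obs R d) : measurable_fun setT G ->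
  measurable_fun setT (Phat_on phi z L de G).
Proof.
move=> mG; rewrite Phat_onE//; apply: measurable_funM.
  by apply: measurable_indic; exact: measurable_confs_in.
by apply: measurable_glauber_op => //; exact: measurable_Phat_coef.
Qed.

Lemma integral_weight_Phat_le (G : obs R d) : measurable_fun setT G ->
  (\int[lp]_eta (`|G eta| * weight cphi (Phat_coef z L de) C eta)%:E <=
   L1norm_on (confs_in L) C G)%E.
Proof.
move=> mG; rewrite -L1norm_on_indic//; apply: ge0_le_integral => //.
- by move=> eta _; rewrite lee_fin mulr_ge0// weight_ge0.
- apply/measurable_EFinP; apply: measurable_funM; first exact: measurableT_comp.
  by apply: measurable_weight; exact: measurable_Phat_coef.
- apply/measurable_EFinP; apply: measurable_funM; first exact: measurableT_comp.
  apply: measurable_funM; first by apply: measurable_indic; exact: measurable_confs_in.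
  by apply/measurable_EFinP; exact: measurable_expr_card.
- by move=> eta _; rewrite lee_fin ler_wpM2l// weight_Phat_le.
Qed.

Lemma Phat_on_contraction (G : obs R d) : measurable_fun setT G ->
  (L1norm_on (confs_in L) C (Phat_on phi z L de G) <= L1norm_on (confs_in L) C G)%E.
Proof.
move=> mG; apply: le_trans (integral_weight_Phat_le mG).
have aG : admissible (Phat_coef z L de) G by split => //; exact: measurable_Phat_coef.
apply: (L1norm_on_le (measurable_confs_in mL) aG (measurable_Phat_on mG)).
apply: aeW => eta etaL; rewrite Phat_onE// /cutoff -/(in_conf L eta) in_confE// mul1r.
exact: normr_glauber_op_le.
Qed.

Lemma Phat_on_linear (c : R) (u v : obs R d) :
  measurable_fun setT u -> measurable_fun setT v ->
  (L1norm_on (confs_in L) C u < +oo)%E -> (L1norm_on (confs_in L) C v < +oo)%E ->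
  {ae lp, forall eta, Phat_on phi z L de (c *: u + v) eta =
    (c *: Phat_on phi z L de u + Phat_on phi z L de v) eta}.
Proof.
move=> mu mv ufin vfin.
have muv : measurable_fun setT (c *: u + v : obs R d).
  by apply: measurable_funD => //; exact: measurable_funM.
have ma := measurable_Phat_coef z de mL.
have := ae_glauber_abs_fin (conj ma mu) (le_lt_trans (integral_weight_Phat_le mu) ufin).
have := ae_glauber_abs_fin (conj ma mv) (le_lt_trans (integral_weight_Phat_le mv) vfin).
apply: filterS2 => eta fv fu.
rewrite !Phat_onE// /cutoff /=.
have lin xi om : (xi `<=` eta)%fset ->
    Phat_coef z L de xi om * (c *: u + v : obs R d) (xi `|` om)%fset =
    c * (Phat_coef z L de xi om * u (xi `|` om)%fset) +
    Phat_coef z L de xi om * v (xi `|` om)%fset.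
  by move=> _; rewrite -mulrCA -mulrDr.
have [_ ->] := glauber_abs_lin mphi (conj ma muv) (conj ma mu) (conj ma mv) lin fu fv.
by rewrite mulrDr mulrCA.
Qed.

End thinning.

End glauber_estimates.

(** * Weighted norms and elementary inequalities *)

Section weighted_norms.
Context {R : realType} {d : nat}.
Local Notation fconf := (fconf R d).
Local Notation lp := (@lebesgue_poisson R d).
Variables (D : set fconf) (c : R).
Hypothesis mD : measurable D.
Hypothesis c_ge0 : 0 <= c.
Implicit Types F : obs R d.

Lemma L1norm_on_ge0 F : (0 <= L1norm_on D c F)%E.
Proof. by apply: integral_ge0 => eta _; rewrite lee_fin mulr_ge0// exprn_ge0. Qed.

Lemma L1norm_on_triangle F1 F2 : measurable_fun setT F1 -> measurable_fun setT F2 ->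
  (L1norm_on D c (F1 + F2)%R <= L1norm_on D c F1 + L1norm_on D c F2)%E.
Proof.
move=> m1 m2; rewrite /L1norm_on -ge0_integralD//.
- apply: ge0_le_integral => //.
  + by move=> eta _; rewrite lee_fin mulr_ge0// exprn_ge0.
  + by apply: measurable_funTS; apply: measurable_weighted_norm; exact: measurable_funD.
  + by apply: emeasurable_funD; apply: measurable_funTS; exact: measurable_weighted_norm.
  + move=> eta _; rewrite lee_fin -mulrDl ler_wpM2r ?exprn_ge0//.
    exact: ler_normD.
- by move=> eta _; rewrite lee_fin mulr_ge0// exprn_ge0.
- by apply: measurable_funTS; exact: measurable_weighted_norm.
- by move=> eta _; rewrite lee_fin mulr_ge0// exprn_ge0.
- by apply: measurable_funTS; exact: measurable_weighted_norm.
Qed.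

Lemma L1norm_onZ (a : R) F : measurable_fun setT F ->
  (L1norm_on D c (a *: F)%R = `|a|%:E * L1norm_on D c F)%E.
Proof.
move=> mF; rewrite /L1norm_on -ge0_integralZl//.
- by apply: eq_integral => eta _; rewrite -EFinM mulrA -normrM.
- by apply: measurable_funTS; exact: measurable_weighted_norm.
- by move=> eta _; rewrite lee_fin mulr_ge0// exprn_ge0.
Qed.

Lemma L1norm_on_le_L1norm F : measurable_fun setT F -> (L1norm_on D c F <= L1norm c F)%E.
Proof.
move=> mF; apply: ge0_subset_integral => //; first exact: measurable_weighted_norm.
by move=> eta _; rewrite lee_fin mulr_ge0// exprn_ge0.
Qed.

Lemma ae_eq_L1norm_on F1 F2 : measurable_fun setT F1 -> measurable_fun setT F2 ->
  {ae lp, forall eta, D eta -> F1 eta = F2 eta} -> L1norm_on D c F1 = L1norm_on D c F2.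
Proof.
move=> m1 m2 F12; apply: ae_eq_integral => //.
- by apply: measurable_funTS; exact: measurable_weighted_norm.
- by apply: measurable_funTS; exact: measurable_weighted_norm.
- by apply: filterS F12 => eta F12 Deta; rewrite F12.
Qed.

End weighted_norms.

(** Bernoulli's inequality with a second-order remainder, used for [de = 1 / n] and [j] the number
    of surviving points. *)
Lemma bernoulli_remainder (R : realFieldType) (de : R) j : 0 <= de <= 1 ->
  0 <= (1 - de) ^+ j - 1 + j%:R * de <= (j%:R * de) ^+ 2.
Proof.
move=> /andP[de0 de1]; elim: j => [|j /andP[IH1 IH2]].
  by rewrite expr0 subrr !mul0r addr0 expr0n lexx.
have -> : (1 - de) ^+ j.+1 - 1 + j.+1%:R * de =
    (1 - de) * ((1 - de) ^+ j - 1 + j%:R * de) + j%:R * de ^+ 2.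
  by rewrite exprS -addn1 natrD; lra.
have j0 : 0 <= j%:R * de ^+ 2 by rewrite mulr_ge0// exprn_ge0.
apply/andP; split; first by rewrite addr_ge0// mulr_ge0// subr_ge0.
apply: (@le_trans _ _ ((j%:R * de) ^+ 2 + j%:R * de ^+ 2)).
  by rewrite lerD2r; apply: le_trans IH2; rewrite ler_piMl// lerBlDr lerDl.
rewrite -[j.+1]addn1 natrD mulrDl mul1r sqrrD -addrA lerD2l.
have e0 : 0 <= de ^+ 2 by rewrite exprn_ge0.
have -> : j%:R * de * de *+ 2 = 2 * (j%:R * de ^+ 2) by rewrite mulr2n expr2; lra.
lra.
Qed.

(** * Consistency of the discrete generators *)

Section one_step_coefficient.
Variables (R : realFieldType) (n de i C z kappa : R).
Hypothesis n0 : 0 < n.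
Hypothesis de01 : 0 <= de <= 1.
Hypothesis nde : n * de = 1.
Hypothesis i01 : 0 <= i <= 1.
Variables (m : nat).
Hypothesis im : m = 0%N -> i = 1.
Hypothesis C0 : 0 <= C.
Hypothesis z0 : 0 <= z.
Hypothesis kappa0 : 0 <= kappa.
Hypothesis zC : z * kappa <= C.

(** The coefficient of [n (Phat - 1) - Lhat], with [j] and [m] the numbers of points of [xi] and
    [om], and [i] the indicator that [om] lies in the box. The case [m = 0] compares with the death
    term, [m = 1] with the birth term, and [m >= 2] is pure error. *)
Let coef j := n * (i * ((1 - de) ^+ j * (z * de) ^+ m) - (m == 0%N)%:R) +
  (j%:R * (m == 0%N)%:R - z * (m == 1%N)%:R).

(** The first bound is for domination, the second for convergence; the next lemma has the same
    pattern. *)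
Let coef0 j : m = 0%N -> 0 <= coef j <= j%:R /\ coef j <= j%:R ^+ 2 * de.
Proof.
move=> m0.
have /andP[b0 b1] := bernoulli_remainder j de01; have /andP[d0 d1] := de01.
have q1 : (1 - de) ^+ j <= 1.
  by rewrite exprn_ile1// ?subr_ge0// lerBlDr lerDl.
have XE : coef j = n * ((1 - de) ^+ j - 1 + j%:R * de).
  rewrite /coef m0 (im m0) expr0 eqxx mulr0 !mulr1 mul1r subr0.
  by rewrite [RHS]mulrDr [n * (j%:R * de)]mulrCA nde mulr1.
rewrite XE; split; first (apply/andP; split).
- by rewrite mulr_ge0// ltW.
- have : n * ((1 - de) ^+ j - 1 + j%:R * de) <= n * (j%:R * de).
    by rewrite ler_wpM2l ?(ltW n0)// gerDr subr_le0.
  by rewrite [n * (j%:R * de)]mulrCA nde mulr1.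
- have : n * ((1 - de) ^+ j - 1 + j%:R * de) <= n * (j%:R * de) ^+ 2.
    by rewrite ler_wpM2l ?(ltW n0).
  suff -> : n * (j%:R * de) ^+ 2 = j%:R ^+ 2 * de by [].
  by rewrite exprMn mulrCA expr2 [n * (de * de)]mulrA nde mul1r.
Qed.

(** For [i = 0] the coefficient is [- z], which is not small: births outside the box are missing
    from T_n. Hence the condition on the second bound. *)
Let coef1 j : m = 1%N -> `|coef j| <= z /\ (i = 1 -> `|coef j| <= z * (j%:R * de)).
Proof.
move=> m1; have /andP[d0 d1] := de01; have /andP[i0 i1] := i01.
have /andP[b0 b1] := bernoulli_remainder j de01.
have q0 : 0 <= (1 - de) ^+ j by rewrite exprn_ge0// subr_ge0.
have q1 : (1 - de) ^+ j <= 1.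
  by rewrite exprn_ile1// ?subr_ge0// lerBlDr lerDl.
have XE : coef j = - (z * (1 - i * (1 - de) ^+ j)).
  rewrite /coef m1 expr1 eqxx /= mulr1 mulr0 sub0r subr0.
  rewrite (_ : n * _ = (n * de) * (z * (i * (1 - de) ^+ j))); last first.
    by set q := (1 - de) ^+ j; lra.
  by rewrite nde mul1r mulrBr mulr1 opprB.
have iq0 : 0 <= i * (1 - de) ^+ j by rewrite mulr_ge0.
have iq1 : i * (1 - de) ^+ j <= 1 by rewrite mulr_ile1.
rewrite XE normrN ger0_norm ?mulr_ge0 ?subr_ge0//; split.
- by rewrite ler_piMr// lerBlDr lerDl.
- move=> i_1; rewrite i_1 mul1r ler_wpM2l//.
  by move: b0; set q := (1 - de) ^+ j; lra.
Qed.

Let coef2 j : (1 < m)%N -> `|coef j| <= z ^+ m * de.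
Proof.
move=> m2; have /andP[d0 d1] := de01; have /andP[i0 i1] := i01.
have q0 : 0 <= (1 - de) ^+ j by rewrite exprn_ge0// subr_ge0.
have q1 : (1 - de) ^+ j <= 1.
  by rewrite exprn_ile1// ?subr_ge0// lerBlDr lerDl.
have XE : coef j = n * (i * ((1 - de) ^+ j * (z * de) ^+ m)).
  by rewrite /coef !gtn_eqF// 1?ltnW// !mulr0 !subr0 addr0.
have zm : 0 <= z ^+ m by rewrite exprn_ge0.
have dm : de ^+ m <= de ^+ 2 by rewrite ler_wiXn2l.
rewrite XE ger0_norm; last by rewrite !mulr_ge0// ?exprn_ge0 ?mulr_ge0// ltW.
rewrite exprMn; apply: (@le_trans _ _ (n * (z ^+ m * de ^+ 2))).
  rewrite ler_wpM2l ?(ltW n0)//.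
  apply: (@le_trans _ _ (z ^+ m * de ^+ m)); last by rewrite ler_wpM2l.
  by rewrite mulrA ler_piMl// ?mulr_ge0 ?exprn_ge0// mulr_ile1.
by rewrite mulrCA expr2 [n * (de * de)]mulrA nde mul1r.
Qed.

(** One pair of bounds for all three cases. The factor [1 + (j + m)^2] dominates [j^2] for [m = 0],
    [j] for [m = 1], and 1 for [m >= 2]. *)
Lemma diff_coef_real j :
  `|coef j| * (C ^+ j * kappa ^+ m) <= C ^+ (j + m) * (1 + j%:R * (m == 0%N)%:R) /\
  (i = 1 -> `|coef j| * (C ^+ j * kappa ^+ m) <=
    C ^+ (j + m) * ((1 + (j + m)%:R ^+ 2) * de)).
Proof.
have /andP[d0 d1] := de01.
have Cj : 0 <= C ^+ j by rewrite exprn_ge0.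
have Cjm : 0 <= C ^+ (j + m) by rewrite exprn_ge0.
have mul_le (b : R) : `|coef j| * kappa ^+ m <= C ^+ m * b ->
    `|coef j| * (C ^+ j * kappa ^+ m) <= C ^+ (j + m) * b.
  by move=> hb; rewrite mulrCA exprD -mulrA ler_wpM2l.
have sq_le (a b : nat) : (a <= b)%N -> a%:R ^+ 2 <= 1 + b%:R ^+ 2 :> R.
  by move=> ab; rewrite ler_wpDl// -!natrX ler_nat leq_exp2r.
have [m0|m_gt0] := posnP m.
  have [/andP[c0 cj] cj2] := coef0 j m0.
  rewrite (ger0_norm c0) m0 ?eqxx expr0 !mulr1 addn0 mulrC.
  split=> [|_]; apply: ler_wpM2l => //.
    by rewrite (le_trans cj)// lerDr.
  by apply: (le_trans cj2); apply: ler_wpM2r => //; exact: sq_le.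
have [m1|m_neq1] := eqVneq m 1%N.
  have [c1 c2] := coef1 j m1; rewrite ?gtn_eqF// mulr0 addr0.
  split=> [|i_1]; apply: mul_le.
    rewrite mulr1 m1 !expr1; apply: le_trans zC; exact: ler_wpM2r.
  rewrite m1 !expr1; apply: (@le_trans _ _ (z * (j%:R * de) * kappa)).
    by apply: ler_wpM2r => //; exact: c2.
  rewrite mulrAC; apply: ler_pM => //; rewrite ?mulr_ge0//.
  apply: ler_wpM2r => //; apply: (@le_trans _ _ (j%:R ^+ 2 + 1)).
    have : 0 <= (j%:R - 1) ^+ 2 :> R by exact: sqr_ge0.
    have : 0 <= j%:R ^+ 2 :> R by exact: sqr_ge0.
    rewrite sqrrB1 mulr2n; set y := j%:R; set y2 := y ^+ 2; lra.
  by rewrite addrC lerD2l -!natrX ler_nat leq_exp2r// leq_addr.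
have m2 : (1 < m)%N by rewrite ltn_neqAle eq_sym m_neq1.
have main : `|coef j| * kappa ^+ m <= C ^+ m * de.
  apply: (@le_trans _ _ ((z * kappa) ^+ m * de)).
    rewrite exprMn mulrAC; apply: ler_wpM2r; first by rewrite exprn_ge0.
    exact: coef2.
  apply: ler_wpM2r => //; apply: lerXn2r => //; rewrite nnegrE//.
  exact: mulr_ge0.
rewrite ?gtn_eqF// mulr0 addr0; split=> [|_]; apply: mul_le; apply: (le_trans main);
  apply: ler_wpM2l; rewrite ?exprn_ge0// ler_peMl// lerDl sqr_ge0//.
Qed.

End one_step_coefficient.

Section glauber_consistency.
Context {R : realType} {d : nat}.
Hypothesis d_gt0 : (0 < d)%N.
Local Notation Rd := 'rV[R]_d.
Local Notation fconf := (fconf R d).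
Local Notation lp := (@lebesgue_poisson R d).
Variable phi : Rd -> R.
Hypothesis mphi : measurable_fun setT phi.
Hypothesis phi_ge0 : forall x, 0 <= phi x.
Hypothesis phi_even : forall x, phi (- x) = phi x.
Variable cphi : R.
Hypothesis C_phiE : C_phi phi = cphi%:E.
Local Notation op := (glauber_op phi).
Variables z C : R.
Hypothesis z_gt0 : 0 < z.
Hypothesis C_gt0 : 0 < C.
Hypothesis zC : z * expR (C * cphi) <= C.
Local Notation kappa := (expR (C * cphi)).

Let C0 : 0 <= C. Proof. exact: ltW. Qed.
Let z0 : 0 <= z. Proof. exact: ltW. Qed.

Lemma integral_weight_le a (G : obs R d) (b c : R) :
  measurable_conf2 a -> measurable_fun setT G ->
  0 <= b -> 0 <= c -> (forall eta, weight cphi a C eta <= b * c ^+ #|` eta|%fset) ->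
  (\int[lp]_eta (`|G eta| * weight cphi a C eta)%:E <= b%:E * L1norm c G)%E.
Proof.
move=> ma mG b0 c0 wle; rewrite /L1norm /L1norm_on -ge0_integralZl//.
- apply: ge0_le_integral => //.
  + by move=> eta _; rewrite lee_fin mulr_ge0// weight_ge0.
  + apply/measurable_EFinP; apply: measurable_funM; first exact: measurableT_comp.
    exact: measurable_weight.
  + by apply: measurable_funeM; exact: measurable_weighted_norm.
  + by move=> eta _; rewrite -EFinM lee_fin mulrCA ler_wpM2l.
- exact: measurable_weighted_norm.
- by move=> eta _; rewrite lee_fin mulr_ge0// exprn_ge0.
Qed.

(** Both terms explain the weight [2 * C] of the domain: the death term has the factor |eta|, at
    most 2 to the power |eta|, and the birth term is covered by [weight_birth_le]. *)
Lemma L1_Lhat (G : obs R d) : L1 (2 * C) G -> L1 C (Lhat phi z G).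
Proof.
move=> [mG Gfin]; have C20 : 0 <= 2 * C by rewrite mulr_ge0.
have mb : measurable_conf2 (birth_coef z : fconf -> fconf -> R).
  exact: measurable_birth_coef.
pose N : obs R d := fun eta => - (#|` eta|%fset%:R * G eta).
pose B : obs R d := op (birth_coef z) G.
have mN : measurable_fun setT N.
  apply: measurableT_comp => //; apply: measurable_funM => //.
  by apply: measurable_fun_fconf => n; apply: measurable_fun_nat; exact: measurable_card_tuple.
have mB : measurable_fun setT B by exact: measurable_glauber_op.
rewrite LhatE//; split; first exact: measurable_funD.
apply: (le_lt_trans (L1norm_on_triangle measurableT C0 mN mB)).
apply: lte_add_pinfty.
- apply: le_lt_trans Gfin; apply: ge0_le_integral => //.
  + by move=> eta _; rewrite lee_fin mulr_ge0// exprn_ge0.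
  + exact: measurable_weighted_norm.
  + exact: measurable_weighted_norm.
  + move=> eta _; rewrite lee_fin /N normrN normrM normr_nat mulrAC mulrC.
    by rewrite exprMn ler_wpM2l// ler_wpM2r ?exprn_ge0// natr_le_expr2.
- apply: (@le_lt_trans _ _ (1%:E * L1norm (2 * C) G)%E); last by rewrite mul1e.
  apply: le_trans (integral_weight_le mb mG ler01 C20 _).
    apply: (L1norm_on_le d_gt0 mphi phi_ge0 C_phiE C_gt0 measurableT (conj mb mG) mB).
    by apply: aeW => eta _; exact: normr_glauber_op_le.
  by move=> eta; rewrite mul1r exprMn mulrC; exact: weight_birth_le.
Qed.

(* The coefficient of [n (Phat - 1) - Lhat] on configurations in [L]. *)
Definition diff_coef (L : set Rd) (n : nat) (xi om : fconf) : R :=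
  in_conf L xi * (n%:R * (in_conf L om *
     ((1 - n%:R^-1) ^+ #|` xi|%fset * (z * n%:R^-1) ^+ #|` om|%fset)
       - (#|` om|%fset == 0%N)%:R) +
    (#|` xi|%fset%:R * (#|` om|%fset == 0%N)%:R - z * (#|` om|%fset == 1%N)%:R)).

Lemma measurable_diff_coef L n : measurable L -> measurable_conf2 (diff_coef L n).
Proof.
move=> mL i j; apply: measurable_funM.
  exact: (measurableT_comp (measurable_in_conf (n := i) mL) measurable_fst).
apply: measurable_funD; last first.
  exact: (measurable_conf2_card (fun k m => k%:R * (m == 0%N)%:R - z * (m == 1%N)%:R)).
apply: measurable_funM => //; apply: measurable_funB; last first.
  exact: (measurable_conf2_card (fun k m => (m == 0%N)%:R)).
apply: measurable_funM.
  exact: (measurableT_comp (measurable_in_conf (n := j) mL) measurable_snd).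
exact: (measurable_conf2_card (fun k m => (1 - n%:R^-1) ^+ k * (z * n%:R^-1) ^+ m)).
Qed.

Lemma diff_coef_le L n (eta xi : fconf) : (1 < n)%N -> (xi `<=` eta)%fset ->
  let om := (eta `\` xi)%fset in
  let T := `|diff_coef L n xi om| * C ^+ #|` xi|%fset * kappa ^+ #|` om|%fset in
  let k := #|` eta|%fset in
  T <= C ^+ k * (1 + #|` xi|%fset%:R * (#|` om|%fset == 0%N)%:R) /\
  (confs_in L eta -> T <= C ^+ k * ((1 + k%:R ^+ 2) * n%:R^-1)).
Proof.
move=> n1 xieta om T k.
have n0 : 0 < n%:R :> R by rewrite ltr0n ltnW.
have de01 : 0 <= (n%:R^-1 : R) <= 1.
  by rewrite invr_ge0 ltW//= invf_le1// ler1n ltnW.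
have nde : n%:R * n%:R^-1 = 1 :> R by rewrite mulfV// gt_eqF.
have i0 : #|` om|%fset = 0%N -> in_conf L om = 1.
  by move=> /cardfs0_eq ->; apply: in_confE => x.
have := @diff_coef_real R n%:R n%:R^-1 (in_conf L om) C z kappa n0 de01 nde
  (in_conf_itv L om) #|` om|%fset i0 C0 z0 (expR_ge0 _) zC #|` xi|%fset.
rewrite -(cardfs_subset xieta) -/k => -[X1 X2].
have TX : T <= `|n%:R * (in_conf L om *
     ((1 - n%:R^-1) ^+ #|` xi|%fset * (z * n%:R^-1) ^+ #|` om|%fset)
       - (#|` om|%fset == 0%N)%:R) +
    (#|` xi|%fset%:R * (#|` om|%fset == 0%N)%:R - z * (#|` om|%fset == 1%N)%:R)| *
    (C ^+ #|` xi|%fset * kappa ^+ #|` om|%fset).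
  rewrite /T /diff_coef -mulrA ler_wpM2r//.
    by rewrite mulr_ge0// exprn_ge0// expR_ge0.
  by have /andP[x0 x1] := in_conf_itv L xi; rewrite normrM ger0_norm// ler_piMl.
split=> [|etaL]; apply: (le_trans TX) => //; apply: X2.
by apply/in_confE/(confs_in_subset etaL); exact: fsubsetDl.
Qed.

(** Summed over the subsets of a [k]-point configuration, the constant 1 gives [2 ^+ k]; the only
    splitting with empty [om] adds [k <= 2 ^+ k]. *)
Lemma weight_diff_le L n (eta : fconf) : (1 < n)%N ->
  weight cphi (diff_coef L n) C eta <= 2 * (2 * C) ^+ #|` eta|%fset.
Proof.
move=> n1; set k := #|` eta|%fset.
apply: (@le_trans _ _ (C ^+ k * subset_sum (fun xi om : fconf =>
   1 + #|` xi|%fset%:R * (#|` om|%fset == 0%N)%:R) eta)).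
  rewrite /weight {2}/subset_sum mulr_sumr.
  rewrite -/(subset_sum (fun xi om : fconf =>
    C ^+ k * (1 + #|` xi|%fset%:R * (#|` om|%fset == 0%N)%:R)) eta).
  by apply: le_subset_sum => xi xieta; case: (diff_coef_le L n1 xieta).
rewrite subset_sumD subset_sum_cst mul1r.
rewrite (subset_sum_point (fun xi : fconf => #|` xi|%fset%:R)).
rewrite exprMn mulrA [2 * _ * _]mulrC ler_wpM2l ?exprn_ge0// mulr2n mulrDl mul1r lerD2l.
exact: natr_le_expr2.
Qed.

Lemma weight_diff_small L n (eta : fconf) : (1 < n)%N -> confs_in L eta ->
  weight cphi (diff_coef L n) C eta <=
  C ^+ #|` eta|%fset * (1 + #|` eta|%fset%:R ^+ 2) * 2 ^+ #|` eta|%fset * n%:R^-1.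
Proof.
move=> n1 etaL; rewrite [leRHS]mulrAC -subset_sum_cst; apply: le_subset_sum => xi xieta.
by have [_ /(_ etaL)] := diff_coef_le L n1 xieta; rewrite [leRHS]mulrA.
Qed.

End glauber_consistency.

(** * Density of the domain and convergence of the discrete generators *)

Section glauber_convergence.
Context {R : realType} {d : nat}.
Hypothesis d_gt0 : (0 < d)%N.
Local Notation Rd := 'rV[R]_d.
Local Notation fconf := (fconf R d).
Local Notation lp := (@lebesgue_poisson R d).

(** The number of points is truncated at [k]. On such functions the two norms differ by a factor of
    at most [2 ^+ k], and the truncation error tends to 0 by dominated convergence. *)
Lemma L1_truncation_dense (C : R) (u : obs R d) (e : R) : 0 < C -> L1 C u -> 0 < e ->
  exists2 w : obs R d, L1 (2 * C) w & (L1norm C (u - w)%R < e%:E)%E.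
Proof.
move=> C_gt0 [mu ufin] e0; have C0 := ltW C_gt0; have C20 : 0 <= 2 * C by rewrite mulr_ge0.
pose w k : obs R d := fun eta => u eta * (#|` eta|%fset <= k)%N%:R.
have mw k : measurable_fun setT (w k).
  apply: measurable_funM => //; apply: measurable_fun_fconf => n.
  exact: (measurable_fun_nat (fun j => (j <= k)%N%:R : R) (@measurable_card_tuple R d n)).
have muw k : measurable_fun setT (u - w k : obs R d) by exact: measurable_funB.
have wL1 k : L1 (2 * C) (w k).
  split=> //; apply: (@le_lt_trans _ _ ((2 ^+ k)%:E * L1norm C u)%E); last first.
    by rewrite lte_mul_pinfty// lee_fin exprn_ge0.
  rewrite /L1norm /L1norm_on -ge0_integralZl//; last 2 first.
  - exact: measurable_weighted_norm.
  - by move=> eta _; rewrite lee_fin mulr_ge0// exprn_ge0.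
  apply: ge0_le_integral => //.
  - by move=> eta _; rewrite lee_fin mulr_ge0// exprn_ge0.
  - exact: measurable_weighted_norm.
  - by apply: measurable_funeM; exact: measurable_weighted_norm.
  - move=> eta _; rewrite -EFinM lee_fin /w; case: (leqP _ k) => [ek|_]; last first.
      by rewrite mulr0 normr0 mul0r !mulr_ge0// exprn_ge0.
    rewrite mulr1 exprMn mulrCA ler_wpM2r ?mulr_ge0 ?exprn_ge0//.
    by rewrite ler_weXn2l// ler1n.
have mf k : measurable_fun setT
    (fun eta => (`|(u - w k : obs R d) eta| * C ^+ #|` eta|%fset)%:E).
  exact: measurable_weighted_norm.
have intg : lp.-integrable setT (fun eta => (`|u eta| * C ^+ #|` eta|%fset)%:E).
  apply/integrableP; split; first exact: measurable_weighted_norm.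
  under eq_integral do rewrite gee0_abs ?lee_fin ?mulr_ge0 ?exprn_ge0//.
  exact: ufin.
have cv : {ae lp, forall eta, setT eta ->
    (fun k => (`|(u - w k : obs R d) eta| * C ^+ #|` eta|%fset)%:E) @ \oo --> 0%E}.
  apply: aeW => eta _; apply: cvg_near_cst; near=> k.
  have ek : (#|` eta|%fset <= k)%N by near: k; exact: nbhs_infty_ge.
  have -> : (u - w k : obs R d) eta = u eta - u eta * (#|` eta|%fset <= k)%N%:R by [].
  by rewrite ek mulr1 subrr normr0 mul0r.
have dom : {ae lp, forall eta k, setT eta ->
    (`|(`|(u - w k : obs R d) eta| * C ^+ #|` eta|%fset)%:E| <=
      (`|u eta| * C ^+ #|` eta|%fset)%:E)%E}.
  apply: aeW => eta k _; rewrite gee0_abs ?lee_fin ?mulr_ge0 ?exprn_ge0//.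
  rewrite ler_wpM2r ?exprn_ge0//.
  have -> : (u - w k : obs R d) eta = u eta - u eta * (#|` eta|%fset <= k)%N%:R by [].
  by case: leqP => _; rewrite ?mulr1 ?mulr0 ?subr0// subrr normr0.
have [_ _] := dominated_convergence measurableT mf (measurable_cst 0%E) cv intg dom.
rewrite integral0 => /fine_cvgP[ffin] /cvgrPdist_lt/(_ _ e0) near_lt.
near \oo => k; exists (w k) => //.
have fin_k : L1norm C (u - w k)%R \is a fin_num by near: k; exact: ffin.
rewrite -(fineK fin_k) lte_fin.
have : `|0 - fine (L1norm C (u - w k)%R)| < e by near: k; exact: near_lt.
by rewrite sub0r normrN; apply: le_lt_trans; exact: ler_norm.
Unshelve. all: by end_near. Qed.

Variable phi : Rd -> R.
Hypothesis mphi : measurable_fun setT phi.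
Hypothesis phi_ge0 : forall x, 0 <= phi x.
Hypothesis phi_even : forall x, phi (- x) = phi x.
Variable cphi : R.
Hypothesis C_phiE : C_phi phi = cphi%:E.
Local Notation op := (glauber_op phi).
Local Notation gabs := (glauber_abs phi).
Variables z C : R.
Hypothesis z_gt0 : 0 < z.
Hypothesis C_gt0 : 0 < C.
Hypothesis zC : z * expR (C * cphi) <= C.

Let C0 : 0 <= C. Proof. exact: ltW. Qed.

Lemma inv_nat_itv (n : nat) : (1 < n)%N -> 0 <= (n%:R^-1 : R) < 1.
Proof. by move=> n1; rewrite invr_ge0 ler0n/= invf_lt1 ?ltr1n// ltr0n ltnW. Qed.

Lemma discrete_generatorE L n (u : obs R d) : measurable L -> (1 < n)%N -> L1 (2 * C) u ->
  {ae lp, forall eta, confs_in L eta ->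
    (n%:R *: (Phat_on phi z L n%:R^-1 u - u) - Lhat phi z u) eta =
    op (diff_coef z L n) u eta}.
Proof.
move=> mL n1 [mu ufin]; have de01 := inv_nat_itv n1.
have C20 : 0 <= 2 * C by rewrite mulr_ge0.
have mP : measurable_conf2 (Phat_coef z L n%:R^-1) by exact: measurable_Phat_coef.
have mb : measurable_conf2 (birth_coef z : fconf -> fconf -> R).
  exact: measurable_birth_coef.
have mdf : measurable_conf2 (diff_coef z L n) by exact: measurable_diff_coef.
pose f (xi : fconf) : R := #|` xi|%fset%:R - n%:R.
pose c0 (xi om : fconf) : R := f xi * (#|` om|%fset == 0%N)%:R.
have mc0 : measurable_conf2 c0.
  exact: (measurable_conf2_card (fun i j => (i%:R - n%:R) * (j == 0%N)%:R)).
(* [q] is the coefficient of [n (Phat - 1)] plus multiplication by |eta|. Subtracting the birth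
   coefficient leaves [diff_coef], so two uses of [glauber_abs_lin] suffice. *)
pose q xi om := n%:R * Phat_coef z L n%:R^-1 xi om + c0 xi om.
have mq : measurable_conf2 q.
  by move=> i j; apply: measurable_funD; [apply: measurable_funM => //; exact: mP|exact: mc0].
have uC : (L1norm_on (confs_in L) C u < +oo)%E.
  apply: le_lt_trans (L1norm_on_le_L1norm (measurable_confs_in mL) C0 mu) _.
  apply: le_lt_trans ufin; apply: ge0_le_integral => //.
  - by move=> eta _; rewrite lee_fin mulr_ge0// exprn_ge0.
  - exact: measurable_weighted_norm.
  - exact: measurable_weighted_norm.
  - move=> eta _; rewrite lee_fin ler_wpM2l//; apply: lerXn2r; rewrite ?nnegrE//.
    by rewrite ler_peMl// ler1n.
have finP := ae_glauber_abs_fin d_gt0 mphi phi_ge0 C_phiE C_gt0 (conj mP mu)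
  (le_lt_trans (integral_weight_Phat_le z_gt0 C_gt0 zC mL de01 mu) uC).
have bfin : (\int[lp]_eta (`|u eta| * weight cphi (birth_coef z) C eta)%:E < +oo)%E.
  apply: (@le_lt_trans _ _ (1%:E * L1norm (2 * C) u)%E); last by rewrite mul1e.
  apply: integral_weight_le => // eta.
  by rewrite mul1r exprMn mulrC; exact: weight_birth_le.
have finb := ae_glauber_abs_fin d_gt0 mphi phi_ge0 C_phiE C_gt0 (conj mb mu) bfin.
apply: filterS2 finP finb => eta fP fb etaL.
have lin1 xi om : (xi `<=` eta)%fset -> q xi om * u (xi `|` om)%fset =
    n%:R * (Phat_coef z L n%:R^-1 xi om * u (xi `|` om)%fset) +
    c0 xi om * u (xi `|` om)%fset.
  by move=> _; rewrite /q mulrDl mulrA.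
have f0 : (gabs c0 u eta < +oo)%E by apply: (glauber_abs_card0 mphi (f := f)).
have opE : op c0 u eta = f eta * u eta by apply: (glauber_op_card0 mphi).
have [fq qE] := glauber_abs_lin mphi (conj mq mu) (conj mP mu) (conj mc0 mu) lin1 fP f0.
have lin2 xi om : (xi `<=` eta)%fset -> diff_coef z L n xi om * u (xi `|` om)%fset =
    -1 * (birth_coef z xi om * u (xi `|` om)%fset) + q xi om * u (xi `|` om)%fset.
  move=> xieta; rewrite mulrA -mulrDl; congr (_ * _).
  rewrite /diff_coef /q /c0 /f /birth_coef /Phat_coef.
  rewrite (in_confE (confs_in_subset etaL xieta)) !mul1r.
  by rewrite mulrBr mulrBl mulN1r !addrA [RHS]addrC !addrA; lra.
have [_ ->] := glauber_abs_lin mphi (conj mdf mu) (conj mb mu) (conj mq mu) lin2 fb fq.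
rewrite qE opE.
have -> : (n%:R *: (Phat_on phi z L n%:R^-1 u - u) - Lhat phi z u) eta =
    n%:R * (Phat_on phi z L n%:R^-1 u eta - u eta) - Lhat phi z u eta by [].
rewrite Phat_onE// LhatE// /cutoff -/(in_conf L eta) in_confE// /f.
set x1 := op _ _ _; set x2 := op _ _ _; set x3 := u eta; lra.
Qed.

Variable Ls : nat -> set Rd.
Hypothesis Ls_meas : forall n, (1 < n)%N -> measurable (Ls n).
Hypothesis Ls_incr : forall n, (1 < n)%N -> Ls n `<=` Ls n.+1.
Hypothesis Ls_cover : \bigcup_(n in [set n | (1 < n)%N]) Ls n = setT.

Lemma near_confs_in (eta : fconf) : \forall n \near \oo, confs_in (Ls n) eta.
Proof.
have mono n m : (1 < n)%N -> (n <= m)%N -> Ls n `<=` Ls m.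
  move=> n1; elim: m => [|m IH]; first by rewrite leqn0 => /eqP ->.
  rewrite leq_eqVlt => /predU1P[->//|nm] x /(IH nm).
  by apply: Ls_incr; exact: leq_trans n1 nm.
elim/(@fconf_ind R d): eta => [|x eta _ IH]; first by apply: nearW => n y.
have [k /= k1 xk] : (\bigcup_(n in [set n | (1 < n)%N]) Ls n) x by rewrite Ls_cover.
near=> n => y /=; rewrite !inE => /predU1P[->|yeta].
- by apply: (mono k) => //; near: n; exact: nbhs_infty_ge.
- have : confs_in (Ls n) eta by near: n; exact: IH.
  exact.
Unshelve. all: by end_near. Qed.

Lemma discrete_generator_cvg (u : obs R d) (e : R) : L1 (2 * C) u -> 0 < e ->
  \forall n \near \oo, (L1norm_on (confs_in (Ls n)) C
    (n%:R *: (Phat_on phi z (Ls n) n%:R^-1 u - u) - Lhat phi z u)%R < e%:E)%E.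
Proof.
move=> uL1 e0; have [mu ufin] := uL1.
have C20 : 0 <= 2 * C by rewrite mulr_ge0.
(* The index is shifted by 2, since the boxes and the weight bounds are controlled for [n > 1] only,
   while dominated convergence is applied to a full sequence. *)
pose a k := diff_coef z (Ls k.+2) k.+2.
have ma k : measurable_conf2 (a k) by apply: measurable_diff_coef; exact: Ls_meas.
pose h k eta := (`|u eta| * weight cphi (a k) C eta)%:E.
have mh k : measurable_fun setT (h k).
  apply/measurable_EFinP; apply: measurable_funM; first exact: measurableT_comp.
  exact: measurable_weight.
pose g eta := (2%:E * (`|u eta| * (2 * C) ^+ #|` eta|%fset)%:E)%E.
have intg : lp.-integrable setT g.
  apply: integrableZl => //; apply/integrableP; split; first exact: measurable_weighted_norm.
  under eq_integral do rewrite gee0_abs ?lee_fin ?mulr_ge0 ?exprn_ge0//.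
  exact: ufin.
have dom : {ae lp, forall eta k, setT eta -> (`|h k eta| <= g eta)%E}.
  apply: aeW => eta k _; rewrite gee0_abs ?lee_fin ?mulr_ge0 ?weight_ge0//.
  rewrite mulrCA ler_wpM2l//; exact: weight_diff_le.
have cv : {ae lp, forall eta, setT eta -> h ^~ eta @ \oo --> 0%E}.
  apply: aeW => eta _.
  pose b := C ^+ #|` eta|%fset * (1 + #|` eta|%fset%:R ^+ 2) * 2 ^+ #|` eta|%fset.
  have b0 : 0 <= b by rewrite !mulr_ge0 ?exprn_ge0// addr_ge0// exprn_ge0.
  have hE : h ^~ eta = EFin \o (fun k => `|u eta| * weight cphi (a k) C eta) by [].
  rewrite hE; apply: cvg_EFin; first exact: nearW.
  apply: (@squeeze_cvgr _ _ _ _ (fun=> 0) (fun k => `|u eta| * b * k.+1%:R^-1)).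
  - have [N _ HN] := near_confs_in eta.
    near=> k; rewrite mulr_ge0 ?weight_ge0//= -mulrA ler_wpM2l//.
    apply: (le_trans (weight_diff_small z_gt0 C_gt0 zC _ _)) => //.
      by apply: HN => /=; rewrite !leqW//; near: k; exact: nbhs_infty_ge.
    by rewrite ler_wpM2l// lef_pV2 ?posrE ?ltr0n// ler_nat.
  - exact: cvg_cst.
  - rewrite -[X in _ --> X](mulr0 (`|u eta| * b)); apply: cvgMr.
    exact: cvg_harmonic.
have [_ _] := dominated_convergence measurableT mh (measurable_cst 0%E) cv intg dom.
rewrite integral0 => /fine_cvgP[ffin] /cvgrPdist_lt/(_ _ e0) near_lt.
have [N _ HN] : \forall k \near \oo, (\int[lp]_eta h k eta < e%:E)%E.
  near=> k.
  have fin_k : (\int[lp]_eta h k eta)%E \is a fin_num by near: k; exact: ffin.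
  rewrite -(fineK fin_k) lte_fin.
  have : `|0 - fine (\int[lp]_eta h k eta)%E| < e by near: k; exact: near_lt.
  by rewrite sub0r normrN; apply: le_lt_trans; exact: ler_norm.
near=> n.
have nN : (N.+2 <= n)%N by near: n; exact: nbhs_infty_ge.
have n1 : (1 < n)%N by apply: leq_trans nN.
have [k nk] : exists k, n = k.+2 by exists n.-2; case: (n) n1 => [|[]].
have mL := Ls_meas n1.
have mdf : measurable_conf2 (diff_coef z (Ls n) n) by exact: measurable_diff_coef.
have mF : measurable_fun setT
    (n%:R *: (Phat_on phi z (Ls n) n%:R^-1 u - u) - Lhat phi z u : obs R d).
  apply: measurable_funB; last first.
    exact: (L1_Lhat d_gt0 mphi phi_ge0 phi_even C_phiE _ _ zC uL1).1.
  apply: measurable_funM => //; apply: measurable_funB => //.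
  by apply: measurable_Phat_on => //; exact: inv_nat_itv.
apply: (@le_lt_trans _ _
    (\int[lp]_eta (`|u eta| * weight cphi (diff_coef z (Ls n) n) C eta)%:E)%E).
  apply: (L1norm_on_le d_gt0 mphi phi_ge0 C_phiE C_gt0 (measurable_confs_in mL)
    (conj mdf mu) mF).
  apply: filterS (discrete_generatorE mL n1 uL1) => eta etaE etaL.
  by rewrite etaE//; exact: normr_glauber_op_le.
have := HN k; rewrite /h /a -nk; apply => /=.
by move: nN; rewrite nk !ltnS.
Unshelve. all: by end_near. Qed.

End glauber_convergence.

(** * Invariance under null sets and cut-offs *)

Section null_diagonal.
Context {R : realType} {d : nat}.
Hypothesis d_gt0 : (0 < d)%N.
Local Notation Rd := 'rV[R]_d.
Local Notation tup n := (n.-tuple Rd).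
Local Notation fconf := (fconf R d).
Local Notation leb := (@lebesgue_rV R d).
Local Notation lp := (@lebesgue_poisson R d).

Lemma ae_rV_notin (eta : fconf) : {ae leb, forall x, x \notin eta}.
Proof.
by apply: negligibleS (lebesgue_rV_fset d_gt0 eta) => x /= /negP; rewrite negbK.
Qed.

(** The indicator of [y \in om] has integral 0 over tuples of each length, as every entry differs
    from [y] almost everywhere. *)
Lemma ae_lp_notin1 (y : Rd) : {ae lp, forall om : fconf, y \notin om}.
Proof.
pose f (om : fconf) : \bar R := (y \in om)%:R%:E.
have mft n : measurable_fun setT (fun t : tup n => f (conf_of_tuple t)).
  apply/measurable_EFinP; apply: (measurableT_comp (f := fun b : bool => b%:R : R)) => //.
  by apply: (measurable_mem_conf (f := fun=> y)).
have mf : measurable_fun setT f by exact: measurable_fun_fconf.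
have f0 om : (0 <= f om)%E by rewrite lee_fin.
have If n : (\int[tuple_measure leb n]_t f (conf_of_tuple t) = 0)%E.
  elim: n => [|n IH]; first by rewrite integral_tuple0 conf_of_tuple0 /f inE.
  rewrite integral_tuple_cons//.
  have mF : measurable_fun setT (fun x => \int[tuple_measure leb n]_t
      f (conf_of_tuple [tuple of x :: t]))%E.
    apply: (@measurable_fun_fubini_tonelli_F _ _ _ _ _ (tuple_measure leb n)
      (fun w : Rd * tup n => f (conf_of_tuple [tuple of w.1 :: w.2]))) => //.
    by apply: (measurableT_comp (mft n.+1)); exact: measurable_cons.
  rewrite (ge0_ae_eq_integral (g := cst 0%E))//; first exact: integral0.
  - by move=> x _; exact: integral_ge0.
  - apply: filterS (ae_rV_notin [fset y]%fset) => x; rewrite !inE => xy _ /=.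
    rewrite -[RHS]IH; apply: eq_integral => t _.
    by rewrite conf_of_tuple_cons /f !inE eq_sym (negbTE xy).
have : (\int[lp]_om `|f om| = 0)%E.
  under eq_integral do rewrite gee0_abs//.
  rewrite ge0_integral_lebesgue_poisson// eseries0// => n _ _.
  by rewrite If mule0.
move=> /(ae_eq_integral_abs lp measurableT mf); apply: filterS => om /(_ I) /=.
by rewrite /f; case: (y \in om) => // -[] /eqP; rewrite oner_eq0.
Qed.

Lemma ae_lp_notin (eta : fconf) :
  {ae lp, forall om : fconf, forall y, y \in eta -> y \notin om}.
Proof.
elim/(@fconf_ind R d): eta => [|x eta _ IH]; first by apply: aeW => om y; rewrite inE.
apply: filterS2 IH (ae_lp_notin1 x) => om IH xom y; rewrite !inE => /predU1P[->//|].
exact: IH.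
Qed.

End null_diagonal.

Section potential_at_origin.
Context {R : realType} {d : nat}.
Hypothesis d_gt0 : (0 < d)%N.
Local Notation Rd := 'rV[R]_d.
Local Notation fconf := (fconf R d).
Variables phi psi : Rd -> R.
Hypothesis mphi : measurable_fun setT phi.
Hypothesis mpsi : measurable_fun setT psi.
Hypothesis phi_psi : forall x, x != 0 -> phi x = psi x.

Lemma eq_C_phi : C_phi phi = C_phi psi.
Proof.
have mE (chi : Rd -> R) : measurable_fun setT chi ->
    measurable_fun setT (fun x => (1 - expR (- chi x))%:E).
  move=> mchi; apply/measurable_EFinP; apply: measurable_funB => //.
  by apply: (measurableT_comp (@measurable_expR R)); exact: measurableT_comp.
apply: ae_eq_integral => //; [exact: mE|exact: mE|].
apply: filterS (ae_rV_notin d_gt0 [fset 0]%fset) => x; rewrite !inE => x0 _.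
by rewrite phi_psi.
Qed.

Lemma eq_energy (x : Rd) (xi : fconf) : x \notin xi -> energy phi x xi = energy psi x xi.
Proof.
move=> xxi; apply: eq_big_seq => y yxi; apply: phi_psi; rewrite subr_eq0.
by apply: contraNneq xxi => ->.
Qed.

(** Equality holds at every [eta]: the value of the potential at 0 enters the integrand only for [x]
    in the finite set [eta], which is null. *)
Lemma eq_Lhat (z : R) (G : obs R d) : measurable_fun setT G ->
  Lhat phi z G = Lhat psi z G.
Proof.
move=> mG; apply/funext => eta; congr (_ + _ * _).
apply: eq_big_seq => xi; rewrite fpowersetE => xieta.
have mL (chi : Rd -> R) : measurable_fun setT chi -> measurable_fun setT (fun x : Rd =>
    (expR (- energy chi x xi) * G (x |` xi)%fset *
     e_lambda (fun y => expR (- chi (x - y)) - 1) (eta `\` xi)%fset)%:E).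
  move=> mchi; apply/measurable_EFinP.
  have [n [s <-]] := conf_of_tupleP xi.
  have [m [t <-]] := conf_of_tupleP (eta `\` conf_of_tuple s)%fset.
  apply: measurable_funM; first apply: measurable_funM.
  - exact: (measurable_boltzmann mchi (g := fun=> s) (f := id)).
  - under eq_fun do rewrite -conf_of_tuple_cons.
    apply: (measurableT_comp mG); apply: (measurableT_comp (@measurable_conf_of_tuple R d _)).
    exact: measurable_cons.
  - apply: (measurable_e_lambda_tuple (g := fun=> t)
      (f := fun x y : Rd => expR (- chi (x - y)) - 1)) => //.
    apply: measurable_funB => //; apply: (measurableT_comp (@measurable_expR R)).
    apply: measurableT_comp => //; apply: measurableT_comp => //.
    by apply: measurable_rV_sub.
rewrite /Rintegral; congr fine; apply: ae_eq_integral => //; [exact: mL|exact: mL|].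
apply: filterS (ae_rV_notin d_gt0 eta) => x xeta _; congr EFin.
have xsub (B : fconf) : (B `<=` eta)%fset -> x \notin B.
  by move=> /fsubsetP BA; apply: contra xeta => /BA.
rewrite (eq_energy (xsub _ xieta)); congr (_ * _).
apply: eq_big_seq => y yom; rewrite phi_psi// subr_eq0.
by apply: contraNneq (xsub _ (fsubsetDl eta xi)) => ->.
Qed.

(** As for [eq_Lhat], with the null set of those [om] that meet [eta]. *)
Lemma eq_Phat_on (z : R) (L : set Rd) (de : R) (G : obs R d) : measurable L ->
  measurable_fun setT G -> Phat_on phi z L de G = Phat_on psi z L de G.
Proof.
move=> mL mG; rewrite /Phat_on; congr cutoff.
apply/funext => eta; apply: eq_big_seq => xi; rewrite fpowersetE => xieta; congr (_ * _).
have mD := measurable_confs_in mL.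
pose a (_ om : fconf) : R := (z * de) ^+ #|` om|%fset.
have ma : measurable_conf2 a by exact: (measurable_conf2_card (fun i j => (z * de) ^+ j)).
have mP (chi : Rd -> R) : measurable_fun setT chi -> measurable_fun setT (fun om : fconf =>
    ((z * de) ^+ #|` om|%fset * G (xi `|` om)%fset *
      (\prod_(y <- xi) expR (- energy chi y om)) *
      (\prod_(y <- (eta `\` xi)%fset) (expR (- energy chi y om) - 1)))%:E).
  move=> mchi; apply/measurable_EFinP.
  have := measurable_glauber_kernel_om mchi ma mG xi (eta `\` xi)%fset.
  by apply: eq_measurable_fun => om _; rewrite /glauber_kernel /a mulrA.
rewrite /Rintegral; congr fine; apply: ae_eq_integral => //.
- by apply: measurable_funTS; exact: mP.
- by apply: measurable_funTS; exact: mP.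
apply: filterS (ae_lp_notin d_gt0 eta) => om etaom _; congr EFin.
congr (_ * _ * _); apply: eq_big_seq => y yxi; rewrite eq_energy//; apply: etaom.
- exact: (fsubsetP xieta).
- by move: yxi; rewrite !inE => /andP[].
Qed.

End potential_at_origin.

Section cutoffs.
Context {R : realType} {d : nat}.
Local Notation Rd := 'rV[R]_d.
Variables (phi : Rd -> R) (z : R) (L : set Rd) (de : R).

(** If [eta] and [om] lie in [L], so does [xi] united with [om]: [Phat_on] reads its argument on
    [confs_in L] only. The iteration can thus start from [G] itself instead of its cut-off. *)
Lemma Phat_on_cutoff (G : obs R d) :
  Phat_on phi z L de (cutoff L G) = Phat_on phi z L de G.
Proof.
apply/funext => eta; rewrite /Phat_on {1 3}/cutoff -/(in_conf L eta).
have [etaL|etaL] := pselect (confs_in L eta); last by rewrite in_confN// !mul0r.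
congr (_ * _); apply: eq_big_seq => xi; rewrite fpowersetE => xieta; congr (_ * _).
apply: eq_Rintegral => om; rewrite inE => omL.
rewrite /cutoff -/(in_conf L (xi `|` om)%fset) in_confE ?mul1r// => x /=.
rewrite inE => /orP[/(fsubsetP xieta)|]; first exact: etaL.
exact: omL.
Qed.

Lemma iter_Phat_on_cutoff k (G : obs R d) eta : confs_in L eta ->
  iter k (Phat_on phi z L de) (cutoff L G) eta = iter k (Phat_on phi z L de) G eta.
Proof.
case: k => [|k] etaL; first by rewrite /= /cutoff -/(in_conf L eta) in_confE// mul1r.
by rewrite !iterSr Phat_on_cutoff.
Qed.

Lemma L1norm_cutoff (C : R) (F : obs R d) : measurable L ->
  L1norm C (cutoff L F) = L1norm_on (confs_in L) C (cutoff L F).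
Proof.
move=> mL; rewrite /L1norm /L1norm_on [RHS]integral_mkcond; apply: eq_integral => eta _.
rewrite /patch; have [h|h] := pselect (confs_in L eta); first by rewrite mem_set.
by rewrite memNset// /cutoff -/(in_conf L eta) in_confN// mul0r normr0 mul0r.
Qed.

End cutoffs.

(** * Limits, the L^1-spaces as seminormed spaces, and assembly of the theorem *)

Lemma ge0_cvg0P (R : realType) (T : Type) (F : set_system T) (f : T -> \bar R) :
  Filter F -> (forall x, 0 <= f x)%E ->
  f x @[x --> F] --> 0%E <-> forall e : R, 0 < e -> \forall x \near F, (f x < e%:E)%E.
Proof.
move=> FF f0; split => [/fine_cvgP[ffin /cvgrPdist_lt near_lt] e e0|H].
  apply: filterS2 ffin (near_lt _ e0) => x fx; rewrite sub0r normrN /= => lt_e.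
  by rewrite -(fineK fx) lte_fin; apply: le_lt_trans lt_e; exact: ler_norm.
apply/fine_cvgP; split.
  apply: filterS (H _ ltr01) => x fx1; rewrite ge0_fin_numE//.
  exact: lt_trans fx1 (ltry _).
apply/cvgrPdist_lt => e e0; apply: filterS (H _ e0) => x fxe; rewrite sub0r normrN /=.
have fx : f x \is a fin_num by rewrite ge0_fin_numE// (lt_trans fxe)// ltry.
by rewrite ger0_norm ?fine_ge0// -lte_fin fineK.
Qed.

Lemma near_at_right0 (R : realType) (P : R -> Prop) :
  (\forall t \near 0^'+, P t) <-> exists2 h, 0 < h & forall t, 0 < t <= h -> P t.
Proof.
split=> [[e /= e0 He]|[h h0 Hh]].
  exists (e / 2); first by rewrite divr_gt0.
  move=> t /andP[t0 te]; apply: He => //=; rewrite sub0r normrN gtr0_norm//.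
  by rewrite (le_lt_trans te)// ltr_pdivrMr// ltr_pMr// ltr1n.
near=> t; apply: Hh; apply/andP; split.
- by near: t; exact: nbhs_right_gt.
- by near: t; exact: nbhs_right_le.
Unshelve. all: by end_near. Qed.

Lemma measurable_fun_off0 (R : realType) d (f : 'rV[R]_d -> R) :
  measurable_fun [set~ (0 : 'rV[R]_d)] f -> measurable_fun setT f.
Proof.
move=> mf; have m0 := measurable_rV_set1 (0 : 'rV[R]_d).
rewrite -(setvU [set (0 : 'rV[R]_d)]); apply/measurable_funU => //.
  exact: measurableC.
split=> //; apply: (eq_measurable_fun (cst (f 0))); last exact: measurable_cst.
by move=> x; rewrite inE => ->.
Qed.

Section L1_spaces.
Context {R : realType} {d : nat}.
Variable C : R.
Hypothesis C_ge0 : 0 <= C.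

Lemma L1_subspace : is_subspace (L1 C : set (obs R d)).
Proof.
split.
  split; first exact: measurable_cst.
  rewrite /L1norm /L1norm_on; under eq_integral do rewrite normr0 mul0r.
  by rewrite integral0 ltry.
move=> a u v [mu ufin] [mv vfin].
have mau : measurable_fun setT (a *: u : obs R d) by exact: measurable_funM.
split; first exact: measurable_funD.
apply: le_lt_trans (L1norm_on_triangle measurableT C_ge0 mau mv) _.
rewrite L1norm_onZ//; apply: lte_add_pinfty => //.
by rewrite lte_mul_pinfty// lee_fin.
Qed.

Lemma L1norm_on_fin (D : set (fconf R d)) (u : obs R d) : measurable D -> L1 C u ->
  L1norm_on D C u \is a fin_num.
Proof.
move=> mD [mu ufin]; rewrite ge0_fin_numE ?L1norm_on_ge0//.
exact: le_lt_trans (L1norm_on_le_L1norm mD C_ge0 mu) ufin.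
Qed.

Lemma fine_L1norm_on_seminorm (D : set (fconf R d)) : measurable D ->
  seminorm_on (L1 C) (fun u : obs R d => fine (L1norm_on D C u)).
Proof.
move=> mD; split.
- by move=> u; apply: fine_ge0; exact: L1norm_on_ge0.
- move=> u v Eu Ev; have Euv := subspaceD L1_subspace Eu Ev.
  rewrite -lee_fin EFinD !fineK ?L1norm_on_fin//.
  exact: L1norm_on_triangle Eu.1 Ev.1.
- move=> a u Eu; rewrite L1norm_onZ ?Eu.1//; last exact: Eu.1.
  by rewrite fineM// L1norm_on_fin.
Qed.

End L1_spaces.

Theorem proposition4p10 (R : realType) (d : nat) (d_gt0 : (0 < d)%N)
  (phi : 'rV[R]_d -> R)
  (phi_meas : measurable_fun [set~ (0 : 'rV[R]_d)] phi)
  (phi_ge0 : forall x : 'rV[R]_d, x != 0 -> 0 <= phi x)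
  (phi_even : forall x : 'rV[R]_d, x != 0 -> phi (- x) = phi x)
  (C_phi_fin : (C_phi phi < +oo)%E)
  (C z : R) (C_gt0 : 0 < C) (z_gt0 : 0 < z)
  (z_le : z <= Num.min (C * expR (- (C * fine (C_phi phi))))
                       (2 * C * expR (- (2 * C * fine (C_phi phi)))))
  (T : R -> obs R d -> obs R d)
  (T_gen : semigroup_of_closure (L1 C) (L1norm C) (L1 (2 * C)) (Lhat phi z) T)
  (Lambda : nat -> set 'rV[R]_d)
  (Lambda_meas : forall n, (2 <= n)%N -> measurable (Lambda n))
  (Lambda_bnd : forall n, (2 <= n)%N -> bounded_set (Lambda n))
  (Lambda_incr : forall n, (2 <= n)%N -> Lambda n `<=` Lambda n.+1)
  (Lambda_cover : \bigcup_(n in [set n | (2 <= n)%N]) Lambda n = setT)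
  (G : obs R d) (G_L1 : L1 C G) :
  forall tau eps : R, 0 < eps ->
  \forall n \near \oo, forall t : R, 0 <= t <= tau ->
    (L1norm_on (confs_in (Lambda n)) C
      (iter (Num.truncn (n%:R * t))
            (Phat_on phi z (Lambda n) n%:R^-1) (cutoff (Lambda n) G)
       \- cutoff (Lambda n) (T t G))%R < eps%:E)%E.
Proof.
move=> tau eps eps0.
(* The value of [phi] at the origin is arbitrary and plays no role. *)
pose psi (x : 'rV[R]_d) : R := if x == 0 then 0 else phi x.
have phi_psi x : x != 0 -> phi x = psi x by rewrite /psi => /negbTE ->.
have mphi := measurable_fun_off0 phi_meas.
have mpsi : measurable_fun setT psi.
  apply: measurable_fun_off0; apply: eq_measurable_fun phi_meas => x.
  by rewrite inE => /eqP x0; exact: phi_psi.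
have psi_ge0 x : 0 <= psi x by rewrite /psi; case: ifPn => // /phi_ge0.
have psi_even x : psi (- x) = psi x.
  by rewrite /psi oppr_eq0; case: ifPn => // /phi_even.
pose cphi := fine (C_phi phi).
have C_psiE : C_phi psi = cphi%:E.
  rewrite -(eq_C_phi d_gt0 mphi mpsi phi_psi) fineK// ge0_fin_numE//.
  rewrite (eq_C_phi d_gt0 mphi mpsi phi_psi); apply: integral_ge0 => x _.
  by rewrite lee_fin subr_ge0 -expR0 ler_expR oppr_le0.
have zC : z * expR (C * cphi) <= C.
  move: z_le; rewrite le_min => /andP[+ _].
  by rewrite expRN ler_pdivlMr ?expR_gt0.
have C0 := ltW C_gt0.
have [closableA semT genT] := T_gen.
have [TE T_lin T_id T_add T_le T_cont] := semT.
pose E : set (obs R d) := L1 C.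
have Esub : is_subspace E by exact: L1_subspace.
pose r (u : obs R d) : R := fine (L1norm C u).
(* The boxes with index below 2 are arbitrary, possibly not measurable; the zero seminorm replaces
   their norms. *)
pose m (n : nat) (u : obs R d) : R :=
  if (1 < n)%N then fine (L1norm_on (confs_in (Lambda n)) C u) else 0.
have mL n (n1 : (1 < n)%N) : measurable (confs_in (Lambda n)).
  by apply: measurable_confs_in; exact: Lambda_meas.
have rS : seminorm_on E r by exact: fine_L1norm_on_seminorm.
have rE u : E u -> L1norm C u = (r u)%:E by move=> Eu; rewrite fineK// L1norm_on_fin.
have r_le u e : E u -> (L1norm C u < e%:E)%E -> r u <= e.
  by move=> Eu; rewrite rE// lte_fin; exact: ltW.
have mS n : seminorm_on E (m n).
  rewrite /m; case: (boolP (1 < n)%N) => n1 /=; first exact: fine_L1norm_on_seminorm (mL _ n1).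
  by split=> // *; rewrite ?addr0 ?mulr0.
have m_le n u : E u -> m n u <= r u.
  move=> Eu; rewrite /m; case: ifPn => n1; last exact: seminorm_ge0 rS u.
  rewrite -lee_fin -rE// fineK ?L1norm_on_fin//; last exact: mL.
  by apply: L1norm_on_le_L1norm => //; [exact: mL|exact: Eu.1].
(* [S n] keeps [phi], as in the statement; the estimates reach it through [SpsiE], since they need a
   potential that is nonnegative at the origin too. *)
pose S n : obs R d -> obs R d := Phat_on phi z (Lambda n) n%:R^-1.
have SpsiE n u : (1 < n)%N -> E u -> S n u = Phat_on psi z (Lambda n) n%:R^-1 u.
  by move=> n1 [mu _]; apply: eq_Phat_on => //; exact: Lambda_meas.
have mSu n u : (1 < n)%N -> E u -> measurable_fun setT (S n u).
  move=> n1 Eu; rewrite SpsiE//; apply: measurable_Phat_on => //.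
  - exact: Lambda_meas.
  - exact: inv_nat_itv.
  - exact: Eu.1.
have S_contr n u : (1 < n)%N -> E u ->
    (L1norm_on (confs_in (Lambda n)) C (S n u) <= L1norm_on (confs_in (Lambda n)) C u)%E.
  move=> n1 Eu; rewrite SpsiE//.
  exact: (Phat_on_contraction d_gt0 mpsi psi_ge0 C_psiE z_gt0 C_gt0 zC
    (Lambda_meas n n1) (@inv_nat_itv R n n1) Eu.1).
have SE n : (1 < n)%N -> forall u, E u -> E (S n u).
  move=> n1 u Eu; split; first exact: mSu.
  rewrite /S /Phat_on L1norm_cutoff; last exact: Lambda_meas.
  apply: (le_lt_trans (S_contr n u n1 Eu)).
  apply: le_lt_trans (L1norm_on_le_L1norm (mL n n1) C0 Eu.1) _; exact: Eu.2.
have S_le n : (1 < n)%N -> forall u, E u -> m n (S n u) <= m n u.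
  move=> n1 u Eu; rewrite /m n1 fine_le ?S_contr// L1norm_on_fin//; try exact: mL.
  exact: SE.
have S_lin n : (1 < n)%N -> forall (a : R) u v, E u -> E v ->
    m n (S n (a *: u + v) - (a *: S n u + S n v)) = 0.
  move=> n1 a u v Eu Ev; rewrite /m n1.
  have Euv : E (a *: u + v) by exact: Esub.2.
  have fin w : E w -> (L1norm_on (confs_in (Lambda n)) C w < +oo)%E.
    by move=> Ew; rewrite ltey_eq L1norm_on_fin//; exact: mL.
  rewrite (@ae_eq_L1norm_on _ _ _ _ (mL n n1) _ (0 : obs R d)).
  - rewrite /L1norm_on; under eq_integral do rewrite normr0 mul0r.
    by rewrite integral0.
  - apply: measurable_funB; first exact: mSu.
    by apply: measurable_funD; [apply: measurable_funM => //|]; exact: mSu.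
  - exact: measurable_cst.
  have := Phat_on_linear d_gt0 mpsi psi_ge0 C_psiE z_gt0 C_gt0 zC
    (Lambda_meas n n1) (@inv_nat_itv R n n1) a Eu.1 Ev.1 (fin u Eu) (fin v Ev).
  apply: filterS => eta lin _; rewrite !SpsiE//.
  have -> : (Phat_on psi z (Lambda n) n%:R^-1 (a *: u + v) -
      (a *: Phat_on psi z (Lambda n) n%:R^-1 u + Phat_on psi z (Lambda n) n%:R^-1 v)) eta =
    Phat_on psi z (Lambda n) n%:R^-1 (a *: u + v) eta -
      (a *: Phat_on psi z (Lambda n) n%:R^-1 u + Phat_on psi z (Lambda n) n%:R^-1 v) eta.
    by [].
  by rewrite lin subrr.
have DE : (L1 (2 * C) : set (obs R d)) `<=` E.
  move=> u [mu ufin]; split=> //; apply: le_lt_trans ufin.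
  apply: ge0_le_integral => //.
  - by move=> eta _; rewrite lee_fin mulr_ge0// exprn_ge0.
  - exact: measurable_weighted_norm.
  - exact: measurable_weighted_norm.
  - move=> eta _; rewrite lee_fin ler_wpM2l//; apply: lerXn2r; rewrite ?nnegrE ?mulr_ge0//.
    by rewrite ler_peMl// ler1n.
have AE u : L1 (2 * C) u -> E (Lhat phi z u).
  move=> Du; rewrite (eq_Lhat d_gt0 mphi mpsi phi_psi)//; last exact: Du.1.
  exact: (L1_Lhat d_gt0 mpsi psi_ge0 psi_even C_psiE z_gt0 C_gt0 zC).
have TE' t : 0 <= t -> forall u, E u -> E (T t u) by move=> t0 u Eu; exact: TE.
(* For [t > 0] the norm of the difference quotient minus [v] is [t^-1] times the quantity in
   [in_generator]; halving [e] turns a weak inequality into a strict one. *)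
have gen_iff u v : in_generator E r T u v <-> generator_graph (L1 C) (L1norm C) T (u, v).
  have step t : 0 < t -> E u -> E v -> L1norm C (t^-1 *: (T t u - u) - v) =
      (t^-1 * r (T t u - u - t *: v))%:E.
    move=> t0 Eu Ev.
    have ETu : E (T t u - u) by apply: (subspaceB Esub) => //; apply: TE' => //; exact: ltW.
    have Etv : E (t *: v) by exact: (subspaceZ Esub).
    have -> : t^-1 *: (T t u - u) - v = t^-1 *: (T t u - u - t *: v).
      by rewrite [RHS]scalerBr scalerA mulVf ?gt_eqF// scale1r.
    rewrite rE; last by apply/(subspaceZ Esub)/(subspaceB Esub).
    rewrite (seminormZ rS); last exact: (subspaceB Esub).
    by rewrite gtr0_norm// invr_gt0.
  have N0 t : (0 <= L1norm C (t^-1 *: (T t u - u) - v)%R)%E by exact: L1norm_on_ge0.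
  split=> [[Eu Ev guv]|[/= Eu Ev /(ge0_cvg0P _ N0) guv]]; split=> //.
    apply/ge0_cvg0P => // e e0; apply/near_at_right0.
    have [h h0 hh] := guv _ (divr_gt0 e0 (ltr0Sn _ 1)); exists h => // t th.
    have t0 : 0 < t by case/andP: th.
    rewrite step// lte_fin mulrC ltr_pdivrMr//; apply: le_lt_trans (hh _ th) _.
    by rewrite ltr_pM2r// ltr_pdivrMr// ltr_pMr// ltr1n.
  move=> e /guv /near_at_right0[h h0 hh]; exists h => // t th.
  have t0 : 0 < t by case/andP: th.
  by have := hh t th; rewrite step// lte_fin mulrC ltr_pdivrMr// => /ltW.
have D_generator u : L1 (2 * C) u -> in_generator E r T u (Lhat phi z u).
  move=> Du; apply/gen_iff; rewrite genT; split=> /=; [exact: DE|exact: AE|].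
  exists (fun=> u); split=> //; rewrite subrr.
    by rewrite (rE _ Esub.1) (seminorm0 Esub rS); exact: cvg_cst.
  by rewrite (rE _ Esub.1) (seminorm0 Esub rS); exact: cvg_cst.
(* By [genT], a pair in the graph of the generator is a limit of pairs [(F k, Lhat phi z (F k))]
   with [F k] in the domain, so one large [k] serves both coordinates. *)
have D_core u v e : in_generator E r T u v -> 0 < e ->
    exists w, [/\ L1 (2 * C) w, r (u - w) <= e & r (v - Lhat phi z w) <= e].
  move=> /gen_iff; rewrite genT => -[/= Eu Ev [F [DF Fu Fv]]] e0.
  have := (ge0_cvg0P (F := \oo) _ (fun k => L1norm_on_ge0 setT C0 (F k - u))).1 Fu _ e0.
  have := (ge0_cvg0P (F := \oo) _
    (fun k => L1norm_on_ge0 setT C0 (Lhat phi z (F k) - v))).1 Fv _ e0.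
  move=> near_v near_u; near \oo => k.
  have EF := DE _ (DF k); have EAF := AE _ (DF k).
  have EuF : E (F k - u) by exact: (subspaceB Esub).
  have EvF : E (Lhat phi z (F k) - v) by exact: (subspaceB Esub).
  exists (F k); split=> //; rewrite (seminorm_subC Esub rS)//; apply: r_le => //.
  - by near: k; exact: near_u.
  - by near: k; exact: near_v.
have D_dense u e : E u -> 0 < e -> exists2 w, L1 (2 * C) w & r (u - w) <= e.
  move=> Eu e0; have [w Dw uw] := L1_truncation_dense C_gt0 Eu e0; exists w => //.
  have Euw : E (u - w) by apply: (subspaceB Esub) => //; exact: DE.
  exact: r_le.
have consistency u e : L1 (2 * C) u -> 0 < e ->
    \forall n \near \oo, m n (n%:R *: (S n u - u) - Lhat phi z u) <= e.
  move=> Du e0; have Eu := DE _ Du.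
  have := discrete_generator_cvg d_gt0 mpsi psi_ge0 psi_even C_psiE z_gt0 C_gt0 zC
    Lambda_meas Lambda_incr Lambda_cover Du e0.
  apply: filterS2 (nbhs_infty_gt 1) => n n1 hn; rewrite /m n1 SpsiE//.
  rewrite (eq_Lhat d_gt0 mphi mpsi phi_psi)//; last exact: Du.1.
  rewrite -lee_fin fineK ?ltW// ge0_fin_numE ?L1norm_on_ge0//.
  exact: lt_trans hn (ltry _).
have T_cont' u e : E u -> 0 < e ->
    exists2 h, 0 < h & forall t, 0 <= t <= h -> r (T t u - u) <= e.
  move=> Eu e0.
  have /near_at_right0[h h0 hh] : \forall t \near 0^'+, (L1norm C (T t u - u)%R < e%:E)%E.
    by apply: (ge0_cvg0P _ (fun t => L1norm_on_ge0 setT C0 (T t u - u))).1 e0; exact: T_cont.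
  exists h => // t /andP[].
  rewrite le_eqVlt => /predU1P[<- _|t0 th].
    by rewrite /r T_id//= ltW.
  apply: r_le; last by apply: hh; rewrite t0.
  by apply: (subspaceB Esub) => //; apply: TE' => //; exact: ltW.
have T_lin' t : 0 <= t -> forall (a : R) u v, E u -> E v ->
    r (T t (a *: u + v) - (a *: T t u + T t v)) = 0.
  by move=> t0 a u v Eu Ev; rewrite /r T_lin.
have T_id' u : E u -> r (T 0 u - u) = 0 by move=> Eu; rewrite /r T_id.
have T_add' (s t : R) u : 0 <= s -> 0 <= t -> E u -> r (T (s + t) u - T s (T t u)) = 0.
  by move=> s0 t0 Eu; rewrite /r T_add.
have T_le' t : 0 <= t -> forall u, E u -> r (T t u) <= r u.
  by move=> t0 u Eu; rewrite -lee_fin -!rE ?T_le//; exact: TE'.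
have := trotter_approximation Esub rS mS m_le SE S_lin S_le TE' T_lin' T_id' T_add' T_le'
  T_cont' DE AE consistency D_dense D_generator D_core tau G_L1
  (divr_gt0 eps0 (ltr0Sn _ 1)).
apply: filterS2 (nbhs_infty_gt 1) => n n1 hn t tt; have /andP[t0 _] := tt.
have EST : E (iter (Num.truncn (n%:R * t)) (S n) G - T t G).
  apply: (subspaceB Esub); last exact: TE'.
  by apply: iter_E => //; exact: SE.
(* On [confs_in (Lambda n)] both cut-offs act as the identity, so the norm in the statement is [m n]
   of the difference without cut-offs. *)
rewrite (_ : L1norm_on _ _ _ = (m n (iter (Num.truncn (n%:R * t)) (S n) G - T t G))%:E).
  rewrite lte_fin; apply: le_lt_trans (hn t tt) _.
  by rewrite ltr_pdivrMr// ltr_pMr// ltr1n.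
rewrite /m n1 fineK; last by apply: L1norm_on_fin => //; exact: mL.
apply: eq_integral => eta; rewrite inE => etaL; congr (`|_| * _)%:E.
by rewrite /= iter_Phat_on_cutoff// /cutoff -/(in_conf (Lambda n) eta) in_confE// mul1r.
Unshelve. all: by end_near. Qed.
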